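(* Let $\Omega$ be an open subset of $\mathbb{R}^n$, and let $x_0\in\partial\Omega$. Assume that $\Omega$ satisfies an interior sphere condition at $x_0$, with interior balls $B_r(x_r)$, $r\in(0,\bar r]$. Let $s\in(0,1)$, let $a\in L^\infty(S^{n-1})$ be such that $a(\theta)=a(-\theta)$ and $\lambda\leqslant a(\theta)\leqslant\Lambda$ for all $\theta\in S^{n-1}$, for some constants $0<\lambda\leqslant\Lambda$, and let $L$ be the operator $$Lw(x)=PV\int_{\mathbb{R}^n}\frac{w(x)-w(x+y)}{|y|^{n+2s}}\,a\left(\frac{y}{|y|}\right)dy.$$ Let $u\in\mathcal{Z}_\Omega$ be such that $u(x_0)=0$ and $u^-\in L^\infty(\mathbb{R}^n)$. Suppose that $$Lu\geqslant V(x)\,u\quad\text{in }\Omega$$ pointwise, where $V\in L^1_{\mathrm{loc}}(\Omega)$ is such that $V^-\in L^\infty(\Omega)$. Suppose moreover that there exists $R>0$ such that $u\geqslant0$ in $B_R(x_0)$, $u>0$ in $B_R(x_0)\cap\Omega$, and that $u$ grows faster than the power $2s$ at $x_0$. Then, for every $\beta\in(0,\pi/2)$, $$\liminf_{\Omega\ni x\to x_0}\frac{u(x)}{|x-x_0|^s}>0,$$ where the $\liminf$ is taken over those $x$ such that the angle between $x-x_0$ and the vector joining $x_0$ to the center of the interior sphere is smaller than $\pi/2-\beta$. In particular, if $d(x):=\mathrm{dist}(x,\partial\Omega)$, and $u/d^s$ can be extended as a continuous function on a neighborhood of $x_0$ in $\partial\Omega$, then $$\frac{u}{d^s}(x_0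)>0.$$
   Context: $f^+:=\max\{f,0\}$ and $f^-:=\max\{-f,0\}$ denote the positive and negative parts of $f$. $PV$ stands for principal value, i.e. the limit as $\varepsilon\searrow0$ of the integral over $\mathbb{R}^n\setminus B_\varepsilon$. $\mathcal{Z}_\Omega$ is the space of continuous functions $u:\mathbb{R}^n\to\mathbb{R}$ such that $\int_{\mathbb{R}^n}\frac{|u(x)|}{1+|x|^{n+2s}}\,dx<+\infty$ and such that for every $x\in\Omega$ the limit $\lim_{\varepsilon\searrow0}\int_{\mathbb{R}^n\setminus B_\varepsilon}\frac{u(x)-u(x+y)}{|y|^{n+2s}}a\left(\frac{y}{|y|}\right)dy$ exists. Interior sphere condition at $x_0\in\partial\Omega$: there exists $\bar r>0$ such that, for every $r\in(0,\bar r]$, there exists a ball $B_r(x_r)\subseteq\Omega$ with $x_0\in(\partial\Omega)\cap(\partial B_r(x_r))$. Growth condition: given a continuous function $u:\mathbb{R}^n\to\mathbb{R}$ with $u(x_0)=0$ and $|u|>0$ in $B_r(x_r)$ for every sufficiently small $r$, we say that $u$ grows faster than the power $2s$ at $x_0$ if $\limsup_{r\to0^+}\Phi(r)=+\infty$, where $\Phi(r):=\frac{\inf_{B_{r/2}(x_r)}|u|}{r^{2s}}$. *)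

(* Defs.v *)
From HB Require Import structures.
From mathcomp Require Import all_boot all_order all_algebra.
From mathcomp Require Import all_classical all_reals all_analysis.
From mathcomp Require Import measurable_realfun.

Set Implicit Arguments.
Unset Strict Implicit.
Unset Printing Implicit Defensive.

Import Order.TTheory GRing.Theory Num.Theory.
Import numFieldNormedType.Exports.

Local Open Scope classical_set_scope.
Local Open Scope ring_scope.

(* The library norm on 'rV[R]_n is the sup norm; it only serves here through
   the topology, which is the Euclidean one. *)
Definition dotv (R : realType) (n : nat) (x y : 'rV[R]_n) : R :=
  \sum_(i < n) x 0 i * y 0 i.

Definition enorm (R : realType) (n : nat) (x : 'rV[R]_n) : R :=
  Num.sqrt (dotv x x).

Definition eball (R : realType) (n : nat) (c : 'rV[R]_n) (r : R) :
  set 'rV[R]_n := [set x | enorm (x - c) < r].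

Definition usphere (R : realType) (n : nat) : set 'rV[R]_n :=
  [set x | enorm x = 1].

Definition boundary (T : topologicalType) (A : set T) : set T :=
  closure A `\` A^°.

Definition dist_to (R : realType) (n : nat) (A : set 'rV[R]_n)
  (x : 'rV[R]_n) : R := inf [set enorm (x - y) | y in A].

Definition angle (R : realType) (n : nat) (x y : 'rV[R]_n) : R :=
  acos (dotv x y / (enorm x * enorm y)).

Definition normalize (R : realType) (n : nat) (x : 'rV[R]_n) : 'rV[R]_n :=
  (enorm x)^-1 *: x.

(* The sigma-algebra generated by the coordinates, i.e. the Borel
   sigma-algebra of R^n. *)
Definition rV_display : measure_display. Proof. exact. Qed.

Section measurable_rV.
Variables (R : realType) (n : nat).

Let coord (i : 'I_n) (x : 'rV[R]_n) : measurableTypeR R := x 0 i.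

Let rV_set0 : g_sigma_preimage coord set0.
Proof. exact: sigma_algebra0. Qed.

Let rV_setC A : g_sigma_preimage coord A -> g_sigma_preimage coord (~` A).
Proof. exact: sigma_algebraC. Qed.

Let rV_bigcup (F : _^nat) : (forall i, g_sigma_preimage coord (F i)) ->
  g_sigma_preimage coord (\bigcup_i (F i)).
Proof. exact: sigma_algebra_bigcup. Qed.

HB.instance Definition _ := @isMeasurable.Build rV_display
  'rV[R]_n (g_sigma_preimage coord) rV_set0 rV_setC rV_bigcup.

Lemma measurable_coord (i : 'I_n) :
  measurable_fun [set: 'rV[R]_n] (fun x => x 0 i : measurableTypeR R).
Proof.
move=> _ Y mY; rewrite setTI; apply: sub_sigma_algebra => /=.
rewrite -bigcup_seq/=; exists i => /=; first by rewrite mem_index_enum.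
by exists Y => //; rewrite setTI.
Qed.

Lemma measurable_fun_rVP d (T : measurableType d) (f : T -> 'rV[R]_n) :
  (forall i, measurable_fun [set: T] (fun x => f x 0 i : measurableTypeR R)) ->
  measurable_fun [set: T] f.
Proof.
move=> mf; suff : g_sigma_preimage (fun i => coord i \o f) `<=` measurable.
  rewrite g_sigma_preimage_comp => prefS.
  by move=> _ A mA; apply: prefS; exists A.
apply: smallest_sub; first exact: sigma_algebra_measurable.
rewrite -bigcup_seq => A [i _] [B mB <-].
exact: mf.
Qed.

End measurable_rV.

Section lebesgue_rV.
Variable R : realType.

Definition cons_rV (n : nat) (p : measurableTypeR R * 'rV[R]_n) :
  'rV[R]_n.+1 := \row_i (if unlift ord0 i is Some j then p.2 0 j else p.1).

Definition uncons_rV (n : nat) (x : 'rV[R]_n.+1) :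
  measurableTypeR R * 'rV[R]_n := (x 0 ord0, \row_j x 0 (lift ord0 j)).

Lemma cons_rVK n : cancel (@cons_rV n) (@uncons_rV n).
Proof.
move=> [a v]; rewrite /uncons_rV /cons_rV mxE unlift_none; congr (_, _).
by apply/rowP => j; rewrite !mxE liftK.
Qed.

Lemma uncons_rVK n : cancel (@uncons_rV n) (@cons_rV n).
Proof.
move=> x; apply/rowP => i; rewrite !mxE.
by case: unliftP => [j ->|->] //=; rewrite mxE.
Qed.

Lemma measurable_cons_rV n : measurable_fun setT (@cons_rV n).
Proof.
apply: measurable_fun_rVP => i.
case: (unliftP ord0 i) => [j|] ->.
  rewrite (_ : (fun _ => _) =
    (fun x : 'rV[R]_n => x 0 j : measurableTypeR R) \o snd); last first.
    by apply/funext => p; rewrite /= mxE liftK.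
  by apply: measurableT_comp => //; exact: measurable_coord.
rewrite (_ : (fun _ => _) = fst); first exact: measurable_fst.
by apply/funext => p; rewrite /= mxE unlift_none.
Qed.

Lemma measurable_uncons_rV n : measurable_fun setT (@uncons_rV n).
Proof.
apply: measurable_fun_pair; first exact: measurable_coord.
apply: measurable_fun_rVP => i.
under eq_fun do rewrite mxE.
exact: measurable_coord.
Qed.

Section step.
Variables (n : nat) (m : {sigma_finite_measure set 'rV[R]_n -> \bar R}).

Definition lebesgue_step : set 'rV[R]_n.+1 -> \bar R :=
  pushforward (lebesgue_measure \x m)%E (@cons_rV n).

Let lebesgue_step0 : lebesgue_step set0 = 0%E.
Proof. by rewrite /lebesgue_step /pushforward preimage_set0 measure0. Qed.

Let lebesgue_step_ge0 A : (0 <= lebesgue_step A)%E.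
Proof. by rewrite /lebesgue_step /pushforward measure_ge0. Qed.

Let lebesgue_step_sigma_additive : semi_sigma_additive lebesgue_step.
Proof.
have mcons A : measurable A -> measurable (@cons_rV n @^-1` A).
  by move=> mA; rewrite -[X in measurable X]setTI; exact: measurable_cons_rV.
move=> F mF tF mUF; rewrite /lebesgue_step /pushforward preimage_bigcup.
apply: measure_semi_sigma_additive.
- by move=> k; exact: mcons.
- apply/trivIsetP => /= i j _ _ ij; rewrite -preimage_setI.
  by move/trivIsetP : tF => /(_ _ _ _ _ ij) ->//; rewrite preimage_set0.
- by rewrite -preimage_bigcup; exact: mcons.
Qed.

HB.instance Definition _ := isMeasure.Build _ _ _ lebesgue_step
  lebesgue_step0 lebesgue_step_ge0 lebesgue_step_sigma_additive.

Let lebesgue_step_sigma_finite : sigma_finite setT lebesgue_step.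
Proof.
have /sigma_finiteP[F [TF ndF Foo]] :=
  sigma_finiteT (@lebesgue_measure R : {sigma_finite_measure set _ -> \bar R}).
have /sigma_finiteP[G [TG ndG Goo]] := sigma_finiteT m.
exists (fun k => @uncons_rV n @^-1` (F k `*` G k)).
  rewrite -preimage_bigcup (_ : \bigcup_k _ = setT) ?preimage_setT//.
  rewrite -subTset => -[x y] _.
  have [i _ Fi] : (\bigcup_k F k) x by rewrite -TF.
  have [j _ Gj] : (\bigcup_k G k) y by rewrite -TG.
  exists (maxn i j) => //; split.
  - by move: x Fi; exact/subsetPset/ndF/leq_maxl.
  - by move: y Gj; exact/subsetPset/ndG/leq_maxr.
move=> k; have [mF Fkoo] := Foo k; have [mG Gkoo] := Goo k; split.
  rewrite -[X in measurable X]setTI; apply: measurable_uncons_rV => //.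
  exact: measurableX.
rewrite /lebesgue_step /pushforward -comp_preimage.
rewrite (_ : uncons_rV (n:=n) \o cons_rV (n:=n) = id).
  rewrite preimage_id product_measure1E//.
  by rewrite lte_mul_pinfty// ge0_fin_numE.
by apply/funext => p; exact: cons_rVK.
Qed.

HB.instance Definition _ := Measure_isSigmaFinite.Build _ _ _ lebesgue_step
  lebesgue_step_sigma_finite.
End step.

(* n-dimensional Lebesgue measure, as the iterated product of the
   one-dimensional one; R^0 is a point of mass 1. *)
Fixpoint lebesgue_rV (n : nat) :
    {sigma_finite_measure set 'rV[R]_n -> \bar R} :=
  match n with
  | 0%N => dirac (0 : 'rV[R]_0)
  | n'.+1 => lebesgue_step (lebesgue_rV n')
  end.

End lebesgue_rV.

Section surface_measure.
Variables (R : realType) (n : nat).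

Lemma measurable_enorm :
  measurable_fun setT (@enorm R n : _ -> measurableTypeR R).
Proof.
rewrite /enorm /dotv; apply: (@measurableT_comp _ _ _ _ _ _ (@Num.sqrt R)).
  by apply: continuous_measurable_fun => x; exact: sqrt_continuous.
apply: measurable_sum => i; apply: measurable_funM; exact: measurable_coord.
Qed.

Lemma measurable_normalize : measurable_fun setT (@normalize R n).
Proof.
apply: measurable_fun_rVP => i.
under eq_fun do rewrite mxE.
apply: measurable_funM; last exact: measurable_coord.
rewrite (_ : (fun _ => _) = (@powR R ^~ (-1)) \o @enorm R n); last first.
  by apply/funext => x; rewrite /= powR_inv1// sqrtr_ge0.
by apply: measurableT_comp; [exact: measurable_powR | exact: measurable_enorm].
Qed.

(* The surface measure of the unit sphere, as the cone measure
   A |-> n * |{t x : x \in A, 0 < t < 1}|; it is 0 off the sphere. *)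
Definition surface_measure (A : set 'rV[R]_n) : \bar R :=
  (n%:R%:E * lebesgue_rV R n
     ([set x | (0 < enorm x < 1)%R] `&` @normalize R n @^-1` A))%E.

Let cone_measurable A : measurable A ->
  measurable ([set x | 0 < enorm x < 1] `&` @normalize R n @^-1` A).
Proof.
move=> mA; apply: measurableI; last first.
  by rewrite -[X in measurable X]setTI; exact: measurable_normalize.
rewrite (_ : [set _ | _] = setT `&` (@enorm R n) @^-1` `]0, 1[%classic).
  by apply: measurable_enorm => //; exact: measurable_itv.
by rewrite setTI; apply/seteqP; split => x /=; rewrite in_itv.
Qed.

Let surface_measure0 : surface_measure set0 = 0%E.
Proof.
by rewrite /surface_measure preimage_set0 setI0 measure0 mule0.
Qed.

Let surface_measure_ge0 A : (0 <= surface_measure A)%E.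
Proof. by rewrite mule_ge0. Qed.

Let surface_measure_sigma_additive : semi_sigma_additive surface_measure.
Proof.
move=> F mF tF mUF; rewrite /surface_measure.
rewrite (_ : (fun _ => _) = (fun k => n%:R%:E * \sum_(0 <= i < k)
  lebesgue_rV R n ([set x | (0 < enorm x < 1)%R] `&`
    @normalize R n @^-1` (F i)))%E); last first.
  by apply/funext => k; rewrite ge0_sume_distrr.
apply: cvgeZl => //; rewrite preimage_bigcup setI_bigcupr.
apply: measure_semi_sigma_additive.
- by move=> k; exact: cone_measurable.
- apply/trivIsetP => /= i j _ _ ij; rewrite setIACA -preimage_setI.
  by move/trivIsetP : tF => /(_ _ _ _ _ ij) ->//; rewrite preimage_set0 setI0.
- rewrite -setI_bigcupr -preimage_bigcup; exact: cone_measurable.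
Qed.

HB.instance Definition _ := isMeasure.Build _ _ _ surface_measure
  surface_measure0 surface_measure_ge0 surface_measure_sigma_additive.

End surface_measure.

Arguments lebesgue_rV : clear implicits.
Arguments usphere : clear implicits.
Arguments surface_measure : clear implicits.

Section Lebesgue_spaces.
Context d (T : measurableType d) (R : realType).
Variable mu : {measure set T -> \bar R}.

(* Measurability for the completion of mu: on R^n the sigma-algebra is Borel,
   whereas L^oo and L^1_loc consist of Lebesgue measurable functions. *)
Definition ae_measurable (D : set T) (f : T -> R) : Prop :=
  exists2 g : T -> R, measurable_fun setT g &
    {ae mu, forall x, D x -> f x = g x}.

Definition Linfty (D : set T) (f : T -> R) : Prop :=
  ae_measurable D f /\ finite_norm mu +oo%E (f \_ D).

End Lebesgue_spaces.

Definition L1loc (R : realType) (n : nat) (D : set 'rV[R]_n)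
    (f : 'rV[R]_n -> R) : Prop :=
  ae_measurable (lebesgue_rV R n) D f /\
  forall K, K `<=` D -> compact K ->
    (\int[lebesgue_rV R n]_(x in K) `|(f x)%:E| < +oo)%E.

Section nonlocal_operator.
Variables (R : realType) (n : nat) (s : R) (a : 'rV[R]_n -> R).

(* a is only evaluated on the unit sphere. The integral is real valued: the
   integrand is integrable as soon as w satisfies the weighted integrability
   condition of Zspace and a is bounded and measurable on the sphere. *)
Definition truncatedL (w : 'rV[R]_n -> R) (x : 'rV[R]_n) (e : R) : R :=
  \int[lebesgue_rV R n]_(y in ~` eball 0 e)
    ((w x - w (x + y)) / enorm y `^ (n%:R + 2 * s) * a (normalize y)).

(* The principal value, a junk value when the limit does not exist. *)
Definition nonlocalL (w : 'rV[R]_n -> R) (x : 'rV[R]_n) : R :=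
  lim (truncatedL w x e @[e --> 0^'+]).

Definition Zspace (Omega : set 'rV[R]_n) (u : 'rV[R]_n -> R) : Prop :=
  [/\ continuous u,
      (\int[lebesgue_rV R n]_x
         (`|u x| / (1 + enorm x `^ (n%:R + 2 * s)))%:E < +oo)%E &
      forall x, Omega x -> cvg (truncatedL u x e @[e --> 0^'+])].

End nonlocal_operator.

(* c r is the centre of the interior ball of radius r; only its values for
   0 < r <= rbar matter. *)
Definition interior_balls (R : realType) (n : nat) (Omega : set 'rV[R]_n)
    (x0 : 'rV[R]_n) (rbar : R) (c : R -> 'rV[R]_n) : Prop :=
  0 < rbar /\
  forall r, 0 < r <= rbar ->
    eball (c r) r `<=` Omega /\
    (boundary Omega `&` boundary (eball (c r) r)) x0.

Definition growth_ratio (R : realType) (n : nat) (s : R)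
    (c : R -> 'rV[R]_n) (u : 'rV[R]_n -> R) (r : R) : R :=
  inf [set `|u x| | x in eball (c r) (r / 2)] / r `^ (2 * s).

Definition grows_faster (R : realType) (n : nat) (s : R) (x0 : 'rV[R]_n)
    (c : R -> 'rV[R]_n) (u : 'rV[R]_n -> R) : Prop :=
  [/\ u x0 = 0,
      \forall r \near 0^'+, forall x, eball (c r) r x -> 0 < `|u x| &
      limf_esup (fun r => (growth_ratio s c u r)%:E) 0^'+ = +oo%E].

(* f, defined on Omega, extends continuously to a neighbourhood of x0 in the
   boundary of Omega, with extension g. *)
Definition continuous_extension (R : realType) (n : nat)
    (Omega : set 'rV[R]_n) (x0 : 'rV[R]_n) (f g : 'rV[R]_n -> R) : Prop :=
  {in Omega, f =1 g} /\
  exists2 U, nbhs x0 U & {within Omega `|` (boundary Omega `&` U), continuous g}.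

(* Main.v *)
(* The barrier [psi z r x = max (0, r^2 - |x - z|^2) ^ s] has bounded fractional
   operator in the ball [B_r(z)]: along each line through [x] it is dominated by
   the s-th power of its tangent, which is harmonic for the one-dimensional
   operator, with an error controlled by scaling. If [u >= K] on a ball of radius
   comparable to [r] and at comparable distance, then at a negative minimum of
   [u - theta K r^(-2s) psi] the nonlocal push of that ball, of order
   [K r^(-2s)], beats the bounded terms as soon as [K >= C r^(2s)]; hence
   [u >= theta K r^(-2s) psi] in [B_r(z)]. The growth condition provides one
   scale [r0] at which this applies; there [u >= c psi], which is of order [r^s]
   at the points at distance comparable to [r] from [x0] on the axis, and
   [r^s] exceeds [C r^(2s)] for all small [r]. A second comparison, in interior
   balls of any direction, then gives [u >= c |x - x0|^s] in cones.
   Since [V^-] is only essentially bounded, the lower bound of [L u] may fail on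
   a null set; a small continuous potential whose operator blows up there is
   added to the test function. *)
From HB Require Import structures.
Require Import Defs.
From mathcomp Require Import all_boot all_order all_algebra finmap.
From mathcomp Require Import all_classical all_reals all_analysis.
From mathcomp Require Import measurable_realfun ess_sup_inf ring lra.

Set Implicit Arguments.
Unset Strict Implicit.
Unset Printing Implicit Defensive.

Import Order.TTheory GRing.Theory Num.Theory.
Import numFieldNormedType.Exports.

Local Open Scope classical_set_scope.
Local Open Scope ring_scope.

(** Three weak hypotheses shape the argument. The interior balls may turn with the radius and the
    growth condition is only a limsup along them, so nothing can be read off at two radii at once;
    every scale below the chosen one has to be produced by the barrier. The solution is bounded
    below but not above, so it is replaced by its minimum with 1: near x0 this changes nothing, and
    the height cut off far away can only increase the operator. Finally L u >= - M is known off a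
    null set only, and the minimum of a difference may sit exactly there; with a coefficient that is
    merely bounded and measurable there is neither regularity nor a fundamental solution to move it
    away. The compensating potential is therefore built from resolvents of truncated operators, by
    order-preserving averages alone. Its own operator need not converge, which is why the comparison
    is made at one well chosen truncation radius, the principal value entering only through the
    convergence of the truncated operators of the solution. *)

(** * Euclidean norm and Lebesgue measure *)

Section euclidean.
Context {R : realType} {n : nat}.
Implicit Types (x y z : 'rV[R]_n) (t r : R).

Lemma dotvC x y : dotv x y = dotv y x.
Proof. by apply: eq_bigr => i _; rewrite mulrC. Qed.

Lemma dotvDl x y z : dotv (x + y) z = dotv x z + dotv y z.
Proof. by rewrite /dotv -big_split; apply: eq_bigr => i _; rewrite mxE mulrDl. Qed.

Lemma dotvDr x y z : dotv z (x + y) = dotv z x + dotv z y.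
Proof. by rewrite dotvC dotvDl !(dotvC z). Qed.

Lemma dotvZl t x y : dotv (t *: x) y = t * dotv x y.
Proof. by rewrite /dotv mulr_sumr; apply: eq_bigr => i _; rewrite mxE mulrA. Qed.

Lemma dotvZr t x y : dotv y (t *: x) = t * dotv y x.
Proof. by rewrite dotvC dotvZl dotvC. Qed.

Lemma dotvNl x y : dotv (- x) y = - dotv x y.
Proof. by rewrite -scaleN1r dotvZl mulN1r. Qed.

Lemma dotvNr x y : dotv y (- x) = - dotv y x.
Proof. by rewrite dotvC dotvNl dotvC. Qed.

Lemma dotv_ge0 x : 0 <= dotv x x.
Proof. by apply: sumr_ge0 => i _; rewrite -expr2 sqr_ge0. Qed.

Lemma enorm_ge0 x : 0 <= enorm x.
Proof. exact: sqrtr_ge0. Qed.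

Lemma sqr_enorm x : enorm x ^+ 2 = dotv x x.
Proof. by rewrite sqr_sqrtr// dotv_ge0. Qed.

Lemma enormZ t x : enorm (t *: x) = `|t| * enorm x.
Proof.
by rewrite /enorm dotvZl dotvZr mulrA -expr2 sqrtrM ?sqr_ge0// sqrtr_sqr.
Qed.

Lemma enormN x : enorm (- x) = enorm x.
Proof. by rewrite -scaleN1r enormZ normrN1 mul1r. Qed.

Lemma enorm0 : enorm (0 : 'rV[R]_n) = 0.
Proof. by rewrite -(scale0r 0) enormZ normr0 mul0r. Qed.

Lemma enormBC x y : enorm (x - y) = enorm (y - x).
Proof. by rewrite -enormN opprB. Qed.

Lemma ler_coord_enorm x i : `|x 0 i| <= enorm x.
Proof.
rewrite -[leLHS]sqrtr_sqr ler_sqrt ?dotv_ge0//.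
rewrite /dotv (bigD1 i)//= -expr2 lerDl.
by apply: sumr_ge0 => j _; rewrite -expr2 sqr_ge0.
Qed.

Lemma enorm_eq0 x : enorm x = 0 -> x = 0.
Proof.
move=> x0; apply/rowP => i; rewrite mxE; apply/eqP.
by rewrite -normr_le0 -x0 ler_coord_enorm.
Qed.

Lemma dotv_enormM x y : dotv x y <= enorm x * enorm y.
Proof.
have [x0|x0] := eqVneq (enorm x) 0.
  by rewrite x0 mul0r (enorm_eq0 x0) -(scale0r 0) dotvZl mul0r.
have [y0|y0] := eqVneq (enorm y) 0.
  by rewrite y0 mulr0 (enorm_eq0 y0) -(scale0r 0) dotvZr mul0r.
have x1 : 0 < enorm x by rewrite lt_def x0 enorm_ge0.
have y1 : 0 < enorm y by rewrite lt_def y0 enorm_ge0.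
have := dotv_ge0 (enorm y *: x - enorm x *: y).
rewrite dotvDl !dotvDr dotvNl !dotvNr !dotvZl !dotvZr dotvNl dotvZl.
rewrite -!sqr_enorm (dotvC y x) => h.
have {}h : 0 <= (enorm x * enorm y) * (enorm x * enorm y - dotv x y) by nra.
by rewrite pmulr_rge0 ?subr_ge0// in h; exact: mulr_gt0.
Qed.

Lemma ler_enormD x y : enorm (x + y) <= enorm x + enorm y.
Proof.
rewrite -(@ler_pXn2r _ 2)// ?nnegrE ?addr_ge0 ?enorm_ge0//.
rewrite sqrrD !sqr_enorm dotvDl !dotvDr (dotvC y x).
by have := dotv_enormM x y; lra.
Qed.

Lemma ler_enormB x y : enorm x - enorm y <= enorm (x - y).
Proof. by rewrite lerBlDr -{1}(subrK y x) ler_enormD. Qed.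

Lemma normr_enorm x : `|x| <= enorm x.
Proof.
rewrite [leLHS]mx_normrE; apply/bigmax_leP; split; first exact: enorm_ge0.
by move=> -[i j] _ /=; rewrite (ord1 i) ler_coord_enorm.
Qed.

Lemma coord_normr x i : `|x 0 i| <= `|x|.
Proof. by rewrite [leRHS]mx_normrE; apply/bigmax_geP; right; exists (0, i). Qed.

Lemma enorm_normr x : enorm x <= n%:R * `|x|.
Proof.
rewrite -(@ler_pXn2r _ 2)// ?nnegrE ?enorm_ge0 ?mulr_ge0//.
rewrite sqr_enorm exprMn; apply: (@le_trans _ _ (\sum_(i < n) `|x| ^+ 2)).
  apply: ler_sum => i _; rewrite -expr2 -real_normK ?num_real//.
  by rewrite ler_pXn2r// ?nnegrE// coord_normr.
rewrite sumr_const card_ord -[leLHS]mulr_natl ler_wpM2r ?sqr_ge0//.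
by rewrite -natrX ler_nat; case: (n) => // m; rewrite leq_pmulr.
Qed.

Lemma eballE x y r : eball x r y = (enorm (y - x) < r) :> Prop.
Proof. by []. Qed.

Lemma nbhs_eballP x (A : set 'rV[R]_n) :
  nbhs x A <-> exists2 r, 0 < r & eball x r `<=` A.
Proof.
split=> [/nbhs_ballP[r r0 rA]|[r r0 rA]].
  exists r => // y; rewrite eballE => yx; apply: rA.
  rewrite -ball_normE /ball_/= distrC.
  exact: le_lt_trans (normr_enorm _) yx.
apply/nbhs_ballP; exists (r / n.+1%:R) => /=; first by rewrite divr_gt0.
move=> y; rewrite -ball_normE /ball_/= => yx; apply: rA; rewrite eballE.
apply: (le_lt_trans (enorm_normr _)); rewrite distrC.
apply: (@le_lt_trans _ _ (n.+1%:R * `|x - y|)).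
  by rewrite ler_wpM2r// ler_nat.
by rewrite -ltr_pdivlMl// mulrC.
Qed.

Lemma continuous_enormB z : continuous (fun x => enorm (x - z)).
Proof.
move=> x; have FF : Filter (nbhs x) by exact: nbhs_filter.
apply/cvgrPdist_lt => e e0; apply/nbhs_eballP; exists e => // y yx.
apply: le_lt_trans yx; rewrite ler_norml lerNl opprB; apply/andP; split.
  by apply: (le_trans (ler_enormB _ _)); rewrite opprB addrA subrK.
by apply: (le_trans (ler_enormB _ _)); rewrite opprB addrA subrK enormBC.
Qed.

Lemma eball_open x r : open (eball x r).
Proof.
rewrite openE => y yr; apply/nbhs_eballP; exists (r - enorm (y - x)).
  by rewrite subr_gt0.
move=> z; rewrite !eballE ltrBrDr => /(le_lt_trans _); apply.
by rewrite -{1}(subrK y z) -addrA ler_enormD.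
Qed.

Lemma ecball_closed x r : closed [set y | enorm (y - x) <= r].
Proof.
rewrite -openC (_ : ~` _ = [set y | r < enorm (y - x)]); last first.
  by apply/seteqP; split=> y /=; rewrite ltNge => /negP.
rewrite openE => y /= yr; apply/nbhs_eballP; exists (enorm (y - x) - r).
  by rewrite subr_gt0.
move=> z; rewrite eballE /= ltrBrDl -ltrBrDr => /lt_le_trans; apply.
by rewrite lerBlDl (enormBC z y) -(subrKA z y (- x)) ler_enormD.
Qed.

Lemma ecball_compact x r : compact [set y | enorm (y - x) <= r].
Proof.
apply: bounded_closed_compact (@ecball_closed x r).
exists (r + `|x|); split; first exact: num_real.
move=> M rM y /= yr; apply: le_trans (ltW rM).
rewrite -{1}(subrK x y); apply: (le_trans (ler_normD _ _)); rewrite lerD2r.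
exact: le_trans (normr_enorm _) yr.
Qed.

End euclidean.

(** * Borel sets of R^n and behaviour of Lebesgue measure under affine maps *)

Section measure_rV.
Context {R : realType}.
Local Notation mu n := (lebesgue_rV R n).

Lemma measurable_mxball n (x : 'rV[R]_n) (r : R) : 0 < r ->
  measurable (ball x r).
Proof.
move=> r0; rewrite (_ : ball x r = \bigcap_(i in [set: 'I_n])
    (fun y : 'rV[R]_n => y 0 i : measurableTypeR R) @^-1` (ball (x 0 i) r)).
  apply: fin_bigcap_measurable => // i _.
  by rewrite -[X in measurable X]setTI; apply: measurable_coord => //;
    exact: measurable_ball.
apply/seteqP; split=> [y [_ xy] i _|y xy]; first exact: xy.
by split=> // i j; rewrite (ord1 i); exact: xy.
Qed.

(** The sigma-algebra is generated by the coordinates, so an open set is written as a countable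
    union of cubes ([ball] is the sup-norm ball) with rational centres and radii 1/(k+1). *)
Lemma measurable_open_rV n (U : set 'rV[R]_n) : open U -> measurable U.
Proof.
move=> Uo.
pose q2r (q : 'rV[rat]_n) : 'rV[R]_n := map_mx (@ratr R) q.
pose B (p : 'rV[rat]_n * nat) := ball (q2r p.1) (p.2.+1%:R^-1 : R).
rewrite (_ : U = \bigcup_p (if `[< B p `<=` U >] then B p else set0)).
  apply: countable_bigcupT_measurable; first exact: countableP.
  move=> p; case: asboolP => _; last exact: measurable0.
  by apply: measurable_mxball; rewrite invr_gt0.
apply/seteqP; split=> [x Ux|x [p _]]; last by case: asboolP => // BU /BU.
have /nbhs_ballP[e /= e0 xeU] : nbhs x U by exact: open_nbhs_nbhs.
have e20 : 0 < e / 2 by rewrite divr_gt0.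
have [k _ /(_ k (leqnn k)) /= ke] := near_infty_natSinv_lt (PosNum e20).
set r := (k.+1%:R^-1 : R); have r0 : 0 < r by rewrite invr_gt0.
have qP i : {q : rat | `|x 0 i - ratr q| < r}.
  apply: cid.
  have [q] : exists q : rat, ratr q \in `]x 0 i - r, x 0 i + r[.
    by apply: rat_in_itvoo; lra.
  by rewrite in_itv /= => h; exists q; rewrite ltr_norml; lra.
pose q : 'rV[rat]_n := \row_i sval (qP i).
have Bx : ball (q2r q) r x.
  split=> // i j; rewrite (ord1 i) /ball/= !mxE distrC.
  by case: (qP j).
exists (q, k) => //; rewrite ifT//; apply/asboolP => y; rewrite /B /= => By.
apply: xeU; have -> : e = e / 2 + e / 2 by lra.
apply: (@le_ball _ _ _ (r + r)); first by rewrite lerD// ltW.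
exact: ball_triangle (ball_sym Bx) By.
Qed.

Lemma continuous_measurable_rV n (f : 'rV[R]_n -> R) : continuous f ->
  measurable_fun setT (f : _ -> measurableTypeR R).
Proof.
move=> /continuousP cf; apply: (measurability _ (RGenOpens.measurableE R)).
move=> _ [_ [a [b ->] <-]]; rewrite setTI; apply: measurable_open_rV.
exact/cf/interval_open.
Qed.

Lemma measurable_closed_rV n (U : set 'rV[R]_n) : closed U -> measurable U.
Proof.
move=> cU; rewrite -(setCK U); apply: measurableC.
by apply: measurable_open_rV; exact: closed_openC.
Qed.

(** For positive [al], the pushforward rescaled by [al] agrees with Lebesgue measure on half-open
    intervals, hence everywhere by uniqueness; negative [al] reduces to this by reflection. *)
Lemma lebesgue_measure_affine (al b : R) (A : set (measurableTypeR R)) :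
  al != 0 -> measurable A ->
  lebesgue_measure ((fun t => al * t + b : measurableTypeR R) @^-1` A) =
  (`|al|^-1%:E * lebesgue_measure A)%E.
Proof.
have maff (c d : R) : measurable_fun setT
    (fun t : measurableTypeR R => c * t + d : measurableTypeR R).
  by apply: measurable_funD => //; exact: measurable_funM.
wlog al0 : al b A / 0 < al => [hw|] alN0 mA.
  have [|alle0] := ltP 0 al; first by move=> ?; exact: hw.
  have al0 : al < 0 by rewrite lt_neqAle alN0.
  pose A' : set (measurableTypeR R) := -%R @^-1` A.
  have mA' : measurable A'.
    rewrite -[X in measurable X]setTI; apply: continuous_measurable_fun => //.
    exact: opp_continuous.
  rewrite (_ : _ @^-1` A = (fun t => (- al) * t + (- b)) @^-1` A'); last first.
    by apply/seteqP; split=> t; rewrite /A' /= mulNr -opprD opprK.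
  rewrite hw ?oppr_eq0 ?oppr_gt0// normrN; congr (_ * _)%E.
  exact: lebesgue_measureN.
pose M : {measure set (measurableTypeR R) -> \bar R} :=
  mscale (NngNum (normr_ge0 al)) (pushforward lebesgue_measure
    (fun t : measurableTypeR R => al * t + b : measurableTypeR R)).
have -> : lebesgue_measure A = M (maff al b) A.
  apply: lebesgue_measure_unique => // _ [[x y] _ <-].
  rewrite [RHS]/= /mscale /= /pushforward.
  rewrite (_ : (fun t => _) @^-1` _ = `](x - b) / al, (y - b) / al]%classic); last first.
    apply/seteqP; split=> t /=; rewrite !in_itv/= ltr_pdivrMr// ler_pdivlMr//.
      by rewrite mulrC ltrBlDr lerBrDr.
    by rewrite (mulrC t) ltrBlDr lerBrDr.
  rewrite !lebesgue_measure_itv/= !lte_fin ltr_pM2r ?invr_gt0// ltrD2r.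
  case: ifP => _; last by rewrite mule0.
  by rewrite -!EFinB -EFinM gtr0_norm//; congr EFin; field.
rewrite /M /mscale /pushforward /= muleA -EFinM mulVf ?mul1e//.
by rewrite normr_eq0.
Qed.

Lemma measurable_affine_rV n (al : R) (b : 'rV[R]_n) :
  measurable_fun setT (fun x : 'rV[R]_n => al *: x + b).
Proof.
apply: measurable_fun_rVP => i; under eq_fun do rewrite !mxE.
by apply: measurable_funD => //; apply: measurable_funM => //; exact: measurable_coord.
Qed.

(** Induction on the dimension: a section of the preimage is the preimage of a section, so the inner
    factor comes from the induction hypothesis and the outer one from the line. *)
Lemma lebesgue_rV_affine n (al : R) (b : 'rV[R]_n) (A : set 'rV[R]_n) :
  al != 0 -> measurable A ->
  mu n ((fun x => al *: x + b) @^-1` A) = ((`|al| ^- n)%:E * mu n A)%E.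
Proof.
move=> al0; elim: n b A => [|n IH] b A mA.
  rewrite expr0 invr1 mul1e /= /dirac /indic/=; congr (_%:E); congr (_%:R).
  congr (nat_of_bool _); congr (_ \in _); apply/seteqP; split=> x /=;
    by rewrite (thinmx0 (al *: x + b)) (thinmx0 x).
have mcons B : measurable B -> measurable (@cons_rV R n @^-1` B).
  by move=> mB; rewrite -[X in measurable X]setTI; exact: measurable_cons_rV.
pose B := @cons_rV R n @^-1` A.
pose b0 := b 0 0; pose b' : 'rV[R]_n := \row_j b 0 (lift ord0 j).
have consE (t : R) (v : 'rV[R]_n) :
  al *: cons_rV (t, v) + b = cons_rV (al * t + b0, al *: v + b').
  apply/rowP => i; rewrite !mxE; case: unliftP => [j ->|->] /=.
    by rewrite !mxE.
  by [].
have mB : measurable B by exact: mcons.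
pose g : measurableTypeR R -> \bar R := mu n \o xsection B.
have mg : measurable_fun setT g by exact: measurable_fun_xsection.
have g0 x : (0 <= g x)%E by exact: measure_ge0.
have maff (c d : R) : measurable_fun setT
    (fun t : measurableTypeR R => c * t + d : measurableTypeR R).
  by apply: measurable_funD => //; exact: measurable_funM.
pose faff (t : measurableTypeR R) : measurableTypeR R := al * t + b0.
have mfaff : measurable_fun setT faff by exact: maff.
have nng : 0 <= `|al|^-1 by rewrite invr_ge0.
transitivity (\int[lebesgue_measure]_t ((`|al| ^- n)%:E * g (faff t)))%E.
  rewrite /= /lebesgue_step /pushforward /product_measure1.
  apply: eq_integral => t _ /=; rewrite -(IH b'); last exact: measurable_xsection.
  congr (lebesgue_rV R n _); apply/seteqP; split=> v /=.
    by rewrite /xsection /= !inE /B /= consE.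
  by rewrite /xsection /= !inE /B /= consE.
rewrite ge0_integralZl//; last first.
  exact: measurableT_comp.
transitivity ((`|al| ^- n)%:E * \int[pushforward lebesgue_measure faff]_t g t)%E.
  by rewrite (ge0_integral_pushforward mfaff).
rewrite exprS invfM mulrC EFinM -muleA; congr (_ * _)%E.
transitivity (\int[mscale (NngNum nng) lebesgue_measure]_t g t)%E.
  by apply: eq_measure_integral => C mC _; exact: lebesgue_measure_affine.
by rewrite ge0_integral_mscale.
Qed.

End measure_rV.

Section integral_FTC.
Context {R : realType}.

Lemma is_derive_continuous (F : R -> R) (x d : R) :
  is_derive x 1 F d -> {for x, continuous F}.
Proof. by move=> [dF _]; exact/differentiable_continuous/derivable1_diffP. Qed.

Lemma integral_is_derive (f F : R -> R) (a b : R) : a < b ->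
  (forall x, a <= x <= b -> {for x, continuous f}) ->
  (forall x, a <= x <= b -> is_derive x 1 F (f x)) ->
  (\int[lebesgue_measure]_(x in `[a, b]) (f x)%:E = (F b - F a)%:E)%E.
Proof.
move=> ab cf dF; rewrite (continuous_FTC2 (F := F) ab)//.
- apply: continuous_in_subspaceT => x; rewrite inE /= in_itv /=; exact: cf.
- split=> [x||].
  + by rewrite in_itv/= => /andP[/ltW ax /ltW xb]; case: (dF x); rewrite ?ax.
  + apply: cvg_at_right_filter; apply: (@is_derive_continuous _ _ (f a)).
    by apply: dF; rewrite lexx ltW.
  + apply: cvg_at_left_filter; apply: (@is_derive_continuous _ _ (f b)).
    by apply: dF; rewrite lexx ltW.
- move=> x; rewrite in_itv/= => /andP[/ltW ax /ltW xb].
  by rewrite derive1E; have [|_ ->] := dF x; rewrite ?ax.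
Qed.

End integral_FTC.

Section integral_rV.
Context {R : realType}.
Local Notation mu n := (lebesgue_rV R n).

Lemma ge0_integral_affine n (al : R) (b : 'rV[R]_n) (F : 'rV[R]_n -> \bar R) :
  al != 0 -> measurable_fun setT F -> (forall x, (0 <= F x)%E) ->
  (\int[mu n]_x F (al *: x + b)%R = (`|al| ^- n)%:E * \int[mu n]_x F x)%E.
Proof.
move=> al0 mF F0.
have maff := @measurable_affine_rV R n al b.
have nng : 0 <= `|al| ^- n by rewrite invr_ge0 exprn_ge0.
rewrite (_ : (\int[mu n]_x F (al *: x + b)%R =
    \int[pushforward (mu n) (fun x : 'rV[R]_n => al *: x + b)%R]_x F x)%E); last first.
  by rewrite (ge0_integral_pushforward maff).
transitivity (\int[mscale (NngNum nng) (mu n)]_x F x)%E.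
  by apply: eq_measure_integral => C mC _; exact: lebesgue_rV_affine.
by rewrite ge0_integral_mscale.
Qed.

Lemma ge0_integral_shift n (b : 'rV[R]_n) (F : 'rV[R]_n -> \bar R) :
  measurable_fun setT F -> (forall x, (0 <= F x)%E) ->
  (\int[mu n]_x F (x + b)%R = \int[mu n]_x F x)%E.
Proof.
move=> mF F0; under eq_integral do rewrite -[X in (X + b)%R]scale1r.
by rewrite ge0_integral_affine// normr1 expr1n invr1 mul1e.
Qed.

Lemma ge0_integral_oppr n (F : 'rV[R]_n -> \bar R) :
  measurable_fun setT F -> (forall x, (0 <= F x)%E) ->
  (\int[mu n]_x F (- x)%R = \int[mu n]_x F x)%E.
Proof.
move=> mF F0.
under eq_integral do rewrite -[X in F X]addr0 -scaleN1r.
by rewrite ge0_integral_affine ?oppr_eq0 ?oner_eq0// normrN1 expr1n invr1 mul1e.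
Qed.

Lemma measurable_rV_box n (r : R) :
  measurable [set x : 'rV[R]_n | forall i, `|x 0 i| < r].
Proof.
rewrite (_ : [set _ | _] = \bigcap_(i in [set: 'I_n])
    (fun y : 'rV[R]_n => y 0 i : measurableTypeR R) @^-1` (`]-r, r[%classic)).
  apply: fin_bigcap_measurable => // i _.
  by rewrite -[X in measurable X]setTI; apply: measurable_coord.
apply/seteqP; split=> [x xr i _ /=|x xr i]; first by rewrite in_itv/= -ltr_norml.
by have := xr i I; rewrite /= in_itv/= -ltr_norml.
Qed.

Lemma lebesgue_rV_box n (r : R) : 0 < r ->
  mu n [set x | forall i, `|x 0 i| < r] = ((2 * r) ^+ n)%:E.
Proof.
move=> r0; elim: n => [|n IH].
  rewrite expr0 /= /dirac /indic/= mem_set//= => -[] //.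
rewrite /= /lebesgue_step /pushforward.
rewrite (_ : _ @^-1` _ = `]-r, r[%classic `*` [set x : 'rV[R]_n | forall i, `|x 0 i| < r]); last first.
  apply/seteqP; split=> [[t v] /= h|[t v] /= [h1 h2] i].
    split; first by have := h 0; rewrite !mxE unlift_none in_itv/= ltr_norml.
    by move=> i; have := h (lift ord0 i); rewrite !mxE liftK.
  rewrite !mxE; case: unliftP => [j _|_] /=; first exact: h2.
  by move: h1; rewrite in_itv/= ltr_norml.
rewrite product_measure1E//; first last.
  exact: measurable_rV_box.
rewrite [X in (_ * X)%E]IH [X in (X * _)%E]lebesgue_measure_itv/= lte_fin.
rewrite ifT; last by rewrite -subr_gt0 opprK addr_gt0.
by rewrite -EFinB -EFinM exprS; congr (_ * _)%:E; rewrite opprK mulr_natl mulr2n.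
Qed.

Lemma measurable_eball n (c : 'rV[R]_n) r : measurable (eball c r).
Proof. by apply: measurable_open_rV; exact: eball_open. Qed.

Lemma lebesgue_rV_eball n (c : 'rV[R]_n) r : 0 < r ->
  mu n (eball c r) = ((r ^+ n)%:E * mu n (eball 0 1))%E.
Proof.
move=> r0; have rn0 := lt0r_neq0 r0.
have -> : eball c r =
    (fun x => r^-1 *: x + - (r^-1 *: c)) @^-1` eball (0 : 'rV[R]_n) 1.
  apply/seteqP; split=> x; rewrite /= /eball /= subr0 -scalerBr enormZ
    gtr0_norm ?invr_gt0// mulrC ltr_pdivrMr// mul1r//.
rewrite lebesgue_rV_affine ?invr_eq0//; last exact: measurable_eball.
by rewrite gtr0_norm ?invr_gt0// exprVn invrK.
Qed.

Lemma lebesgue_rV_eball_lty n (c : 'rV[R]_n) r : (mu n (eball c r) < +oo)%E.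
Proof.
have [r0|r0] := ltP 0 r; last first.
  rewrite (_ : eball c r = set0) ?measure0//; apply/seteqP; split=> // x.
  by rewrite /eball /= ltNge (le_trans r0)// enorm_ge0.
rewrite lebesgue_rV_eball// lte_mul_pinfty// ?lee_fin ?exprn_ge0 1?ltW//.
apply: (@le_lt_trans _ _ (mu n [set x | forall i, `|x 0 i| < 1])).
  apply: le_measure; rewrite ?inE; first exact: measurable_eball.
  - exact: measurable_rV_box.
  - move=> x; rewrite /eball/= subr0 => x1 i.
    exact: le_lt_trans (ler_coord_enorm _ _) x1.
by rewrite lebesgue_rV_box// ltry.
Qed.

(** The unit ball contains the cube of half-side 1/(n+1), since the Euclidean norm is at most n
    times the sup norm. *)
Lemma lebesgue_rV_eball_gt0 n (c : 'rV[R]_n) r : 0 < r ->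
  (0 < mu n (eball c r))%E.
Proof.
move=> r0; rewrite lebesgue_rV_eball// mule_gt0 ?lte_fin ?exprn_gt0//.
have d0 : 0 < n.+1%:R^-1 :> R by rewrite invr_gt0.
apply: (@lt_le_trans _ _ (mu n [set x | forall i, `|x 0 i| < n.+1%:R^-1])).
  by rewrite lebesgue_rV_box// lte_fin exprn_gt0// mulr_gt0.
apply: le_measure; rewrite ?inE; last 2 first.
- exact: measurable_eball.
- move=> x /= h; rewrite /eball/= subr0.
  apply: (le_lt_trans (enorm_normr x)).
  apply: (@le_lt_trans _ _ (n%:R * n.+1%:R^-1)).
    rewrite ler_wpM2l// [leLHS]mx_normrE; apply/bigmax_leP; split=> [|[i j] _/=].
      exact: ltW.
    by rewrite (ord1 i) ltW.
  by rewrite ltr_pdivrMr// mul1r ltr_nat.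
- exact: measurable_rV_box.
Qed.

End integral_rV.

(** * Polar coordinates *)

Section polar.
Context {R : realType} {n : nat}.
Local Notation mu := (lebesgue_rV R n).
Local Notation leb := (@lebesgue_measure R).

(** Every ray from the origin crosses this annulus in a set of measure ln 2 for dt / t, which is
    where the factor ln 2 in the polar formula comes from. *)
Definition shell : set 'rV[R]_n := [set y | 1 <= enorm y <= 2].

Lemma measurable_enorm_itv (i : interval R) :
  measurable [set y : 'rV[R]_n | enorm y \in i].
Proof.
rewrite -[X in measurable X]setTI.
exact: (measurable_enorm measurableT (measurable_itv i)).
Qed.

Lemma measurable_shell : measurable shell.
Proof.
rewrite (_ : shell = [set y | enorm y \in `[1, 2]]); first exact: measurable_enorm_itv.
by apply/seteqP; split => y /=; rewrite in_itv.
Qed.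

Lemma measurable_funZ d (T : measurableType d)
    (f : T -> measurableTypeR R) (g : T -> 'rV[R]_n) :
  measurable_fun setT f -> measurable_fun setT g ->
  measurable_fun setT (fun t => (f t : R) *: g t).
Proof.
move=> mf mg; apply: measurable_fun_rVP => i; under eq_fun do rewrite mxE.
apply: measurable_funM => //.
exact: (measurableT_comp (measurable_coord i) mg).
Qed.

Lemma integral_inv_itv (c : R) : 0 < c ->
  (\int[leb]_(t in `[(c / 2)%R, c]) (t^-1)%:E = (ln 2)%:E)%E.
Proof.
move=> c0; have c2 : 0 < c / 2 by rewrite divr_gt0.
have c2c : c / 2 < c by rewrite ltr_pdivrMr// ltr_pMr// ltr1n.
have cf x : c / 2 <= x <= c -> {for x, continuous (@GRing.inv R)}.
  move=> /andP[cx _]; apply: inv_continuous.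
  by rewrite gt_eqF// (lt_le_trans c2).
have df x : c / 2 <= x <= c -> is_derive x 1 (@ln R) x^-1.
  by move=> /andP[cx _]; apply: is_derive1_ln; exact: lt_le_trans cx.
rewrite (integral_is_derive c2c cf df).
by rewrite -ln_div ?posrE//; congr (ln _)%:E; field; rewrite gt_eqF.
Qed.

(* Polar coordinates without a surface integral: averaging the dilation
   invariance of Lebesgue measure over a fundamental shell. *)
Lemma ge0_integral_polar (F : 'rV[R]_n -> R) :
  measurable_fun setT (F : _ -> measurableTypeR R) -> (forall y, 0 <= F y) ->
  F 0 = 0 ->
  ((ln 2)%:E * \int[mu]_y (F y)%:E =
   \int[mu]_(y in shell)
     \int[leb]_(t in `]0%R, +oo[) (F (t *: y) * (t ^+ n / t))%:E)%E.
Proof.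
move=> mF F0 F00.
pose I0 (t : measurableTypeR R) : R := \1_(`]0%R, +oo[%classic : set (measurableTypeR R)) t.
pose J (t : measurableTypeR R) : R := I0 t * t^-1.
have mI0 : measurable_fun setT I0 by exact: measurable_indic.
have J0 t : 0 <= J t.
  rewrite /J /I0 indicE; case: (boolP (t \in _)); rewrite ?mul0r// inE /= in_itv/= andbT => t0.
  by rewrite mul1r invr_ge0 ltW.
have mJ : measurable_fun setT J.
  rewrite (_ : J = fun t => I0 t * (t `^ (-1))); last first.
    apply/funext => t; rewrite /J /I0 indicE; case: (boolP (t \in _)); rewrite ?mul0r// inE /= in_itv/= andbT => t0.
    by rewrite powR_inv1// ltW.
  by apply: measurable_funM => //; exact: measurable_powR.
pose S (y : 'rV[R]_n) : R := \1_shell y.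
have mS : measurable_fun setT (S : _ -> measurableTypeR R).
  by apply: measurable_indic; exact: measurable_shell.
have S0 y : 0 <= S y by rewrite /S indicE.
(* At fixed t, [G] is [H] after the dilation y -> t y. Integrating [G] in t first gives the
   right-hand side; integrating [H] in t first sees the t with y / t in the shell, that is |y|/2 <=
   t <= |y|, whose dt / t mass is ln 2. *)
pose G (p : measurableTypeR R * 'rV[R]_n) : \bar R :=
  (J p.1 * p.1 ^+ n * (S p.2 * F (p.1 *: p.2)))%:E.
pose H (p : measurableTypeR R * 'rV[R]_n) : \bar R :=
  (J p.1 * (S (p.1^-1 *: p.2) * F p.2))%:E.
have mG : measurable_fun setT G.
  apply/measurable_EFinP; apply: measurable_funM.
    apply: measurable_funM; first exact: measurableT_comp.
    by apply: measurable_funX.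
  apply: measurable_funM; first exact: measurableT_comp.
  apply: (measurableT_comp mF).
  exact: (measurable_funZ measurable_fst measurable_snd).
have SJ (t : R) y : J t * (S (t^-1 *: y) * F y) =
    J t * (S ((t `^ (-1)) *: y) * F y).
  rewrite /J /I0 indicE; case: (boolP (t \in _)); rewrite ?mul0r// inE /= in_itv/= andbT => t0.
  by rewrite powR_inv1// ltW.
have mH : measurable_fun setT H.
  apply/measurable_EFinP; under eq_fun do rewrite SJ.
  apply: measurable_funM; first exact: measurableT_comp.
  apply: measurable_funM; last exact: measurableT_comp.
  apply: (measurableT_comp mS).
  apply: measurable_funZ; last exact: measurable_snd.
  exact: (measurableT_comp (measurable_powR _) measurable_fst).
have G0 p : (0 <= G p)%E.
  rewrite /G lee_fin; case: p => t y /=; rewrite /J /I0 indicE.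
  case: (boolP (t \in _)); rewrite ?mul0r// inE /= in_itv/= andbT => /ltW t0.
  rewrite mul1r; apply: mulr_ge0; last exact: mulr_ge0.
  by apply: mulr_ge0; rewrite ?invr_ge0 ?exprn_ge0.
have H0 p : (0 <= H p)%E 
  by rewrite /H lee_fin; apply: mulr_ge0; [exact: J0|apply: mulr_ge0].
transitivity (\int[mu]_y \int[leb]_t G (t, y))%E; last first.
  rewrite [RHS]integral_mkcond; apply: eq_integral => y _.
  rewrite [RHS]patchE; case: (boolP (y \in shell)) => ys.
    rewrite [RHS]integral_mkcond; apply: eq_integral => t _.
    rewrite patchE /G /J /I0 /S /= !indicE ys.
    by case: (boolP (t \in _)) => _; rewrite ?mul0r// !mul1r mulrC (mulrC t^-1).
  by rewrite integral0_eq// => t _; rewrite /G /S /= indicE (negbTE ys) mul0r mulr0.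
transitivity (\int[leb]_t \int[mu]_y G (t, y))%E; last first.
  exact: (fubini_tonelli G).
transitivity (\int[leb]_t \int[mu]_y H (t, y))%E; last first.
  apply: eq_integral => t _.
  have [t0|t0] := ltP 0 t; last first.
    rewrite !integral0_eq// => y _; rewrite /G /H /J /I0 /= indicE memNset ?mul0r//=.
      by rewrite in_itv/= andbT ltNge t0.
    by rewrite in_itv/= andbT ltNge t0.
  have mHt : measurable_fun setT (fun y => H (t, y)).
    by apply: (measurableT_comp mH); exact: measurable_pair1.
  have tN0 : t^-1 != 0 by rewrite invr_eq0 gt_eqF.
  have := @ge0_integral_affine R n t 0 (fun y => H (t, y)) (lt0r_neq0 t0) mHt (fun y => H0 _).
  move=> /(congr1 (fun x => (t ^+ n)%:E * x)%E).
  rewrite muleA -EFinM gtr0_norm// mulfV ?mul1e ?expf_neq0 ?lt0r_neq0// => <-.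
  rewrite -ge0_integralZl//; last 2 first.
    by apply: (measurableT_comp mHt); exact: measurable_affine_rV.
    by rewrite lee_fin exprn_ge0// ltW.
  apply: eq_integral => y _; rewrite /H /G /= addr0 scalerA mulVf ?lt0r_neq0// scale1r.
  by rewrite -EFinM (mulrA (t ^+ n)) (mulrC (t ^+ n)).
transitivity (\int[mu]_y \int[leb]_t H (t, y))%E; last first.
  by apply/esym; exact: (fubini_tonelli H).
rewrite -ge0_integralZl//; first last.
- by rewrite lee_fin ln_ge0// ler1n.
- by move=> y _; rewrite lee_fin.
- exact/measurable_EFinP.
apply: eq_integral => y _.
have [y0|y0] := eqVneq y 0.
  by rewrite y0 F00 mule0 integral0_eq// => t _; rewrite /H /= F00 !mulr0.
have yp : 0 < enorm y.
  rewrite lt_def enorm_ge0 andbT; apply: contra_neq y0; exact: enorm_eq0.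
have y2 : 0 < enorm y / 2 by rewrite divr_gt0.
rewrite -(integral_inv_itv yp) muleC -ge0_integralZl//; first last.
- by rewrite lee_fin.
- move=> t; rewrite /= in_itv/= => /andP[yt _].
  by rewrite lee_fin invr_ge0 ltW// (lt_le_trans y2).
- apply/measurable_EFinP; apply: (@eq_measurable_fun _ _ _ _ _ (fun t => t `^ (-1))).
    move=> t; rewrite inE /= in_itv/= => /andP[yt _].
    by rewrite powR_inv1// ltW// (lt_le_trans y2).
  by apply: measurable_funTS; exact: measurable_powR.
rewrite integral_mkcond; apply: eq_integral => t _; rewrite patchE /H /=.
case: ifPn => [|tn].
  rewrite inE /= in_itv/= => /andP[yt ty].
  have t0 : 0 < t by exact: lt_le_trans yt.
  rewrite -EFinM; congr _%:E.
  rewrite /J /I0 indicE mem_set ?mul1r/= ?in_itv/= ?t0// /S indicE mem_set ?mul1r 1?mulrC//.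
  rewrite /shell /= enormZ gtr0_norm ?invr_gt0// ler_pdivlMl// ler_pdivrMl//.
  by rewrite mulr1 ty /= mulrC -ler_pdivrMl// mulrC.
rewrite /J /I0 indicE; case: (boolP (t \in _)); rewrite ?mul0r// inE /= in_itv/= andbT => t0.
rewrite /S indicE memNset ?mul0r ?mulr0// /shell /= => /andP[].
rewrite enormZ gtr0_norm ?invr_gt0// ler_pdivlMl// ler_pdivrMl// mulr1 => ty yt.
move/negP: tn; apply; rewrite inE /= in_itv/= ty andbT.
by rewrite ler_pdivrMr.
Qed.

End polar.

(** * One-dimensional integrals *)

Section power_integrals.
Context {R : realType}.
Local Notation leb := (@lebesgue_measure R).

Lemma ge0_integral_bigcup_le d (T : measurableType d)
    (m : {measure set T -> \bar R}) (F : (set T)^nat) (f : T -> \bar R)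
    (C : \bar R) :
  nondecreasing_seq F -> (forall i, measurable (F i)) ->
  (forall i, measurable_fun (F i) f) -> (forall i x, F i x -> (0 <= f x)%E) ->
  (forall i, (\int[m]_(x in F i) f x <= C)%E) ->
  (\int[m]_(x in \bigcup_i F i) f x <= C)%E.
Proof.
move=> ndF mF mf f0 FC.
have cvgF := @ge0_nondecreasing_set_cvg_integral _ _ _ F f m ndF mF mf f0.
rewrite -(cvg_lim _ cvgF)//; apply: lime_le; first by apply/cvg_ex; eexists; exact: cvgF.
exact: nearW.
Qed.

Lemma ge0_integral_itvcy_le (a : R) (f : R -> \bar R) (C : \bar R) :
  measurable_fun `[a, +oo[%classic f -> (forall x, a <= x -> (0 <= f x)%E) ->
  (forall b, a < b -> (\int[leb]_(x in `[a, b]) f x <= C)%E) ->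
  (\int[leb]_(x in `[a, +oo[) f x <= C)%E.
Proof.
move=> mf f0 fC.
rewrite (_ : `[a, +oo[%classic = \bigcup_k `[a, a + k.+1%:R]%classic); last first.
  apply/seteqP; split=> [x /=|x [k _] /=]; last by rewrite !in_itv/= => /andP[->].
  rewrite in_itv/= andbT => ax; exists (Num.truncn (x - a)) => //=.
  by rewrite in_itv/= ax -lerBlDl ltW// truncnS_gt.
have sub k : `[a, a + k.+1%:R]%classic `<=` `[a, +oo[%classic.
  by move=> x /=; rewrite !in_itv/= => /andP[->].
apply: ge0_integral_bigcup_le => //.
- move=> i j ij; apply/subsetPset => x /=; rewrite !in_itv/= => /andP[-> /le_trans]; apply.
  by rewrite lerD2l ler_nat ltnS.
- by move=> k; exact: measurable_funS (sub k) mf.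
- by move=> i x /sub /=; rewrite in_itv/= andbT; exact: f0.
- by move=> i; apply: fC; rewrite ltrDl.
Qed.

Lemma ge0_integral_itvoc_le (a : R) (f : R -> \bar R) (C : \bar R) :
  0 < a ->
  measurable_fun `]0, a]%classic f -> (forall x, 0 < x -> (0 <= f x)%E) ->
  (forall b, 0 < b < a -> (\int[leb]_(x in `[b, a]) f x <= C)%E) ->
  (\int[leb]_(x in `]0%R, a]) f x <= C)%E.
Proof.
move=> a0 mf f0 fC.
rewrite (_ : `]0, a]%classic = \bigcup_k `[a / k.+2%:R, a]%classic); last first.
  apply/seteqP; split=> [x /=|x [k _] /=]; last first.
    rewrite !in_itv/= => /andP[h ->]; rewrite andbT.
    by apply: lt_le_trans h; rewrite divr_gt0.
  rewrite in_itv/= => /andP[x0 xa]; exists (Num.truncn (a / x)) => //=.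
  rewrite in_itv/= xa andbT ler_pdivrMr// mulrC -ler_pdivrMr//.
  by rewrite ltW// (lt_le_trans (truncnS_gt _))// ler_nat.
have sub k : `[a / k.+2%:R, a]%classic `<=` `]0, a]%classic.
  move=> x /=; rewrite !in_itv/= => /andP[h ->]; rewrite andbT.
  by apply: lt_le_trans h; rewrite divr_gt0.
apply: ge0_integral_bigcup_le => //.
- move=> i j ij; apply/subsetPset => x /=; rewrite !in_itv/= => /andP[h ->].
  rewrite andbT; apply: le_trans h.
  by rewrite ler_pM2l// lef_pV2 ?posrE// ler_nat.
- by move=> k; exact: measurable_funS (sub k) mf.
- by move=> i x /sub /=; rewrite in_itv/= => /andP[x0 _]; exact: f0.
- move=> i; apply: fC; rewrite divr_gt0//= ltr_pdivrMr// ltr_pMr//.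
  by rewrite ltr1n.
Qed.

Lemma is_derive_powR_div (c x : R) : 0 < x -> c != 0 ->
  is_derive x 1 (fun t => c^-1 * t `^ c) (x `^ (c - 1)).
Proof.
move=> x0 cN0; have := is_derive1_powR c x0 => h.
apply: (is_derive_eq (is_deriveZ c^-1 _)).
by rewrite /GRing.scale/= mulrA mulVf ?mul1r.
Qed.

Lemma powR_continuous_gt0 (c x : R) : 0 < x ->
  {for x, continuous (fun t : R => t `^ c)}.
Proof. by move=> x0; exact: (is_derive_continuous (is_derive1_powR c x0)). Qed.

Lemma integral_powR (c x y : R) : 0 < x -> x < y -> c != 0 ->
  (\int[leb]_(t in `[x, y]) (t `^ (c - 1))%:E = ((y `^ c - x `^ c) / c)%:E)%E.
Proof.
move=> x0 xy cN0.
have cf t : x <= t <= y -> {for t, continuous (fun t : R => t `^ (c - 1))}.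
  by move=> /andP[xt _]; apply: powR_continuous_gt0; exact: lt_le_trans xt.
have df t : x <= t <= y -> is_derive t 1 (fun t => c^-1 * t `^ c) (t `^ (c - 1)).
  by move=> /andP[xt _]; apply: is_derive_powR_div => //; exact: lt_le_trans xt.
by rewrite (integral_is_derive xy cf df) -mulrBr mulrC.
Qed.

Lemma integral_powR_cy (a c : R) : 0 < a -> 0 < c ->
  (\int[leb]_(t in `[a, +oo[) (t `^ (- c - 1))%:E <= (a `^ (- c) / c)%:E)%E.
Proof.
move=> a0 c0; apply: ge0_integral_itvcy_le.
- by apply: measurable_funTS; apply/measurable_EFinP; exact: measurable_powR.
- by move=> x _; rewrite lee_fin powR_ge0.
- move=> b ab; rewrite integral_powR// ?oppr_eq0 ?gt_eqF// lee_fin.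
  rewrite invrN mulrN -mulNr opprB ler_pM2r ?invr_gt0//.
  by rewrite gerBl powR_ge0.
Qed.

Lemma integral_powR_oc (a c : R) : 0 < a -> 0 < c ->
  (\int[leb]_(t in `]0%R, a]) (t `^ (c - 1))%:E <= (a `^ c / c)%:E)%E.
Proof.
move=> a0 c0; apply: ge0_integral_itvoc_le => //.
- by apply: measurable_funTS; apply/measurable_EFinP; exact: measurable_powR.
- by move=> x _; rewrite lee_fin powR_ge0.
- move=> b /andP[b0 ba]; rewrite integral_powR// ?gt_eqF// lee_fin.
  by rewrite ler_pM2r ?invr_gt0// gerBl powR_ge0.
Qed.

End power_integrals.

Lemma ge0_integralZlR d (T : measurableType d) (R : realType)
    (m : {measure set T -> \bar R}) (D : set T) (K : R) (g : T -> R) :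
  measurable D -> measurable_fun D g -> (forall x, D x -> 0 <= g x) -> 0 <= K ->
  (\int[m]_(x in D) (K * g x)%:E = K%:E * \int[m]_(x in D) (g x)%:E)%E.
Proof.
move=> mD mg g0 K0; under eq_integral do rewrite EFinM.
by rewrite ge0_integralZl//; exact/measurable_EFinP.
Qed.

Section chord_error.
Context {R : realType}.
Local Notation leb := (@lebesgue_measure R).

Lemma ler_powR_inv (z s : R) : 0 <= z <= 1 -> 0 < s <= 1 -> z <= z `^ s.
Proof.
move=> /andP[z0 z1] /andP[s0 s1].
have [->|zN0] := eqVneq z 0; first exact: powR_ge0.
rewrite -{1}(powRr1 z0) -[1](subrK s) powRD; last by rewrite zN0 implybT.
rewrite -[leRHS]mul1r ler_wpM2r ?powR_ge0//.
have e1 : 1 `^ (1 - s) = 1 :> R by rewrite powR1.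
rewrite -[leRHS]e1.
by apply: ge0_ler_powR; rewrite ?nnegrE// subr_ge0.
Qed.

Lemma powRDp (x r s : R) : 0 < x -> x `^ (r + s) = x `^ r * x `^ s.
Proof. by move=> x0; rewrite powRD// (gt_eqF x0) implybT. Qed.

Lemma ler_powR_neg (x y c : R) : 0 < x -> x <= y -> c <= 0 -> y `^ c <= x `^ c.
Proof.
move=> x0 xy c0; have y0 : 0 < y by exact: lt_le_trans xy.
rewrite -(opprK c) !(powRN _ (- c)) lef_pV2 ?posrE ?powR_gt0//.
by apply: ge0_ler_powR; rewrite ?nnegrE ?oppr_ge0// ltW.
Qed.

(** With x = B / A this is 1 - (1 - x)^s <= x on [0, 1], multiplied by A^s. For B > A already A^s <=
    B A^(s-1). *)
Lemma subr_powR_le (A B s : R) : 0 < A -> 0 <= B -> 0 < s < 1 ->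
  A `^ s - (Num.max 0 (A - B)) `^ s <= B * A `^ (s - 1).
Proof.
move=> A0 B0 /andP[s0 s1].
have As : A `^ s = A * A `^ (s - 1) by rewrite mulr_powRB1// ltW.
have [BA|AB] := leP B A; last first.
  rewrite lerBlDr (@le_trans _ _ (B * A `^ (s - 1)))// ?lerDl ?powR_ge0//.
  by rewrite As ler_wpM2r ?powR_ge0// ltW.
rewrite max_r ?subr_ge0//.
have -> : A - B = A * (1 - B / A) by field; rewrite gt_eqF.
have BA1 : B / A <= 1 by rewrite ler_pdivrMr// mul1r.
have BA0 : 0 <= B / A by rewrite divr_ge0// ltW.
rewrite powRM; [|exact: ltW|by rewrite subr_ge0].
have : 1 - B / A <= (1 - B / A) `^ s.
  by apply: ler_powR_inv; [lra|rewrite s0 ltW].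
rewrite As; set P := A `^ _; set Q := _ `^ s => BQ.
have P0 : 0 <= P by exact: powR_ge0.
have -> : B * P = A * P * (B / A) by field; rewrite gt_eqF.
rewrite -[X in X - _]mulr1 -mulrBr ler_wpM2l//; last by lra.
by rewrite mulr_ge0// ltW.
Qed.

Lemma ge0_integral_split (a : R) (f : R -> \bar R) : 0 < a ->
  measurable_fun (`]0, +oo[%classic : set (measurableTypeR R)) f -> (forall x, 0 < x -> (0 <= f x)%E) ->
  (\int[leb]_(x in `]0%R, +oo[) f x <=
   \int[leb]_(x in `]0%R, a]) f x + \int[leb]_(x in `[a, +oo[) f x)%E.
Proof.
move=> a0 mf f0.
have UE : `]0 : R, +oo[%classic = `]0, a]%classic `|` `]a, +oo[%classic.
  apply/seteqP; split=> x /=; rewrite !in_itv/= !andbT.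
    by move=> x0; rewrite x0/=; case: (leP x a); [left|right].
  by move=> [/andP[]//|]; exact: lt_trans.
have sub1 : `[a, +oo[%classic `<=` `]0 : R, +oo[%classic.
  by move=> x /=; rewrite !in_itv/= !andbT; exact: lt_le_trans.
have mf' := mf; rewrite UE in mf' *.
rewrite ge0_integral_setU//=.
- rewrite leeD2l// ge0_subset_integral//.
  + exact: measurable_funS sub1 mf.
  + by move=> x /sub1; rewrite /= in_itv/= andbT; exact: f0.
  + by move=> x /=; rewrite !in_itv/= !andbT; exact: ltW.
- move=> x [] /=; rewrite in_itv/=; first by move=> /andP[+ _]; exact: f0.
  by rewrite andbT => /(lt_trans a0); exact: f0.
- apply/disj_setPS => x [] /=; rewrite !in_itv/= => /andP[_ xa].
  by rewrite andbT ltNge xa.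
Qed.

(** Error made along a ray when the concave parabola D + p t - q t^2 is replaced by its tangent at t
    = 0, after taking s-th powers of positive parts. *)
Definition chordE (s D p q t : R) : R :=
  (Num.max 0 (D + p * t)) `^ s - (Num.max 0 (D + p * t - q * t ^+ 2)) `^ s.

Lemma chordE_ge0 (s D p q t : R) : 0 < s -> 0 <= q -> 0 <= chordE s D p q t.
Proof.
move=> s0 q0; rewrite subr_ge0; apply: ge0_ler_powR; first exact: ltW.
- by rewrite nnegrE le_max lexx.
- by rewrite nnegrE le_max lexx.
- rewrite ge_max !le_max lexx/=; apply/orP; right.
  by rewrite gerBl mulr_ge0// sqr_ge0.
Qed.

Lemma measurable_chordE (s D p q : R) : measurable_fun setT
  (fun t : measurableTypeR R => chordE s D p q t : measurableTypeR R).
Proof.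
apply: measurable_funB; apply: (measurableT_comp (measurable_powR _));
  apply: measurable_maxr => //.
  by apply: measurable_funD => //; exact: measurable_funM.
apply: measurable_funB; last by apply: measurable_funM => //; exact: measurable_funX.
by apply: measurable_funD => //; exact: measurable_funM.
Qed.

(* With a the positive root of [D + p t = q t ^ 2], the error is at most
   [q t ^ 2 (q a t) ^ (s - 1)] before [a] and [(q a t) ^ s] after [a]; both
   contributions are scale invariant. *)
Lemma integral_chordE (s D p q : R) : 0 < s < 1 -> 0 < D -> 0 < q ->
  (\int[leb]_(t in `]0%R, +oo[) (chordE s D p q t * t `^ (- 1 - 2 * s))%:E
   <= (q `^ s * ((1 - s)^-1 + s^-1))%:E)%E.
Proof.
move=> /andP[s0 s1] D0 q0.
have [a a0 aE] : exists2 a, 0 < a & D + p * a = q * a ^+ 2.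
  have dp : p ^+ 2 < p ^+ 2 + 4 * q * D by rewrite ltrDl !mulr_gt0.
  have p2 := sqr_ge0 p.
  pose r := Num.sqrt (p ^+ 2 + 4 * q * D).
  have r2 : r ^+ 2 = p ^+ 2 + 4 * q * D by rewrite sqr_sqrtr//; lra.
  have rp : `|p| < r by rewrite -sqrtr_sqr ltr_sqrt//; lra.
  exists ((p + r) / (2 * q)).
    by rewrite divr_gt0 ?mulr_gt0//; move: rp; rewrite ltr_norml; lra.
  have -> : D = (r ^+ 2 - p ^+ 2) / (4 * q) by rewrite r2; field; rewrite gt_eqF.
  by field; rewrite gt_eqF.
have Da : D = a * (q * a - p) by lra.
have qap : 0 < q * a - p by rewrite -(pmulr_rgt0 _ a0) -Da.
have Elow t : 0 < t -> t <= a -> chordE s D p q t * t `^ (- 1 - 2 * s) <=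
    q `^ s * a `^ (s - 1) * t `^ ((1 - s) - 1).
  move=> t0 ta; have At : q * a * t <= D + p * t.
    by rewrite -subr_ge0 (_ : _ - _ = (q * a - p) * (a - t)) ?mulr_ge0 ?(ltW qap)// ?subr_ge0//; lra.
  have qat : 0 < q * a * t by rewrite !mulr_gt0.
  have A0 : 0 < D + p * t by exact: lt_le_trans At.
  have : chordE s D p q t <= q * t ^+ 2 * (q * a * t) `^ (s - 1).
    rewrite /chordE (@max_r _ _ 0 (D + p * t)) ?(ltW A0)//.
    apply: (@le_trans _ _ (q * t ^+ 2 * (D + p * t) `^ (s - 1))).
      by apply: subr_powR_le => //; rewrite ?s0// mulr_ge0 ?sqr_ge0// ltW.
    apply: ler_wpM2l; first by rewrite mulr_ge0 ?sqr_ge0// ltW.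
    by apply: ler_powR_neg => //; rewrite subr_le0 ltW.
  move=> /(ler_wpM2r (powR_ge0 t (- 1 - 2 * s))) /le_trans; apply.
  rewrite !powRM ?mulr_ge0 ?(ltW q0) ?(ltW a0) ?(ltW t0)//.
  have -> : t ^+ 2 = t `^ 2 by rewrite -powR_mulrn ?(ltW t0).
  rewrite -(mulr_powRB1 (ltW q0) s0).
  have -> : t `^ (1 - s - 1) = t `^ 2 * (t `^ (s - 1) * t `^ (- 1 - 2 * s)).
    rewrite -!powRDp//; congr (_ `^ _); lra.
  by rewrite le_eqVlt; apply/orP; left; apply/eqP; ring.
have Ehigh t : 0 < t -> a <= t -> chordE s D p q t * t `^ (- 1 - 2 * s) <=
    q `^ s * a `^ s * t `^ (- s - 1).
  move=> t0 at_; have At : D + p * t <= q * a * t.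
    by rewrite -subr_ge0 (_ : _ - _ = (q * a - p) * (t - a)) ?mulr_ge0 ?(ltW qap)// ?subr_ge0//; lra.
  have qat : 0 < q * a * t by rewrite !mulr_gt0.
  have : chordE s D p q t <= (q * a * t) `^ s.
    rewrite /chordE lerBlDr (@le_trans _ _ ((q * a * t) `^ s))// ?lerDl ?powR_ge0//.
    apply: ge0_ler_powR; rewrite ?nnegrE ?le_max ?lexx ?(ltW s0) ?(ltW qat)//.
    by rewrite ge_max (ltW qat).
  move=> /(ler_wpM2r (powR_ge0 t (- 1 - 2 * s))) /le_trans; apply.
  rewrite !powRM ?mulr_ge0 ?(ltW q0) ?(ltW a0) ?(ltW t0)//.
  have -> : t `^ (- s - 1) = t `^ s * t `^ (- 1 - 2 * s).
    rewrite -!powRDp//; congr (_ `^ _); lra.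
  by rewrite !mulrA.
have mE : measurable_fun setT (fun t : measurableTypeR R =>
    (chordE s D p q t * t `^ (- 1 - 2 * s))%:E).
  apply/measurable_EFinP; apply: measurable_funM; first exact: measurable_chordE.
  exact: measurable_powR.
have E0 t : (0 <= (chordE s D p q t * t `^ (- 1 - 2 * s))%:E)%E.
  by rewrite lee_fin mulr_ge0 ?powR_ge0// chordE_ge0// ltW.
apply: (le_trans (ge0_integral_split a0 _ _)) => //.
  exact: measurable_funTS.
rewrite mulrDr EFinD; apply: leeD.
- apply: (@le_trans _ _ (\int[leb]_(t in `]0%R, a]) (q `^ s * a `^ (s - 1) * t `^ ((1 - s) - 1))%:E)%E).
    apply: ge0_le_integral => //.
    + exact: measurable_funTS.
    + apply/measurable_EFinP/measurable_funTS; apply: measurable_funM.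
        exact: measurable_cst.
      exact: measurable_powR.
    + move=> t /=; rewrite in_itv/= => /andP[t0 ta].
      by rewrite lee_fin Elow.
  rewrite ge0_integralZlR//; first last.
  + by rewrite mulr_ge0 ?powR_ge0.
  + by move=> t _; rewrite powR_ge0.
  + by apply: measurable_funTS; exact: measurable_powR.
  have s10 : 0 < 1 - s by rewrite subr_gt0.
  apply: (le_trans (lee_wpmul2l _ (integral_powR_oc a0 s10))).
    by rewrite lee_fin mulr_ge0 ?powR_ge0.
  rewrite -EFinM lee_fin -mulrA (mulrA (a `^ _)) -powRDp//.
  by rewrite (_ : s - 1 + (1 - s) = 0) ?powRr0 ?mul1r//; lra.
- apply: (@le_trans _ _ (\int[leb]_(t in `[a, +oo[) (q `^ s * a `^ s * t `^ (- s - 1))%:E)%E).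
    apply: ge0_le_integral => //.
    + exact: measurable_funTS.
    + apply/measurable_EFinP/measurable_funTS; apply: measurable_funM.
        exact: measurable_cst.
      exact: measurable_powR.
    + move=> t /=; rewrite in_itv/= andbT => ta.
      by rewrite lee_fin Ehigh// (lt_le_trans a0).
  rewrite ge0_integralZlR//; first last.
  + by rewrite mulr_ge0 ?powR_ge0.
  + by move=> t _; rewrite powR_ge0.
  + by apply: measurable_funTS; exact: measurable_powR.
  apply: (le_trans (lee_wpmul2l _ (integral_powR_cy a0 s0))).
    by rewrite lee_fin mulr_ge0 ?powR_ge0.
  rewrite -EFinM lee_fin -mulrA (mulrA (a `^ _)) -powRDp//.
  by rewrite subrr powRr0 ?mul1r.
Qed.

End chord_error.

(** * The function t_+^s is harmonic on the half-line: the one-sided integrals compared *)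

Section half_line.
Context {R : realType}.
Local Notation leb := (@lebesgue_measure R).
Variable s : R.
Hypothesis s01 : 0 < s < 1.

Let s0 : 0 < s. Proof. by case/andP: s01. Qed.
Let s1 : s < 1. Proof. by case/andP: s01. Qed.

(** Drop of t_+^s when moving left from the point 1, and in [outerf] its gain when moving right,
    both against the one-dimensional kernel. *)
Definition innerf (x : R) : R := (1 - (Num.max 0 (1 - x)) `^ s) * x `^ (- 1 - 2 * s).
Definition outerf (x : R) : R := ((1 + x) `^ s - 1) * x `^ (- 1 - 2 * s).

(** [A] is [innerf] on ]0, 1[; [B] is [outerf] pulled back by the substitution [F], Jacobian
    included ([BE]); [Q] is a primitive of [B - A] ([dQ]). *)
Let A (x : R) : R := (1 - (1 - x) `^ s) * x `^ (- 1 - 2 * s).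
Let B (x : R) : R := A x * (1 - x) `^ (s - 1).
Let Q (x : R) : R := (2 * s)^-1 * ((1 - (1 - x) `^ s) ^+ 2 * x `^ (- 2 * s)).
Let F (x : R) : R := x / (1 - x).

Let dB (x : R) : x < 1 -> is_derive x 1 (fun t : R => 1 - (1 - t) `^ s) (s * (1 - x) `^ (s - 1)).
Proof.
move=> x1.
have h1 : is_derive x 1 (fun t : R => 1 - t) (-1).
  apply: (is_derive_eq (is_deriveB (is_derive_cst _ _ _) (is_derive_id _ _))).
  by rewrite sub0r.
have h2 : is_derive (1 - x) 1 (fun t : R => t `^ s) (s * (1 - x) `^ (s - 1)).
  by apply: is_derive1_powR; rewrite subr_gt0.
have h3 := @is_derive1_comp R (fun t => t `^ s) (fun t => 1 - t) x _ _ h2 h1.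
have h4 := is_deriveB (is_derive_cst (1 : R) x 1) h3.
by apply: (is_derive_eq h4); rewrite sub0r mulrN1 opprK.
Qed.

Let dQ (x : R) : 0 < x -> x < 1 -> is_derive x 1 Q (B x - A x).
Proof.
move=> x0 x1; have h := dB x1.
have hp := is_derive1_powR (- 2 * s) x0.
have h2 := is_deriveM (is_deriveM h h) hp.
have h3 := is_deriveZ (2 * s)^-1 h2.
apply: (is_derive_eq h3); rewrite /GRing.scale/= /B /A !fctE.
have -> : - 2 * s - 1 = - 1 - 2 * s by lra.
have -> : x `^ (- 2 * s) = x * x `^ (- 1 - 2 * s).
  rewrite -{2}(powRr1 (ltW x0)) -powRDp//; congr (_ `^ _); lra.
have -> : (1 - x) `^ s = (1 - x) * (1 - x) `^ (s - 1).
  by rewrite mulr_powRB1// subr_ge0 ltW.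
by field; rewrite gt_eqF.
Qed.

Let dF (x : R) : x < 1 -> is_derive x 1 F ((1 - x) ^- 2).
Proof.
move=> x1.
have h1 : is_derive x 1 (fun t : R => 1 - t) (-1).
  apply: (is_derive_eq (is_deriveB (is_derive_cst _ _ _) (is_derive_id _ _))).
  by rewrite sub0r.
have x1N : 1 - x != 0 by rewrite subr_eq0 gt_eqF.
have h2 := @is_deriveV R _ x _ _ x1N h1.
have h3 := is_deriveM (is_derive_id x 1) h2.
apply: (is_derive_eq h3); by rewrite /GRing.scale/=; field.
Qed.

Let contA (x : R) : 0 < x -> x < 1 -> {for x, continuous A}.
Proof.
move=> x0 x1; apply: cvgM; first exact: is_derive_continuous (dB x1).
exact: powR_continuous_gt0.
Qed.

Let contB (x : R) : 0 < x -> x < 1 -> {for x, continuous B}.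
Proof.
move=> x0 x1; apply: cvgM; first exact: contA.
have h2 : is_derive (1 - x) 1 (fun t : R => t `^ (s - 1)) ((s - 1) * (1 - x) `^ (s - 1 - 1)).
  by apply: is_derive1_powR; rewrite subr_gt0.
have h1 : is_derive x 1 (fun t : R => 1 - t) (-1).
  apply: (is_derive_eq (is_deriveB (is_derive_cst _ _ _) (is_derive_id _ _))).
  by rewrite sub0r.
exact: is_derive_continuous (@is_derive1_comp R (fun t => t `^ (s - 1)) (fun t => 1 - t) x _ _ h2 h1).
Qed.

Let A_ge0 (x : R) : 0 < x -> x < 1 -> 0 <= A x.
Proof.
move=> x0 x1; rewrite mulr_ge0 ?powR_ge0// subr_ge0.
have e1 : 1 `^ s = 1 :> R by rewrite powR1.
rewrite -[leRHS]e1; apply: ge0_ler_powR; rewrite ?nnegrE ?ltW// ?subr_gt0//.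
by rewrite gtrBl.
Qed.

Let F_near (x : R) : x < 1 -> \forall t \near x, derive1 F t = (1 - t) ^- 2.
Proof.
move=> x1; near=> t; rewrite derive1E.
have t1 : t < 1 by near: t; exact: lt_nbhsl.
by case: (dF t1).
Unshelve. all: by end_near. Qed.

Let contF' (x : R) : x < 1 -> {for x, continuous (derive1 F)}.
Proof.
move=> x1; have x1N : 1 - x != 0 by rewrite subr_eq0 gt_eqF.
have c1 : {for x, continuous (fun t : R => (1 - t) ^- 2)}.
  apply: continuousV; first by rewrite expf_neq0.
  have c0 : {for x, continuous (fun t : R => 1 - t)}.
    by apply: cvgB; [exact: cvg_cst|exact: cvg_id].
  exact: (cvgM c0 c0).
rewrite /prop_for /continuous_at (nbhs_singleton (F_near x1)).
apply: cvg_trans c1; apply: near_eq_cvg.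
by apply: filterS (F_near x1) => t ->.
Qed.

Let BE (x : R) : 0 < x -> x < 1 ->
  B x = outerf (F x) * (1 - x) ^- 2.
Proof.
move=> x0 x1; have y0 : 0 < 1 - x by rewrite subr_gt0.
rewrite /B /A /outerf /F.
have -> : 1 + x / (1 - x) = (1 - x)^-1 by field; rewrite gt_eqF.
set y := 1 - x in y0 *.
have yV c : y^-1 `^ c = y `^ (- c).
  by rewrite -(powR_inv1 (ltW y0)) -powRrM mulN1r.
rewrite powRM ?invr_ge0 ?ltW// !yV powRN.
have -> : - (- 1 - 2 * s) = s + (s + 1) by lra.
rewrite !powRDp// (powRr1 (ltW y0)) (powR_inv1 (ltW y0)).
have P0 := powR_gt0 s y0.
by field; rewrite !gt_eqF.
Qed.

Lemma integral_A_B (a b : R) : 0 < a -> a < b -> b < 1 ->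
  (\int[leb]_(x in `[a, b]) (A x)%:E + (Q b - Q a)%:E =
   \int[leb]_(x in `[a, b]) (B x)%:E)%E.
Proof.
move=> a0 ab b1.
have cf x : a <= x <= b -> {for x, continuous (B - A)}.
  move=> /andP[ax xb]; have x0 : 0 < x by exact: lt_le_trans ax.
  have x1 : x < 1 by exact: le_lt_trans b1.
  by apply: cvgB; [exact: contB|exact: contA].
have df x : a <= x <= b -> is_derive x 1 Q ((B - A) x).
  move=> /andP[ax xb]; rewrite !fctE; apply: dQ; first exact: lt_le_trans ax.
  exact: le_lt_trans b1.
have BA0 x : a <= x <= b -> 0 <= (B - A) x.
  move=> /andP[ax xb]; have x0 : 0 < x by exact: lt_le_trans ax.
  have x1 : x < 1 by exact: le_lt_trans b1.
  rewrite !fctE /B -[X in _ - X]mulr1 -mulrBr mulr_ge0 ?A_ge0// subr_ge0.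
  have e1 : 1 `^ (s - 1) = 1 :> R by rewrite powR1.
  rewrite -[leLHS]e1; apply: ler_powR_neg; first by rewrite subr_gt0.
    by rewrite gerBl ltW.
  by rewrite subr_le0 ltW.
have m (f : R -> R) : (forall x, 0 < x -> x < 1 -> {for x, continuous f}) ->
    measurable_fun (`[a, b]%classic : set (measurableTypeR R)) (EFin \o f).
  move=> fc; apply/measurable_EFinP; apply: subspace_continuous_measurable_fun => //.
  apply: continuous_in_subspaceT => x; rewrite inE /= in_itv/= => /andP[ax xb].
  by apply: fc; [exact: lt_le_trans ax|exact: le_lt_trans b1].
rewrite -(integral_is_derive ab cf df) -ge0_integralD//=.
- by apply: eq_integral => x _; rewrite -[(B - A) x]/(B x - A x) -EFinD addrC subrK.
- move=> x /=; rewrite in_itv/= => /andP[ax xb]; rewrite lee_fin A_ge0//.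
    exact: lt_le_trans ax.
  exact: le_lt_trans b1.
- exact: m contA.
- by apply: m => x x0 x1; apply: cvgB; [exact: contB|exact: contA].
Qed.

Lemma measurable_innerf : measurable_fun setT (innerf : measurableTypeR R -> measurableTypeR R).
Proof.
apply: measurable_funM; last exact: measurable_powR.
apply: measurable_funB => //; apply: (measurableT_comp (measurable_powR _)).
by apply: measurable_maxr => //; exact: measurable_funB.
Qed.

Lemma measurable_outerf : measurable_fun setT (outerf : measurableTypeR R -> measurableTypeR R).
Proof.
apply: measurable_funM; last exact: measurable_powR.
apply: measurable_funB => //; apply: (measurableT_comp (measurable_powR _)).
exact: measurable_funD.
Qed.

Lemma outerf_ge0 (x : R) : 0 < x -> 0 <= outerf x.
Proof.
move=> x0; rewrite mulr_ge0 ?powR_ge0// subr_ge0.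
have e1 : 1 `^ s = 1 :> R by rewrite powR1.
rewrite -[leLHS]e1; apply: ge0_ler_powR; rewrite ?nnegrE ?ltW// ?ltrDl//.
by rewrite addr_gt0.
Qed.

Lemma innerf_ge0 (x : R) : 0 < x -> 0 <= innerf x.
Proof.
move=> x0; rewrite mulr_ge0 ?powR_ge0// subr_ge0.
have e1 : 1 `^ s = 1 :> R by rewrite powR1.
rewrite -[leRHS]e1; apply: ge0_ler_powR; first exact: ltW.
- by rewrite nnegrE le_max lexx.
- by rewrite nnegrE.
- by rewrite ge_max ler01 gerBl ltW.
Qed.


(** The substitution [F] carries [a, b] to [F a, F b], which lies in [a, +oo[ because F a >= a; the
    rest of that half-line only adds a nonnegative amount. *)
Lemma integral_A_outer (a b : R) : 0 < a -> a < b -> b < 1 ->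
  (\int[leb]_(x in `[a, b]) (B x)%:E <=
   \int[leb]_(x in `[a, +oo[) (outerf x)%:E)%E.
Proof.
move=> a0 ab b1; have a1 : a < 1 by exact: lt_trans b1.
have Fpos x : 0 < x -> x < 1 -> 0 < F x.
  by move=> x0 x1; rewrite divr_gt0// subr_gt0.
have inF x : a <= x <= b -> x < 1 by move=> /andP[_ xb]; exact: le_lt_trans b1.
have aFa : a <= F a.
  rewrite ler_pdivlMr ?subr_gt0//.
  by rewrite ger_pMr// gerBl ltW.
have co : {within `[F a, F b], continuous outerf}.
  apply: continuous_in_subspaceT => x; rewrite inE /= in_itv/= => /andP[ax _].
  have x0 : 0 < x by apply: lt_le_trans ax; exact: Fpos.
  apply: cvgM; last exact: powR_continuous_gt0.
  apply: cvgB; last exact: cvg_cst.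
  have h1 : is_derive x 1 (fun t : R => 1 + t) 1.
    apply: (is_derive_eq (is_deriveD (is_derive_cst _ _ _) (is_derive_id _ _))).
    by rewrite add0r.
  have h2 : is_derive (1 + x) 1 (fun t : R => t `^ s) (s * (1 + x) `^ (s - 1)).
    by apply: is_derive1_powR; rewrite addr_gt0.
  exact: is_derive_continuous (@is_derive1_comp R (fun t => t `^ s) (fun t => 1 + t) x _ _ h2 h1).
have H := @integration_by_substitution_increasing R F outerf a b (ltW ab).
apply: (@le_trans _ _ (\int[leb]_(x in `[F a, F b]) (outerf x)%:E)%E); last first.
  apply: ge0_subset_integral => //.
  - by apply/measurable_EFinP/measurable_funTS; exact: measurable_outerf.
  - move=> x /=; rewrite in_itv/= andbT => ax; rewrite lee_fin outerf_ge0//.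
    exact: lt_le_trans ax.
  - by move=> x /=; rewrite !in_itv/= andbT => /andP[Fx _]; exact: le_trans Fx.
rewrite le_eqVlt; apply/orP; left; apply/eqP; rewrite H//.
- apply: eq_integral => x; rewrite inE /= in_itv/= => axb; congr (_%:E).
  have x1 := inF _ axb; have x0 : 0 < x by case/andP: axb => + _; exact: lt_le_trans.
  by rewrite BE// -(nbhs_singleton (F_near x1)).
- move=> x y; rewrite !in_itv/= => /inF x1 /inF y1 xy.
  rewrite /F ltr_pdivrMr ?subr_gt0// mulrAC ltr_pdivlMr ?subr_gt0//.
  by rewrite !mulrBr !mulr1 (mulrC y x) ltrD2r.
- by move=> x; rewrite in_itv/= => /andP[ax xb]; apply: contF'; exact: lt_trans b1.
- apply/cvg_ex; exists (derive1 F a); apply: cvg_at_right_filter; exact: contF'.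
- apply/cvg_ex; exists (derive1 F b); apply: cvg_at_left_filter; exact: contF'.
- split=> [x||].
  + by rewrite in_itv/= => /andP[ax xb]; case: (dF (lt_trans xb b1)).
  + by apply: cvg_at_right_filter; exact: is_derive_continuous (dF a1).
  + by apply: cvg_at_left_filter; exact: is_derive_continuous (dF b1).
Qed.

(** The total drop of t_+^s from the point 1 is at most 1, so beyond b the weight alone bounds the
    integral. *)
Lemma integral_inner_le (a b : R) : 0 < a -> a < b -> b < 1 ->
  (\int[leb]_(x in `[a, +oo[) (innerf x)%:E <=
   \int[leb]_(x in `[a, b]) (A x)%:E + (b `^ (- 2 * s) / (2 * s))%:E)%E.
Proof.
move=> a0 ab b1; have b0 : 0 < b by exact: lt_trans ab.
have UE : `[a, +oo[%classic = `[a, b]%classic `|` `]b, +oo[%classic.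
  apply/seteqP; split=> x /=; rewrite !in_itv/= !andbT.
    by move=> x0; rewrite x0/=; case: (leP x b); [left|right].
  by move=> [/andP[]//|bx]; exact: ltW (lt_trans ab bx).
rewrite UE ge0_integral_setU//=; last 3 first.
- by apply/measurable_EFinP/measurable_funTS; exact: measurable_innerf.
- move=> x [] /=; rewrite in_itv/=.
    by move=> /andP[ax _]; rewrite lee_fin innerf_ge0//; exact: lt_le_trans ax.
  by rewrite andbT => bx; rewrite lee_fin innerf_ge0//; exact: lt_trans bx.
- apply/disj_setPS => x [] /=; rewrite !in_itv/= => /andP[_ xa].
  by rewrite andbT ltNge xa.
apply: leeD.
  rewrite le_eqVlt; apply/orP; left; apply/eqP; apply: eq_integral => x.
  rewrite inE /= in_itv/= => /andP[ax xb]; rewrite /innerf max_r//.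
  by rewrite subr_ge0 (le_trans xb)// ltW.
apply: (@le_trans _ _ (\int[leb]_(x in `[b, +oo[) (x `^ (- 1 - 2 * s))%:E)%E).
  apply: (@le_trans _ _ (\int[leb]_(x in `[b, +oo[) (innerf x)%:E)%E).
    apply: ge0_subset_integral => //.
    - by apply/measurable_EFinP/measurable_funTS; exact: measurable_innerf.
    - move=> x /=; rewrite in_itv/= andbT => bx; rewrite lee_fin innerf_ge0//.
      exact: lt_le_trans bx.
    - by move=> x /=; rewrite !in_itv/= !andbT; exact: ltW.
  apply: ge0_le_integral => //.
  - move=> x /=; rewrite in_itv/= andbT => bx; rewrite lee_fin innerf_ge0//.
    exact: lt_le_trans bx.
  - by apply/measurable_EFinP/measurable_funTS; exact: measurable_innerf.
  - by apply/measurable_EFinP/measurable_funTS; exact: measurable_powR.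
  - move=> x _; rewrite lee_fin /innerf ler_piMl ?powR_ge0//.
    by rewrite gerBl powR_ge0.
have s20 : 0 < 2 * s by rewrite mulr_gt0.
by have := integral_powR_cy b0 s20; rewrite addrC -mulNr.
Qed.

(* The limit [a -> 0] is the identity [L (t_+ ^ s) = 0]: the inversion
   [t |-> t / (1 - t)] makes the two half-line integrals comparable and their
   difference has the explicit primitive [Q]. *)
Lemma integral_inner_outer (a : R) : 0 < a < 1 ->
  (\int[leb]_(x in `[a, +oo[) (innerf x)%:E <=
   \int[leb]_(x in `[a, +oo[) (outerf x)%:E + (a `^ (2 - 2 * s) / s)%:E)%E.
Proof.
move=> /andP[a0 a1].
set e := a `^ (2 - 2 * s); have e0 : 0 < e by exact: powR_gt0.
have e8 : 0 < e / 8 by rewrite divr_gt0.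
(* The cut b = 1 - d is so close to 1 that d^s <= e/8. Then the tail b^(-2s) / (2s) of [innerf] and
   the boundary term Q b cancel up to e / (2s), and Q a costs another e / (2s). *)
pose d := Num.min (Num.min ((1 - a) / 2) 2^-1) ((e / 8) `^ s^-1).
have d0 : 0 < d by rewrite !lt_min powR_gt0// divr_gt0 ?subr_gt0//= invr_gt0 ltr0n.
have [da d2 ds] : [/\ d <= (1 - a) / 2, d <= 2^-1 & d <= (e / 8) `^ s^-1].
  by split; rewrite /d !ge_min lexx ?orbT.
have dse : d `^ s <= e / 8.
  have <- : (e / 8) `^ s^-1 `^ s = e / 8.
    by rewrite -powRrM mulVf ?gt_eqF// powRr1// ltW.
  apply: (@ge0_ler_powR _ s (ltW s0) d); [by rewrite nnegrE ltW| |exact: ds].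
  by rewrite nnegrE powR_ge0.
have ab : a < 1 - d by lra.
have b1 : 1 - d < 1 by lra.
have b2 : 2^-1 <= 1 - d by lra.
apply: (le_trans (integral_inner_le a0 ab b1)).
have := integral_A_outer a0 ab b1; rewrite -(integral_A_B a0 ab b1).
rewrite -leeBrDr ?fin_numE// => /(leeD2r (((1 - d) `^ (- 2 * s) / (2 * s))%:E)) /le_trans; apply.
rewrite -addeA leeD2l// -EFinN -EFinD lee_fin.
have -> : Q (1 - d) = (2 * s)^-1 * ((1 - d `^ s) ^+ 2 * (1 - d) `^ (- 2 * s)).
  by rewrite /Q (_ : 1 - (1 - d) = d)//; lra.
have Qa : Q a <= (2 * s)^-1 * e.
  rewrite /Q ler_pM2l ?invr_gt0 ?mulr_gt0//.
  have -> : e = a ^+ 2 * a `^ (- 2 * s).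
    by rewrite /e -powR_mulrn ?(ltW a0)// -powRDp// mulNr.
  rewrite ler_wpM2r ?powR_ge0//.
  have h : 1 - a <= (1 - a) `^ s by apply: ler_powR_inv; [lra|rewrite s0 ltW].
  have h1 : 0 <= 1 - (1 - a) `^ s.
    rewrite subr_ge0; have e1 : 1 `^ s = 1 :> R by rewrite powR1.
    rewrite -[leRHS]e1; apply: ge0_ler_powR; rewrite ?nnegrE; first exact: ltW.
    - by rewrite subr_ge0 ltW.
    - by [].
    - by rewrite gerBl ltW.
  by rewrite ler_pXn2r// ?nnegrE//; lra.
have P4 : (1 - d) `^ (- 2 * s) <= 4.
  apply: (@le_trans _ _ (2^-1 `^ (- 2 * s))).
    by apply: ler_powR_neg; rewrite ?invr_gt0 ?mulNr ?oppr_le0 ?mulr_ge0// ltW.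
  apply: (@le_trans _ _ (2^-1 `^ (- 2))).
    by rewrite -!(powR_inv1 (ler0n _ 2)) -!powRrM; apply: ler_powR; have := s1; lra.
  by rewrite powRN powR_mulrn ?invr_ge0// exprVn invrK -natrX ler_nat.
have P0 := powR_ge0 (1 - d) (- 2 * s).
set P := (1 - d) `^ _ in P4 P0 *; set y := d `^ s in dse *.
have y0 : 0 <= y by exact: powR_ge0.
have sE : e / s = (2 * s)^-1 * e + (2 * s)^-1 * e by field; rewrite gt_eqF.
have : (2 * s)^-1 * (P * (1 - (1 - y) ^+ 2)) <= (2 * s)^-1 * e.
  rewrite ler_pM2l ?invr_gt0 ?mulr_gt0//.
  have h1 : P * y <= 4 * y by rewrite ler_wpM2r.
  have h2 : 0 <= P * y ^+ 2 by rewrite mulr_ge0 ?sqr_ge0.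
  by rewrite (_ : P * _ = 2 * (P * y) - P * y ^+ 2); [lra|ring].
have -> : P / (2 * s) = (2 * s)^-1 * P by rewrite mulrC.
rewrite sE (_ : P * _ = P - (1 - y) ^+ 2 * P); last by ring.
by rewrite mulrBr; lra.
Qed.
End half_line.

(** * Truncated operators *)

(** The coefficient only agrees almost everywhere with a Borel function; the analysis runs on a
    representative of its kernel that is Borel, even, homogeneous and bounded at every point. The
    two bounds force the value 0 at the origin, since 0 to a nonzero power is 0. *)
Record kernel_spec (R : realType) (n : nat) (s lam Lam : R)
    (k : 'rV[R]_n -> R) : Prop := KernelSpec {
  kernel_s : 0 < s < 1 ;
  kernel_lam : 0 < lam ;
  kernel_measurable : measurable_fun setT (k : _ -> measurableTypeR R) ;
  kernel_sym : forall y, k (- y) = k y ;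
  kernel_hom : forall t y, 0 < t -> k (t *: y) = t `^ (- (n%:R + 2 * s)) * k y ;
  kernel_ge : forall y, lam * enorm y `^ (- (n%:R + 2 * s)) <= k y ;
  kernel_le : forall y, k y <= Lam * enorm y `^ (- (n%:R + 2 * s)) }.

Definition far {R : realType} {n : nat} (e : R) : set 'rV[R]_n := ~` eball 0 e.

Section kernel.
Context {R : realType} {n : nat} {s lam Lam : R} {k : 'rV[R]_n -> R}.
Hypothesis kP : kernel_spec s lam Lam k.
Local Notation mu := (lebesgue_rV R n).
Local Notation leb := (@lebesgue_measure R).
Local Notation gam := (n%:R + 2 * s).

Let s0 : 0 < s. Proof. by case/andP: (kernel_s kP). Qed.
Let s1 : s < 1. Proof. by case/andP: (kernel_s kP). Qed.

Lemma gam_gt0 : 0 < gam.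
Proof. by rewrite ltr_wpDl// mulr_gt0. Qed.

Lemma kernel_ge0 y : 0 <= k y.
Proof.
apply: le_trans (kernel_ge kP y).
by rewrite mulr_ge0 ?powR_ge0// ltW// (kernel_lam kP).
Qed.

Lemma kernel0 : k 0 = 0.
Proof.
have p0 : (0 : R) `^ (- gam) = 0 by rewrite powR0// oppr_eq0 gt_eqF ?gam_gt0.
have := kernel_ge kP 0; have := kernel_le kP 0.
by rewrite enorm0 p0 !mulr0 => h1 h2; apply/eqP; rewrite eq_le h1.
Qed.

Lemma Lam_ge0 : (0 < n)%N -> 0 <= Lam.
Proof.
case: n k kP => // m k' kP' _.
pose x : 'rV[R]_m.+1 := delta_mx 0 0.
have x1 : enorm x != 0.
  apply/eqP => /enorm_eq0 /rowP/(_ 0)/eqP; rewrite !mxE !eqxx /=.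
  by rewrite oner_eq0.
have px : 0 < enorm x `^ (- (m.+1%:R + 2 * s)).
  by rewrite powR_gt0// lt_def x1 enorm_ge0.
rewrite -(pmulr_lge0 _ px).
apply: le_trans (kernel_le kP' x); apply: le_trans (kernel_ge kP' x).
by rewrite mulr_ge0 ?(ltW px)// ltW// (kernel_lam kP').
Qed.

Lemma farE (e : R) (y : 'rV[R]_n) : far e y = (e <= enorm y) :> Prop.
Proof.
rewrite /far /setC /= eballE subr0; apply/propext; rewrite leNgt.
by split=> /negP.
Qed.

Lemma measurable_far e : measurable (far e : set 'rV[R]_n).
Proof. by apply: measurableC; exact: measurable_eball. Qed.

Lemma mu_shell_fin : (mu (@shell R n) < +oo)%E.
Proof.
apply: (@le_lt_trans _ _ (mu (eball 0 3))); last exact: lebesgue_rV_eball_lty.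
apply: le_measure; rewrite ?inE; [exact: measurable_shell|exact: measurable_eball|].
by move=> y /= /andP[_ y2]; rewrite eballE subr0; lra.
Qed.

Lemma mu_shell_gt0 : (0 < n)%N -> (0 < mu (@shell R n))%E.
Proof.
move=> n0.
have B1 : mu (eball 0 1) \is a fin_num.
  by rewrite ge0_fin_numE ?measure_ge0// lebesgue_rV_eball_lty.
apply: (@lt_le_trans _ _ (mu (eball 0 2 `\` eball 0 1))); last first.
  apply: le_measure; rewrite ?inE.
  - by apply: measurableD; exact: measurable_eball.
  - exact: measurable_shell.
  - move=> y [] /=; rewrite !eballE subr0 => y2 /negP; rewrite -leNgt => y1.
    by rewrite /shell /= y1 ltW.
rewrite measureD//; first last.
- exact: lebesgue_rV_eball_lty.
- exact: measurable_eball.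
- exact: measurable_eball.
rewrite setIidr; last by move=> y; rewrite !eballE => /lt_trans; apply; rewrite ltr1n.
have B1gt0 := @lebesgue_rV_eball_gt0 R n 0 1 ltr01.
have B2 := @lebesgue_rV_eball R n 0 2 (ltr0n R 2).
rewrite sube_gt0; apply: (@lt_le_trans _ _ ((2 ^+ n)%:E * mu (eball 0 1))%E); last by rewrite -B2.
have key (b : \bar R) : b \is a fin_num -> (0 < b -> b < (2 ^+ n)%:E * b)%E.
  case: b => // b _; rewrite lte_fin => b0.
  by rewrite -EFinM lte_fin ltr_pMl// exprn_egt1// ?ltr1n// -lt0n.
exact: key.
Qed.

Hypothesis n0 : (0 < n)%N.

Lemma kernel_shell_le y : shell y -> k y <= Lam.
Proof.
move=> /andP[y1 _]; apply: (le_trans (kernel_le kP y)).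
rewrite ler_piMr ?Lam_ge0//.
have e1 : 1 `^ (- gam) = 1 :> R by rewrite powR1.
by rewrite -[leRHS]e1; apply: ler_powR_neg => //; rewrite oppr_le0 ltW// gam_gt0.
Qed.

Lemma kernel_shell_ge y : shell y -> lam * 2 `^ (- gam) <= k y.
Proof.
move=> /andP[y1 y2]; apply: le_trans (kernel_ge kP y).
rewrite ler_pM2l ?(kernel_lam kP)//.
apply: ler_powR_neg => //; last by rewrite oppr_le0 ltW// gam_gt0.
exact: lt_le_trans y1.
Qed.

Lemma measurable_kernel_polar (phi : R -> R) :
  measurable_fun setT (phi : measurableTypeR R -> measurableTypeR R) ->
  (forall r, 0 <= phi r) ->
  measurable_fun (@shell R n) (fun y => \int[leb]_(t in `]0%R, +oo[)
     (k y * (phi (t * enorm y) * t `^ (- 1 - 2 * s)))%:E)%E.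
Proof.
move=> mphi phi0; apply: measurable_funTS.
pose I0 (t : measurableTypeR R) : R := \1_(`]0%R, +oo[%classic : set (measurableTypeR R)) t.
have mI0 : measurable_fun setT I0 by exact: measurable_indic.
pose G (p : measurableTypeR R * 'rV[R]_n) : \bar R :=
  (I0 p.1 * (k p.2 * (phi (p.1 * enorm p.2) * p.1 `^ (- 1 - 2 * s))))%:E.
have mG : measurable_fun setT G.
  apply/measurable_EFinP; apply: measurable_funM; first exact: measurableT_comp.
  apply: measurable_funM; first exact: (measurableT_comp (kernel_measurable kP)).
  apply: measurable_funM; last exact: (measurableT_comp (measurable_powR _) measurable_fst).
  apply: (measurableT_comp mphi); apply: measurable_funM; first exact: measurable_fst.
  exact: (measurableT_comp (measurable_enorm (n:=n)) measurable_snd).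
have G0 p : (0 <= G p)%E.
  by rewrite lee_fin !mulr_ge0 ?kernel_ge0 ?powR_ge0// /I0 indicE.
have := @measurable_fun_fubini_tonelli_G _ _ _ _ _ leb G mG G0.
congr measurable_fun; apply/funext => y.
rewrite /fubini_G [RHS]integral_mkcond; apply: eq_integral => t _.
by rewrite patchE /G /I0 /= indicE; case: (_ \in _); rewrite ?mul1r ?mul0r.
Qed.

(** Homogeneity turns k (t y) t^n / t into k y times t^(-1-2s): on each ray the dimension disappears
    and only the one-dimensional weight is left. *)
Lemma kernel_polar (phi : R -> R) :
  measurable_fun setT (phi : measurableTypeR R -> measurableTypeR R) ->
  (forall r, 0 <= phi r) ->
  ((ln 2)%:E * \int[mu]_y (phi (enorm y) * k y)%:E =
   \int[mu]_(y in @shell R n)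
     \int[leb]_(t in `]0%R, +oo[) (k y * (phi (t * enorm y) * t `^ (- 1 - 2 * s)))%:E)%E.
Proof.
move=> mphi phi0.
rewrite (@ge0_integral_polar _ _ (fun y => phi (enorm y) * k y)); first last.
- by rewrite kernel0 mulr0.
- by move=> y; rewrite mulr_ge0// kernel_ge0.
- apply: measurable_funM; last exact: kernel_measurable kP.
  exact: (measurableT_comp mphi (measurable_enorm (n:=n))).
apply: eq_integral => y _; apply: eq_integral => t.
rewrite inE /= in_itv/= andbT => t0; congr (_%:E).
rewrite enormZ gtr0_norm// (kernel_hom kP)//.
have -> : t ^+ n / t = t `^ (n%:R - 1).
  by rewrite powRDp// powR_mulrn ?(ltW t0)// powR_inv1// ltW.
have -> : - 1 - 2 * s = - gam + (n%:R - 1) by lra.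
by rewrite (powRDp (- gam) _ t0); ring.
Qed.

Lemma kernel_far_fin e : 0 < e -> (\int[mu]_(y in far e) (k y)%:E < +oo)%E.
Proof.
move=> e0; have ln20 : 0 < ln 2 :> R by rewrite ln_gt0// ltr1n.
have s20 : 0 < 2 * s by rewrite mulr_gt0.
have e20 : 0 < e / 2 by rewrite divr_gt0.
pose phi (r : R) : R := \1_(`[e, +oo[%classic : set (measurableTypeR R)) r.
have mphi : measurable_fun setT (phi : measurableTypeR R -> measurableTypeR R).
  exact: measurable_indic.
have phi0 r : 0 <= phi r by rewrite /phi indicE.
have -> : (\int[mu]_(y in far e) (k y)%:E = \int[mu]_y (phi (enorm y) * k y)%:E)%E.
  rewrite integral_mkcond; apply: eq_integral => y _; rewrite patchE /phi indicE.
  have -> : (y \in far e) = (enorm y \in `[e, +oo[%classic).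
    by apply/idP/idP; rewrite !inE farE /= in_itv/= andbT.
  by case: (_ \in _); rewrite ?mul1r ?mul0r.
suff : ((ln 2)%:E * \int[mu]_y (phi (enorm y) * k y)%:E < +oo)%E.
  move=> h; have [//|] := ltP (\int[mu]_y (phi (enorm y) * k y)%:E)%E +oo%E.
  by rewrite leye_eq => /eqP Ioo; rewrite Ioo gt0_muley ?lte_fin// ltxx in h.
rewrite kernel_polar//.
have C0 : 0 <= Lam * ((e / 2) `^ (- (2 * s)) / (2 * s)).
  by rewrite mulr_ge0 ?Lam_ge0// divr_ge0 ?powR_ge0// ltW.
apply: (@le_lt_trans _ _ (\int[mu]_(y in @shell R n)
    (Lam * ((e / 2) `^ (- (2 * s)) / (2 * s)))%:E))%E; last first.
  rewrite integral_cst//; last exact: measurable_shell.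
  by rewrite lte_mul_pinfty ?mu_shell_fin// lee_fin.
apply: ge0_le_integral => //.
- exact: measurable_shell.
- by move=> y _; apply: integral_ge0 => t _; rewrite lee_fin !mulr_ge0 ?kernel_ge0 ?powR_ge0.
- exact: measurable_kernel_polar.
- move=> y ys; rewrite ge0_integralZlR//; first last.
  + exact: kernel_ge0.
  + by move=> t _; rewrite mulr_ge0 ?powR_ge0.
  + apply: measurable_funTS; apply: measurable_funM; last exact: measurable_powR.
    apply: (measurableT_comp mphi); exact: measurable_funM.
  rewrite EFinM; apply: lee_pmul; rewrite ?lee_fin ?kernel_ge0 ?kernel_shell_le//.
    by apply: integral_ge0 => t _; rewrite lee_fin mulr_ge0 ?powR_ge0.
  apply: (le_trans _ (integral_powR_cy e20 s20)).
  rewrite integral_mkcond [leRHS]integral_mkcond; apply: ge0_le_integral => //.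
  + move=> t _; apply: erestrict_ge0 => {}t _; by rewrite lee_fin mulr_ge0 ?powR_ge0.
  + apply/(measurable_restrictT _ _).1 => //.
    apply/measurable_EFinP; apply: measurable_funTS; apply: measurable_funM; last exact: measurable_powR.
    apply: (measurableT_comp mphi); exact: measurable_funM.
  + apply/(measurable_restrictT _ _).1 => //.
    by apply/measurable_EFinP; apply: measurable_funTS; exact: measurable_powR.
  + move=> t _; rewrite !patchE; case: ifPn => [t0|_]; last first.
      by case: ifPn => // _; rewrite lee_fin powR_ge0.
    rewrite inE /= in_itv/= andbT in t0.
    rewrite /phi indicE; case: ifPn => te.
      rewrite (_ : - 1 - 2 * s = - (2 * s) - 1); last by lra.
      by rewrite lee_fin ler_piMl ?powR_ge0//; case: (_ \in _).
    rewrite memNset ?mul0r//= in_itv/= andbT => h; move/negP: te; apply.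
    rewrite inE /= in_itv/= andbT ler_pdivrMr//.
    by apply: (le_trans h); rewrite ler_pM2l//; case/andP: ys.
Qed.

(** This second moment of the short jumps controls every function whose second differences are of
    order |y|^2, uniformly in the truncation. *)
Lemma kernel_near : exists2 C, 0 <= C & forall e, 0 < e ->
  (\int[mu]_(y in eball 0 e) (enorm y ^+ 2 * k y)%:E <= (C * e `^ (2 - 2 * s))%:E)%E.
Proof.
have ln20 : 0 < ln 2 :> R by rewrite ln_gt0// ltr1n.
have s22 : 0 < 2 - 2 * s by have := s1; lra.
have shfin : mu (@shell R n) \is a fin_num by rewrite ge0_fin_numE ?measure_ge0// mu_shell_fin.
exists ((ln 2)^-1 * (Lam * (4 / (2 - 2 * s)) * fine (mu (@shell R n)))).
  by rewrite !mulr_ge0 ?invr_ge0 ?Lam_ge0 ?fine_ge0 ?measure_ge0 ?ltW.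
move=> e e0.
pose phi (r : R) : R := r ^+ 2 * \1_(`]-oo, e[%classic : set (measurableTypeR R)) r.
have mphi : measurable_fun setT (phi : measurableTypeR R -> measurableTypeR R).
  by apply: measurable_funM; [exact: measurable_funX|exact: measurable_indic].
have phi0 r : 0 <= phi r by rewrite /phi indicE mulr_ge0 ?sqr_ge0.
have pp t y : 0 <= phi (t * enorm y) * t `^ (- 1 - 2 * s).
  by apply: mulr_ge0; [exact: phi0|exact: powR_ge0].
have -> : (\int[mu]_(y in eball 0 e) (enorm y ^+ 2 * k y)%:E = \int[mu]_y (phi (enorm y) * k y)%:E)%E.
  rewrite integral_mkcond; apply: eq_integral => y _; rewrite patchE /phi indicE.
  have -> : (y \in eball 0 e) = (enorm y \in `]-oo, e[%classic).
    by apply/idP/idP; rewrite !inE eballE /= in_itv/= subr0.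
  by case: (_ \in _); rewrite ?mulr1 ?mulr0 ?mul0r.
rewrite -(mulrA (ln 2)^-1) EFinM lee_pdivlMl// kernel_polar//.
apply: (@le_trans _ _ (\int[mu]_(y in @shell R n)
    (Lam * (4 * (e `^ (2 - 2 * s) / (2 - 2 * s))))%:E))%E; last first.
  rewrite integral_cst//; last exact: measurable_shell.
  rewrite [X in (_ * X)%E](_ : _ = (fine (mu (@shell R n)))%:E); last by rewrite fineK.
  by rewrite -EFinM lee_fin le_eqVlt; apply/orP; left; apply/eqP; ring.
apply: ge0_le_integral => //.
- exact: measurable_shell.
- by move=> y _; apply: integral_ge0 => t _; rewrite lee_fin; apply: mulr_ge0; [exact: kernel_ge0|exact: pp].
- exact: measurable_kernel_polar.
- move=> y ys; rewrite ge0_integralZlR//; first last.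
  + exact: kernel_ge0.
  + apply: measurable_funTS; apply: measurable_funM; last exact: measurable_powR.
    apply: (measurableT_comp mphi); exact: measurable_funM.
  rewrite EFinM; apply: lee_pmul; rewrite ?lee_fin ?kernel_ge0 ?kernel_shell_le//.
    by apply: integral_ge0 => t _; rewrite lee_fin; exact: pp.
  apply: (@le_trans _ _ (4%:E * \int[leb]_(t in `]0%R, e]) (t `^ (2 - 2 * s - 1))%:E)%E); last first.
    by rewrite EFinM lee_pmul2l//; exact: integral_powR_oc.
  rewrite -ge0_integralZlR//; last 2 first.
  + by apply: measurable_funTS; exact: measurable_powR.
  + by move=> t _; exact: powR_ge0.
  rewrite integral_mkcond [leRHS]integral_mkcond; apply: ge0_le_integral => //.
  + by move=> t _; apply: erestrict_ge0 => {}t _; rewrite lee_fin; exact: pp.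
  + apply/(measurable_restrictT _ _).1 => //.
    apply/measurable_EFinP; apply: measurable_funTS; apply: measurable_funM; last exact: measurable_powR.
    apply: (measurableT_comp mphi); exact: measurable_funM.
  + apply/(measurable_restrictT _ _).1 => //.
    apply/measurable_EFinP; apply: measurable_funTS; apply: measurable_funM; first exact: measurable_cst.
    exact: measurable_powR.
  + move=> t _; rewrite !patchE; case: ifPn => [t0|_]; last first.
      by case: ifPn => // _; rewrite lee_fin mulr_ge0 ?powR_ge0.
    rewrite inE /= in_itv/= andbT in t0; case/andP: ys => y1 y2.
    have t2 : t ^+ 2 * t `^ (- 1 - 2 * s) = t `^ (2 - 2 * s - 1).
      by rewrite -powR_mulrn ?(ltW t0)// -powRDp//; congr (_ `^ _); lra.
    rewrite /phi indicE; case: ifPn => te.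
      rewrite lee_fin -t2 exprMn mulrA ler_wpM2r ?powR_ge0//.
      apply: (@le_trans _ _ (t ^+ 2 * enorm y ^+ 2)).
        apply: ler_piMr; last by rewrite lern1 leq_b1.
        by apply: mulr_ge0; exact: sqr_ge0.
      rewrite mulrC ler_wpM2r ?sqr_ge0//.
      have -> : 4 = 2 ^+ 2 :> R by rewrite -natrX.
      by rewrite ler_pXn2r// nnegrE// enorm_ge0.
    rewrite memNset ?mulr0 ?mul0r//= in_itv/= => h; move/negP: te; apply.
    rewrite inE /= in_itv/= t0/= ltW//; apply: le_lt_trans h.
    by rewrite ler_pMr.
Qed.

(** The jump rate diverges as the truncation shrinks. This is what will make the potential of a
    density of small integral uniformly small. *)
Lemma kernel_far_ge M : exists2 d, 0 < d & (M%:E <= \int[mu]_(y in far d) (k y)%:E)%E.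
Proof.
have ln20 : 0 < ln 2 :> R by rewrite ln_gt0// ltr1n.
have s20 : 0 < 2 * s by rewrite mulr_gt0.
have shfin : mu (@shell R n) \is a fin_num by rewrite ge0_fin_numE ?measure_ge0// mu_shell_fin.
have sh0 : 0 < fine (mu (@shell R n)).
  by rewrite fine_gt0// mu_shell_gt0//= mu_shell_fin.
pose c := (ln 2)^-1 * (lam * 2 `^ (- gam) * fine (mu (@shell R n)) / (2 * s)).
have c0 : 0 < c.
  by rewrite /c !mulr_gt0 ?invr_gt0 ?powR_gt0 ?(kernel_lam kP)// mulr_gt0.
(* Integrating over d <= t <= 1 on each ray of the shell yields at least c (d^(-2s) - 1). The radius
   [d] is chosen with d^(-2s) = N; N >= 2 gives d < 1, and c (N - 1) = c + |M| exceeds M. *)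
pose N := 2 + `|M| / c.
have N2 : 2 <= N by rewrite lerDl divr_ge0// ltW.
have N0 : 0 < N by lra.
pose d := N `^ (- (2 * s)^-1).
have d0 : 0 < d by exact: powR_gt0.
have dN : d `^ (- (2 * s)) = N.
  by rewrite /d -powRrM mulrNN mulVf ?gt_eqF// powRr1// ltW.
have d1 : d < 1.
  rewrite ltNge; apply/negP => d1.
  have : d `^ (- (2 * s)) <= 1 `^ (- (2 * s)).
    by apply: ler_powR_neg => //; rewrite oppr_le0 ltW.
  by rewrite dN powR1 /=; lra.
exists d => //.
pose phi (r : R) : R := \1_(`[d, +oo[%classic : set (measurableTypeR R)) r.
have mphi : measurable_fun setT (phi : measurableTypeR R -> measurableTypeR R).
  exact: measurable_indic.
have phi0 r : 0 <= phi r by rewrite /phi indicE.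
have -> : (\int[mu]_(y in far d) (k y)%:E = \int[mu]_y (phi (enorm y) * k y)%:E)%E.
  rewrite integral_mkcond; apply: eq_integral => y _; rewrite patchE /phi indicE.
  have -> : (y \in far d) = (enorm y \in `[d, +oo[%classic).
    by apply/idP/idP; rewrite !inE farE /= in_itv/= andbT.
  by case: (_ \in _); rewrite ?mul1r ?mul0r.
apply: (@le_trans _ _ (c * (N - 1))%:E).
  rewrite lee_fin -ler_pdivrMl// mulrC /N; have := ler_norm (M / c).
  by rewrite normrM normfV (gtr0_norm c0); lra.
rewrite /c -(mulrA (ln 2)^-1) EFinM lee_pdivrMl// kernel_polar//.
apply: (@le_trans _ _ (\int[mu]_(y in @shell R n)
    (lam * 2 `^ (- gam) * ((N - 1) / (2 * s)))%:E))%E.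
  rewrite integral_cst//; last exact: measurable_shell.
  rewrite [X in (_ * X)%E](_ : _ = (fine (mu (@shell R n)))%:E); last by rewrite fineK.
  by rewrite -EFinM lee_fin le_eqVlt; apply/orP; left; apply/eqP; ring.
have lg0 : 0 <= lam * 2 `^ (- gam).
  by rewrite mulr_ge0 ?powR_ge0// ltW// (kernel_lam kP).
apply: ge0_le_integral => //.
- exact: measurable_shell.
- by move=> y _; rewrite lee_fin mulr_ge0// divr_ge0//; [lra|exact: ltW].
- exact: measurable_kernel_polar.
- move=> y ys; rewrite ge0_integralZlR//; first last.
  + exact: kernel_ge0.
  + by move=> t _; rewrite mulr_ge0 ?powR_ge0.
  + apply: measurable_funTS; apply: measurable_funM; last exact: measurable_powR.
    apply: (measurableT_comp mphi); exact: measurable_funM.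
  have Ns : 0 <= (N - 1) / (2 * s) by rewrite divr_ge0//; [lra|exact: ltW].
  rewrite EFinM; apply: lee_pmul; rewrite ?lee_fin ?kernel_shell_ge//.
  have -> : (((N - 1) / (2 * s))%:E = \int[leb]_(t in `[d, 1%R]) (t `^ (- (2 * s) - 1))%:E)%E.
    rewrite integral_powR ?oppr_eq0 ?gt_eqF// powR1 dN; congr EFin.
    by field; rewrite gt_eqF.
  rewrite [leLHS]integral_mkcond [leRHS]integral_mkcond. apply: ge0_le_integral => //.
  + by move=> t _; apply: erestrict_ge0 => {}t _; rewrite lee_fin powR_ge0.
  + apply/(measurable_restrictT _ _).1 => //.
    by apply/measurable_EFinP; apply: measurable_funTS; exact: measurable_powR.
  + apply/(measurable_restrictT _ _).1 => //.
    apply/measurable_EFinP; apply: measurable_funTS; apply: measurable_funM; last exact: measurable_powR.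
    apply: (measurableT_comp mphi); exact: measurable_funM.
  + move=> t _; rewrite !patchE; case: ifPn => [t0|_]; last first.
      by case: ifPn => // _; rewrite lee_fin mulr_ge0 ?powR_ge0.
    rewrite inE /= in_itv/= in t0; case/andP: t0 => dt t1.
    have t0 : 0 < t by exact: lt_le_trans dt.
    rewrite mem_set/= ?in_itv/= ?t0// /phi indicE mem_set/= ?in_itv/= ?andbT.
      by rewrite mul1r (_ : - 1 - 2 * s = - (2 * s) - 1)//; lra.
    by apply: (le_trans dt); rewrite ler_pMr//; case/andP: ys.
Qed.

Lemma integrable_kernel e : 0 < e -> mu.-integrable (far e) (EFin \o k).
Proof.
move=> e0; apply/integrableP; split.
  by apply/measurable_EFinP/measurable_funTS; exact: kernel_measurable kP.
under eq_integral do rewrite /= ger0_norm ?kernel_ge0//.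
exact: kernel_far_fin.
Qed.

Lemma integrable_mul_kernel (g : 'rV[R]_n -> R) (M e : R) : 0 < e ->
  measurable_fun setT (g : _ -> measurableTypeR R) -> (forall y, `|g y| <= M) ->
  mu.-integrable (far e) (fun y => (g y * k y)%:E).
Proof.
move=> e0 mg gM.
have M0 : 0 <= M by exact: le_trans (gM 0).
apply: (@le_integrable _ _ _ _ _ (measurable_far e) _ (fun y => (M%:E * (EFin \o k) y)%E)).
- apply/measurable_EFinP/measurable_funTS; apply: measurable_funM => //.
  exact: kernel_measurable kP.
- move=> y _; rewrite /= lee_fin !normrM !(ger0_norm (kernel_ge0 _)) (ger0_norm M0).
  by rewrite ler_wpM2r ?kernel_ge0.
- by apply: integrableZl; [exact: measurable_far|exact: integrable_kernel].
Qed.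

End kernel.

(** * Truncated operators on bounded Borel functions *)

Section operator.
Context {R : realType} {n : nat} {s lam Lam : R} {k : 'rV[R]_n -> R}.
Hypothesis kP : kernel_spec s lam Lam k.
Hypothesis n0 : (0 < n)%N.
Local Notation mu := (lebesgue_rV R n).

Definition bmeas (w : 'rV[R]_n -> R) : Prop :=
  measurable_fun setT (w : _ -> measurableTypeR R) /\
  exists M, forall x, `|w x| <= M.

Definition Lop (e : R) (w : 'rV[R]_n -> R) (x : 'rV[R]_n) : R :=
  \int[mu]_(y in far e) ((w x - w (x + y)) * k y).

Definition mass (e : R) : R := \int[mu]_(y in far e) k y.

Definition jconv (e : R) (w : 'rV[R]_n -> R) (x : 'rV[R]_n) : R :=
  \int[mu]_(y in far e) (w (x + y) * k y).

Lemma measurable_addl (w : 'rV[R]_n -> R) x :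
  measurable_fun setT (w : _ -> measurableTypeR R) ->
  measurable_fun setT ((fun y => w (x + y)) : _ -> measurableTypeR R).
Proof.
move=> mw; have := measurableT_comp mw (@measurable_affine_rV R n 1 x).
by congr measurable_fun; apply/funext => y /=; rewrite scale1r addrC.
Qed.

Lemma measurable_subl (w : 'rV[R]_n -> R) x :
  measurable_fun setT (w : _ -> measurableTypeR R) ->
  measurable_fun setT ((fun y => w (x - y)) : _ -> measurableTypeR R).
Proof.
move=> mw; have := measurableT_comp mw (@measurable_affine_rV R n (-1) x).
by congr measurable_fun; apply/funext => y /=; rewrite scaleN1r addrC.
Qed.

Lemma bmeas_shift w x : bmeas w -> bmeas (fun y => w (x + y)).
Proof. by move=> [mw [M wM]]; split; [exact: measurable_addl|exists M]. Qed.

Lemma bmeas_refl w x : bmeas w -> bmeas (fun y => w (x - y)).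
Proof. by move=> [mw [M wM]]; split; [exact: measurable_subl|exists M]. Qed.

Lemma bmeas_cst c : bmeas (fun=> c).
Proof. by split; [exact: measurable_cst|exists `|c|]. Qed.

Lemma bmeasD f g : bmeas f -> bmeas g -> bmeas (fun x => f x + g x).
Proof.
move=> [mf [M fM]] [mg [N gN]]; split; first exact: measurable_funD.
by exists (M + N) => x; rewrite (le_trans (ler_normD _ _))// lerD.
Qed.

Lemma bmeasZ c f : bmeas f -> bmeas (fun x => c * f x).
Proof.
move=> [mf [M fM]]; split; first exact: measurable_funM.
by exists (`|c| * M) => x; rewrite normrM ler_wpM2l.
Qed.

Lemma bmeasB f g : bmeas f -> bmeas g -> bmeas (fun x => f x - g x).
Proof.
move=> bf bg; have := bmeasD bf (bmeasZ (-1) bg).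
by congr bmeas; apply/funext => x; rewrite mulN1r.
Qed.

Lemma integrable_bmeas e g : 0 < e -> bmeas g ->
  mu.-integrable (far e) (EFin \o (fun y => g y * k y)).
Proof. by move=> e0 [mg [M gM]]; exact: (integrable_mul_kernel kP n0 e0 mg gM). Qed.

Lemma integrable_mass e : 0 < e -> mu.-integrable (far e) (EFin \o k).
Proof. exact: (integrable_kernel kP n0). Qed.

Lemma massE e : 0 < e -> ((mass e)%:E = \int[mu]_(y in far e) (k y)%:E)%E.
Proof.
move=> e0; rewrite /mass /Rintegral fineK//.
exact: (integrable_fin_num (measurable_far e) (integrable_mass e0)).
Qed.

Lemma mass_ge0 e : 0 <= mass e.
Proof. by apply: Rintegral_ge0 => y _; exact: (kernel_ge0 kP). Qed.

(** With jumps of size at least e only, the operator is a finite jump rate times the identity minus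
    an average. The average is linear and order preserving, and all maximum principles below rest on
    that. *)
Lemma LopE e w x : 0 < e -> bmeas w -> Lop e w x = mass e * w x - jconv e w x.
Proof.
move=> e0 bw; rewrite /Lop /mass /jconv.
rewrite -RintegralZr//; first last.
- exact: integrable_mass.
- exact: measurable_far.
rewrite -RintegralB//; first last.
- exact: integrable_bmeas (bmeas_shift x bw).
- have := integrable_bmeas e0 (bmeas_cst (w x)).
  by apply: eq_integrable => [|y _]; [exact: measurable_far|rewrite /= mulrC].
- exact: measurable_far.
by apply: eq_Rintegral => y _; rewrite mulrBl (mulrC (k y)).
Qed.

Lemma convD e f g x : 0 < e -> bmeas f -> bmeas g ->
  jconv e (fun y => f y + g y) x = jconv e f x + jconv e g x.
Proof.
move=> e0 bf bg; rewrite /jconv -RintegralD//.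
- by apply: eq_Rintegral => y _; rewrite mulrDl.
- exact: measurable_far.
- exact: integrable_bmeas (bmeas_shift x bf).
- exact: integrable_bmeas (bmeas_shift x bg).
Qed.

Lemma convZ e c f x : 0 < e -> bmeas f ->
  jconv e (fun y => c * f y) x = c * jconv e f x.
Proof.
move=> e0 bf; rewrite /jconv -RintegralZl//.
- by apply: eq_Rintegral => y _; rewrite mulrA.
- exact: measurable_far.
- exact: integrable_bmeas (bmeas_shift x bf).
Qed.

Lemma LopD e f g x : 0 < e -> bmeas f -> bmeas g ->
  Lop e (fun y => f y + g y) x = Lop e f x + Lop e g x.
Proof.
by move=> e0 bf bg; rewrite !LopE ?convD//; [ring|exact: bmeasD].
Qed.

Lemma LopZ e c f x : 0 < e -> bmeas f ->
  Lop e (fun y => c * f y) x = c * Lop e f x.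
Proof. by move=> e0 bf; rewrite !LopE ?convZ//; [ring|exact: bmeasZ]. Qed.

Lemma le_conv e f g x : 0 < e -> bmeas f -> bmeas g ->
  (forall y, f y <= g y) -> jconv e f x <= jconv e g x.
Proof.
move=> e0 bf bg fg; apply: le_Rintegral; first exact: measurable_far.
- exact: integrable_bmeas (bmeas_shift x bf).
- exact: integrable_bmeas (bmeas_shift x bg).
- by move=> y _; rewrite ler_wpM2r// (kernel_ge0 kP).
Qed.

Lemma conv_cst e c x : 0 < e -> jconv e (fun=> c) x = c * mass e.
Proof.
move=> e0; rewrite /jconv /mass -RintegralZl//; first exact: measurable_far.
exact: integrable_mass.
Qed.

Lemma conv_ge0 e w x : (forall y, 0 <= w y) -> 0 <= jconv e w x.
Proof. by move=> w0; apply: Rintegral_ge0 => y _; rewrite mulr_ge0// (kernel_ge0 kP). Qed.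

Lemma conv_EFin e w x : 0 < e -> bmeas w ->
  ((jconv e w x)%:E = \int[mu]_(y in far e) (w (x + y) * k y)%:E)%E.
Proof.
move=> e0 bw; rewrite /jconv /Rintegral fineK//.
exact: (integrable_fin_num (measurable_far e) (integrable_bmeas e0 (bmeas_shift x bw))).
Qed.

Lemma far_opp e y : far e (- y) = far e (y : 'rV[R]_n).
Proof. by rewrite !farE enormN. Qed.

Lemma conv_sym e w x : 0 < e -> bmeas w -> (forall y, 0 <= w y) ->
  jconv e w x = \int[mu]_(y in far e) (w (x - y) * k y).
Proof.
move=> e0 [mw wM] w0; rewrite /jconv /Rintegral; congr fine.
rewrite integral_mkcond [RHS]integral_mkcond -ge0_integral_oppr.
- apply: eq_integral => y _; rewrite !patchE.
  have -> : (- y \in far e) = (y \in far e) by apply/idP/idP; rewrite !inE far_opp.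
  by case: ifP => // _; rewrite (kernel_sym kP).
- apply/(measurable_restrictT _ _).1; first exact: measurable_far.
  apply/measurable_EFinP/measurable_funTS; apply: measurable_funM.
    exact: measurable_addl.
  exact: kernel_measurable kP.
- by move=> y; apply: erestrict_ge0 => {}y _; rewrite lee_fin mulr_ge0// (kernel_ge0 kP).
Qed.

Definition diff2 (w : 'rV[R]_n -> R) (x y : 'rV[R]_n) : R :=
  2 * w x - w (x + y) - w (x - y).

Lemma bmeas_diff2 w x : bmeas w -> bmeas (diff2 w x).
Proof.
move=> bw; apply: bmeasB; last exact: bmeas_refl.
by apply: bmeasB; [exact: bmeas_cst|exact: bmeas_shift].
Qed.

(** Evenness of the kernel symmetrises the integral. Second differences compensate the singularity
    of the kernel at the origin, so estimates in this form survive as e tends to 0. *)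
Lemma Lop_diff2 e w x : 0 < e -> bmeas w -> (forall y, 0 <= w y) ->
  2 * Lop e w x = \int[mu]_(y in far e) (diff2 w x y * k y).
Proof.
move=> e0 bw w0.
have -> : 2 * Lop e w x = 2 * w x * mass e - jconv e w x - \int[mu]_(y in far e) (w (x - y) * k y).
  by rewrite LopE// -conv_sym//; ring.
have i1 := integrable_bmeas e0 (bmeas_cst (2 * w x)).
have i2 := integrable_bmeas e0 (bmeas_shift x bw).
have i3 := integrable_bmeas e0 (bmeas_refl x bw).
have mf := @measurable_far R n e.
rewrite -(conv_cst (2 * w x) 0 e0) /jconv -RintegralB//.
rewrite -RintegralB//; last first.
  have := integrableB mf i1 i2; apply: eq_integrable => // y _.
by apply: eq_Rintegral => y _; rewrite /diff2; ring.
Qed.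

End operator.

(** * Potentials of null sets *)

Section resolvent.
Context {R : realType} {n : nat} {s lam Lam : R} {k : 'rV[R]_n -> R}.
Hypothesis kP : kernel_spec s lam Lam k.
Hypothesis n0 : (0 < n)%N.
Local Notation mu := (lebesgue_rV R n).
Local Notation Lop := (@Lop R n k).
Local Notation mass := (@mass R n k).
Local Notation jconv := (@jconv R n k).

(* This class is stable under averaging by jumps of size at least [e], so the
   solution of [p + L_e p = h] inherits the bounds of [h] uniformly in [e]. *)
Record smooth_density (eta l D : R) (w : 'rV[R]_n -> R) : Prop := SmoothDensity {
  sd01 : forall x, 0 <= w x <= 1 ;
  sd_lip : forall x y, w x <= w y + l * enorm (x - y) ;
  sd_diff2 : forall x y, `|diff2 w x y| <= D * enorm y ^+ 2 ;
  sd_int : (\int[mu]_x (w x)%:E <= eta%:E)%E }.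

Lemma lipschitz_continuous (l : R) (w : 'rV[R]_n -> R) :
  (forall x y, w x <= w y + l * enorm (x - y)) -> continuous w.
Proof.
move=> wl x; have FF : Filter (nbhs x) by exact: nbhs_filter.
apply/cvgrPdist_lt => e e0; apply/nbhs_eballP; exists (e / (`|l| + 1)).
  by rewrite divr_gt0// ltr_wpDl.
move=> y; rewrite eballE ltr_pdivlMr; last by rewrite ltr_wpDl.
move=> yx; have := wl x y; have := wl y x; rewrite (enormBC x y).
have h : l * enorm (y - x) <= `|l| * enorm (y - x).
  by rewrite ler_wpM2r ?enorm_ge0// ler_norm.
have := enorm_ge0 (y - x); rewrite /= ltr_norml; move: yx h.
by rewrite mulrDr mulr1 (mulrC _ `|l|); lra.
Qed.

Lemma sd_continuous eta l D w : smooth_density eta l D w -> continuous w.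
Proof. by move=> [_ wl _ _]; exact: lipschitz_continuous wl. Qed.

Lemma sd_bmeas eta l D w : smooth_density eta l D w -> bmeas w.
Proof.
move=> wP; split; first by apply: continuous_measurable_rV; exact: sd_continuous wP.
by exists 1 => x; have /andP[w0 w1] := sd01 wP x; rewrite ger0_norm.
Qed.

Lemma conv_shift e w x z : jconv e w (x + z) = jconv e (fun t => w (t + z)) x.
Proof. by apply: eq_Rintegral => y _; rewrite addrAC. Qed.

Lemma bmeas_shiftr (w : 'rV[R]_n -> R) z : bmeas w -> bmeas (fun t => w (t + z)).
Proof.
move=> bw; have := bmeas_shift z bw.
by congr bmeas; apply/funext => t; rewrite addrC.
Qed.

Lemma measurable_add_rV : measurable_fun setT (fun p : 'rV[R]_n * 'rV[R]_n => p.1 + p.2).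
Proof.
apply: measurable_fun_rVP => i; under eq_fun do rewrite mxE.
apply: measurable_funD.
  exact: (measurableT_comp (measurable_coord i) measurable_fst).
exact: (measurableT_comp (measurable_coord i) measurable_snd).
Qed.

Lemma integral_conv e w : 0 < e -> bmeas w -> (forall x, 0 <= w x) ->
  (\int[mu]_x (jconv e w x)%:E = (mass e)%:E * \int[mu]_x (w x)%:E)%E.
Proof.
move=> e0 bw w0; have [mw _] := bw.
pose X (y : 'rV[R]_n) : R := \1_(far e) y.
have mX : measurable_fun setT (X : _ -> measurableTypeR R).
  by apply: measurable_indic; exact: measurable_far.
pose G (p : 'rV[R]_n * 'rV[R]_n) : \bar R := (X p.2 * k p.2 * w (p.1 + p.2))%:E.
have mk := kernel_measurable kP.
have mG : measurable_fun setT G.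
  apply/measurable_EFinP; apply: measurable_funM.
    by apply: measurable_funM; [exact: (measurableT_comp mX)|exact: (measurableT_comp mk)].
  exact: (measurableT_comp mw measurable_add_rV).
have Xk0 y : 0 <= X y * k y by rewrite mulr_ge0 ?(kernel_ge0 kP)// /X indicE.
have G0 p : (0 <= G p)%E by rewrite lee_fin; exact: mulr_ge0.
transitivity (\int[mu]_x \int[mu]_y G (x, y))%E.
  apply: eq_integral => x _; rewrite (conv_EFin kP n0)// integral_mkcond.
  apply: eq_integral => y _; rewrite patchE /G /X /= indicE.
  by case: (_ \in _); rewrite ?mul1r ?mul0r// mulrC.
rewrite (fubini_tonelli G mG G0).
transitivity (\int[mu]_y ((X y * k y)%:E * \int[mu]_x (w x)%:E))%E.
  apply: eq_integral => y _; rewrite /G /=.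
  rewrite ge0_integralZlR//; last exact: (bmeas_shiftr y bw).1.
  congr (_ * _)%E; apply: (@ge0_integral_shift R n y (fun x => (w x)%:E)).
    exact/measurable_EFinP.
  by move=> x; rewrite lee_fin.
rewrite ge0_integralZr//; first last.
- by apply: integral_ge0 => x _; rewrite lee_fin.
- by move=> y _; rewrite lee_fin.
- by apply/measurable_EFinP; exact: measurable_funM.
congr (_ * _)%E; rewrite (massE kP n0)// [RHS]integral_mkcond.
apply: eq_integral => y _; rewrite patchE /X indicE.
by case: (_ \in _); rewrite ?mul1r ?mul0r.
Qed.

Lemma conv_bounds e w c d x : 0 < e -> bmeas w -> (forall y, c <= w y <= d) ->
  c * mass e <= jconv e w x <= d * mass e.
Proof.
move=> e0 bw wb; rewrite -!(conv_cst kP n0 _ x e0).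
by apply/andP; split; apply: (le_conv kP n0) => //; try exact: bmeas_cst;
  move=> y; case/andP: (wb y).
Qed.

(** The new function is a convex combination of [h] and an average of translates of [p], and each of
    the four bounds is convex and translation invariant. A fixed point of this map solves p + L_e p
    = h. *)
Lemma sd_step eta l D h p e : 0 < e -> smooth_density eta l D h ->
  smooth_density eta l D p ->
  smooth_density eta l D (fun x => (h x + jconv e p x) / (1 + mass e)).
Proof.
move=> e0 hP pP; have bp := sd_bmeas pP; have bh := sd_bmeas hP.
have m0 := mass_ge0 kP e; have m1 : 0 < 1 + mass e by rewrite ltr_wpDr.
have p01 := sd01 pP; have h01 := sd01 hP.
split=> [x|x y|x y|].
- have /andP[c0 c1] := conv_bounds x e0 bp p01.
  have /andP[h0 h1] := h01 x.
  rewrite divr_ge0/=; [|by lra|exact: ltW].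
  by rewrite ler_pdivrMr//; lra.
- have : jconv e p x <= jconv e (fun z => p (z + (y - x)) + l * enorm (x - y)) x.
    apply: (le_conv kP n0) => //.
      by apply: bmeasD; [exact: bmeas_shiftr|exact: bmeas_cst].
    move=> z; have := sd_lip pP z (z + (y - x)).
    by rewrite opprD addNKr opprB.
  rewrite (convD kP n0)//; [|exact: bmeas_shiftr|exact: bmeas_cst].
  rewrite (conv_cst kP n0)// -conv_shift subrKC => h1.
  have h2 := sd_lip hP x y.
  have -> : (h y + jconv e p y) / (1 + mass e) + l * enorm (x - y) =
    (h y + jconv e p y + l * enorm (x - y) * (1 + mass e)) / (1 + mass e).
    by field; rewrite gt_eqF.
  by rewrite ler_pM2r ?invr_gt0// mulrDr mulr1; lra.
- have -> : diff2 (fun x => (h x + jconv e p x) / (1 + mass e)) x y =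
    (diff2 h x y + jconv e (fun z => diff2 p z y) x) / (1 + mass e).
    rewrite /diff2 !conv_shift.
    have -> : jconv e (fun z => 2 * p z - p (z + y) - p (z - y)) x =
      2 * jconv e p x - jconv e (fun z => p (z + y)) x - jconv e (fun z => p (z - y)) x.
      rewrite (_ : (fun z => _) = (fun z => (2 * p z + -1 * p (z + y)) + -1 * p (z - y))); last first.
        by apply/funext => z; ring.
      have b1 := bmeas_shiftr y bp; have b2 := bmeas_shiftr (- y) bp.
      rewrite (convD kP n0)//; [|by apply: bmeasD; exact: bmeasZ|exact: bmeasZ].
      rewrite (convD kP n0)//; [|exact: bmeasZ|exact: bmeasZ].
      by rewrite !(convZ kP n0)//; ring.
    by ring.
  rewrite normrM normfV (gtr0_norm m1) ler_pdivrMr// mulrDr mulr1.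
  apply: (le_trans (ler_normD _ _)); apply: lerD; first exact: sd_diff2 hP x y.
  have bd : bmeas (fun z => diff2 p z y).
    apply: bmeasB; last exact: bmeas_shiftr.
    by apply: bmeasB; [exact: bmeasZ|exact: bmeas_shiftr].
  have db z : - (D * enorm y ^+ 2) <= diff2 p z y <= D * enorm y ^+ 2.
    by rewrite -ler_norml; exact: sd_diff2 pP z y.
  have := conv_bounds x e0 bd db.
  by rewrite mulNr -ler_norml.
- have mh := bh.1; have mp := bp.1.
  have bc : bmeas (jconv e p).
    split; last first.
      by exists (mass e) => x; rewrite ger0_norm; have := conv_bounds x e0 bp p01; lra.
    apply: continuous_measurable_rV; apply: (@lipschitz_continuous (l * mass e)) => x y.
    have : jconv e p x <= jconv e (fun z => p (z + (y - x)) + l * enorm (x - y)) x.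
      apply: (le_conv kP n0) => //.
        by apply: bmeasD; [exact: bmeas_shiftr|exact: bmeas_cst].
      move=> z; have := sd_lip pP z (z + (y - x)).
      by rewrite opprD addNKr opprB.
    rewrite (convD kP n0)//; [|exact: bmeas_shiftr|exact: bmeas_cst].
    by rewrite (conv_cst kP n0)// -conv_shift subrKC mulrAC.
  have cge0 x : 0 <= jconv e p x.
    by apply: (conv_ge0 kP) => y; case/andP: (p01 y).
  under eq_integral do rewrite mulrC.
  rewrite ge0_integralZlR//; first last.
  + by rewrite invr_ge0 ltW.
  + by move=> x _; rewrite addr_ge0//; case/andP: (h01 x).
  + exact: measurable_funD mh bc.1.
  rewrite lee_pdivrMl//; under eq_integral do rewrite EFinD.
  rewrite ge0_integralD//; first last.
  + by apply/measurable_EFinP; exact: bc.1.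
  + by move=> x _; rewrite lee_fin.
  + by apply/measurable_EFinP.
  + by move=> x _; rewrite lee_fin; case/andP: (h01 x).
  rewrite integral_conv//; last by move=> x; case/andP: (p01 x).
  rewrite -EFinM mulrDl mul1r EFinD EFinM; apply: leeD; first exact: sd_int hP.
  by rewrite lee_wpmul2l// ?lee_fin//; exact: sd_int pP.
Qed.
End resolvent.

(** * Cutoff functions with bounded second differences *)

Section bump.
Context {R : realType}.

Definition sqrp (t : R) : R := (Num.max 0 t) ^+ 2.

(** Step from 0 to 1 on [0, 1] with second derivative 4 on the first half and -4 on the second. As a
    combination of truncated squares its second differences are bounded term by term: (2 + 4 + 2)
    times 2 gives the 16 of [sstep_diff2]. *)
Definition sstep (t : R) : R := 2 * sqrp t - 4 * sqrp (t - 2^-1) + 2 * sqrp (t - 1).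

Lemma sqrp_ge0E t : 0 <= t -> sqrp t = t ^+ 2.
Proof. by move=> t0; rewrite /sqrp max_r. Qed.

Lemma sqrp_le0E t : t <= 0 -> sqrp t = 0.
Proof. by move=> t0; rewrite /sqrp max_l// expr0n. Qed.

Lemma sqrp_diff2 (t u : R) : `|2 * sqrp t - sqrp (t + u) - sqrp (t - u)| <= 2 * u ^+ 2.
Proof.
wlog u0 : u / 0 <= u => [hw|].
  have [|/ltW u0] := leP 0 u; first exact: hw.
  have := hw (- u); rewrite oppr_ge0 opprK sqrrN => /(_ u0).
  by congr (_ <= _); congr `|_|; ring.
rewrite ler_norml; have [t0|/ltW t0] := leP 0 t.
  rewrite (sqrp_ge0E t0) sqrp_ge0E; last lra.
  have [tu|/ltW tu] := leP 0 (t - u).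
    by rewrite sqrp_ge0E//; apply/andP; split; nra.
  by rewrite sqrp_le0E//; apply/andP; split; nra.
rewrite (sqrp_le0E t0) (@sqrp_le0E (t - u)); last lra.
have [tu|/ltW tu] := leP 0 (t + u).
  by rewrite sqrp_ge0E//; apply/andP; split; nra.
by rewrite sqrp_le0E//; apply/andP; split; nra.
Qed.

Lemma sstep_diff2 (t u : R) : `|2 * sstep t - sstep (t + u) - sstep (t - u)| <= 16 * u ^+ 2.
Proof.
have h1 := sqrp_diff2 t u; have h2 := sqrp_diff2 (t - 2^-1) u.
have h3 := sqrp_diff2 (t - 1) u.
move: h1 h2 h3; rewrite !ler_norml /sstep.
rewrite (_ : t + u - 2^-1 = t - 2^-1 + u); last lra.
rewrite (_ : t - u - 2^-1 = t - 2^-1 - u); last lra.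
rewrite (_ : t + u - 1 = t - 1 + u); last lra.
rewrite (_ : t - u - 1 = t - 1 - u); last lra.
by move=> /andP[? ?] /andP[? ?] /andP[? ?]; apply/andP; split; lra.
Qed.

Lemma sstep_le0 t : t <= 0 -> sstep t = 0.
Proof. by move=> t0; rewrite /sstep !sqrp_le0E; lra. Qed.

Lemma sstep_ge1 t : 1 <= t -> sstep t = 1.
Proof. by move=> t0; rewrite /sstep !sqrp_ge0E; [field|lra|lra|lra]. Qed.

Lemma sstep_low t : 0 <= t <= 2^-1 -> sstep t = 2 * t ^+ 2.
Proof.
move=> /andP[t0 t1]; rewrite /sstep (sqrp_ge0E t0) (@sqrp_le0E (t - 2^-1)); last lra.
by rewrite (@sqrp_le0E (t - 1)); lra.
Qed.

Lemma sstep_high t : 2^-1 <= t <= 1 -> sstep t = 1 - 2 * (1 - t) ^+ 2.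
Proof.
move=> /andP[t0 t1]; rewrite /sstep (@sqrp_ge0E t); last lra.
rewrite (@sqrp_ge0E (t - 2^-1)); last lra.
by rewrite (@sqrp_le0E (t - 1)); [field|lra].
Qed.

Lemma sstep_mono_lip01 x y : 0 <= x -> x <= y -> y <= 1 ->
  sstep x <= sstep y <= sstep x + 2 * (y - x).
Proof.
move=> x0 xy y1; have [x2|/ltW x2] := leP x 2^-1; have [y2|/ltW y2] := leP y 2^-1.
- by rewrite !sstep_low; [apply/andP; split; nra|apply/andP; split; lra|apply/andP; split; lra].
- rewrite sstep_low ?x0// sstep_high ?y2// .
  by apply/andP; split; nra.
- have -> : x = y by lra.
  by rewrite lexx subrr mulr0 addr0 lexx.
- by rewrite !sstep_high; [apply/andP; split; nra|apply/andP; split; lra|apply/andP; split; lra].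
Qed.

Definition clip01 (t : R) : R := Num.min 1 (Num.max 0 t).

Lemma sstep_clip t : sstep t = sstep (clip01 t).
Proof.
rewrite /clip01; have [t0|t0] := leP 0 t; last first.
  by rewrite min_r// !sstep_le0// ltW.
by have [t1|t1] := leP 1 t; rewrite // !sstep_ge1.
Qed.

Lemma sstep_mono_lip x y : x <= y -> sstep x <= sstep y <= sstep x + 2 * (y - x).
Proof.
move=> xy; rewrite (sstep_clip x) (sstep_clip y).
have c01 t : 0 <= clip01 t <= 1.
  by rewrite le_min ler01 le_max lexx ge_min lexx.
have /andP[cxy cl] : clip01 x <= clip01 y <= clip01 x + (y - x).
  rewrite /clip01; have [] := leP 0 x; have [] := leP 0 y;
  have [] := leP 1 x; have [] := leP 1 y; have [] := leP (1 : R) 0; move=> *; lra.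
have /andP[x0 _] := c01 x; have /andP[_ y1] := c01 y.
by have /andP[h1 h2] := sstep_mono_lip01 x0 cxy y1; apply/andP; split; lra.
Qed.

Lemma sstep01 t : 0 <= sstep t <= 1.
Proof.
have [t0|/ltW t0] := leP t 0; first by rewrite sstep_le0// lexx ler01.
have /andP[h _] := sstep_mono_lip t0; rewrite sstep_le0// in h; rewrite h/=.
have [t1|/ltW t1] := leP 1 t; first by rewrite sstep_ge1.
by have /andP[+ _] := sstep_mono_lip t1; rewrite (@sstep_ge1 1).
Qed.

(** Rises on [-1, -1/2] and falls on [1/2, 1]. The factor 2 in the arguments makes each step
    4-Lipschitz with second differences at most 64 u^2; two steps give the constants 8 and 128
    below. *)
Definition bump1 (t : R) : R := sstep (2 * t + 2) - sstep (2 * t - 1).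

Lemma bump101 t : 0 <= bump1 t <= 1.
Proof.
have /andP[h1 h2] := sstep01 (2 * t + 2); have /andP[h3 h4] := sstep01 (2 * t - 1).
have /andP[h5 _] : sstep (2 * t - 1) <= sstep (2 * t + 2) <= sstep (2 * t - 1) + 2 * (2 * t + 2 - (2 * t - 1)).
  by apply: sstep_mono_lip; lra.
by rewrite /bump1; apply/andP; split; lra.
Qed.

Lemma bump1_lip x y : bump1 x <= bump1 y + 8 * `|x - y|.
Proof.
rewrite /bump1; have [xy|/ltW xy] := leP x y.
  have e1 : 2 * x + 2 <= 2 * y + 2 by lra.
  have e2 : 2 * x - 1 <= 2 * y - 1 by lra.
  have /andP[? ?] := sstep_mono_lip e1; have /andP[? ?] := sstep_mono_lip e2.
  by rewrite ler0_norm; lra.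
have e1 : 2 * y + 2 <= 2 * x + 2 by lra.
have e2 : 2 * y - 1 <= 2 * x - 1 by lra.
have /andP[? ?] := sstep_mono_lip e1; have /andP[? ?] := sstep_mono_lip e2.
by rewrite ger0_norm; lra.
Qed.

Lemma bump1_diff2 (t u : R) : `|2 * bump1 t - bump1 (t + u) - bump1 (t - u)| <= 128 * u ^+ 2.
Proof.
have := sstep_diff2 (2 * t + 2) (2 * u); have := sstep_diff2 (2 * t - 1) (2 * u).
rewrite /bump1 !ler_norml exprMn.
rewrite (_ : 2 * (t + u) + 2 = 2 * t + 2 + 2 * u); last lra.
rewrite (_ : 2 * (t - u) + 2 = 2 * t + 2 - 2 * u); last lra.
rewrite (_ : 2 * (t + u) - 1 = 2 * t - 1 + 2 * u); last lra.
rewrite (_ : 2 * (t - u) - 1 = 2 * t - 1 - 2 * u); last lra.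
rewrite (_ : 2 ^+ 2 = 4 :> R); last by rewrite expr2; lra.
by move=> /andP[? ?] /andP[? ?]; apply/andP; split; lra.
Qed.

Lemma bump1_supp t : 1 <= `|t| -> bump1 t = 0.
Proof.
rewrite /bump1 ler_normr => /orP[h|h].
  by rewrite !sstep_ge1 ?subrr//; lra.
by rewrite !sstep_le0 ?subrr//; lra.
Qed.

Lemma bump1_1 t : `|t| <= 2^-1 -> bump1 t = 1.
Proof.
rewrite /bump1 ler_norml => /andP[h1 h2].
by rewrite sstep_ge1 ?sstep_le0 ?subr0//; lra.
Qed.

End bump.

Section cutoff.
Context {R : realType} {n : nat}.
Local Notation mu := (lebesgue_rV R n).
Implicit Types (f g : 'rV[R]_n -> R).

Definition c11 (l D : R) f : Prop :=
  [/\ forall x, 0 <= f x <= 1, forall x y, f x <= f y + l * enorm (x - y)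
    & forall x y, `|diff2 f x y| <= D * enorm y ^+ 2].

Lemma c11_onem l D f : c11 l D f -> c11 l D (fun x => 1 - f x).
Proof.
move=> [f01 fl fD]; split=> [x|x y|x y].
- by have := f01 x; lra.
- by have := fl y x; rewrite enormBC; lra.
- have -> : diff2 (fun x => 1 - f x) x y = - diff2 f x y by rewrite /diff2; ring.
  by rewrite normrN.
Qed.

Lemma c11_cst1 : c11 0 0 (fun=> 1).
Proof.
split=> [x|x y|x y]; first by rewrite ler01 lexx.
  by rewrite mul0r addr0.
by rewrite /diff2 mulr1 (_ : 2 - 1 - 1 = 0) ?normr0 ?mul0r//; lra.
Qed.

(** Discrete Leibniz rule: the cross terms in the second difference of a product are two products of
    first differences, whence 2 l1 l2. *)
Lemma c11M l1 D1 l2 D2 f g : c11 l1 D1 f -> c11 l2 D2 g ->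
  c11 (l1 + l2) (D1 + D2 + 2 * l1 * l2) (fun x => f x * g x).
Proof.
move=> [f01 fl fD] [g01 gl gD].
have fl' x y : `|f x - f y| <= l1 * enorm (x - y).
  by rewrite ler_norml; have := fl x y; have := fl y x; rewrite (enormBC y x); lra.
have gl' x y : `|g x - g y| <= l2 * enorm (x - y).
  by rewrite ler_norml; have := gl x y; have := gl y x; rewrite (enormBC y x); lra.
split=> [x|x y|x y].
- have /andP[f0 f1] := f01 x; have /andP[g0 g1] := g01 x.
  by rewrite mulr_ge0//= mulr_ile1.
- have -> : f x * g x = f y * g y + (f x * (g x - g y) + g y * (f x - f y)) by ring.
  rewrite lerD2l; apply: (le_trans (ler_norm _)); apply: (le_trans (ler_normD _ _)).
  rewrite !normrM mulrDl addrC; have /andP[f0 f1] := f01 x; have /andP[g0 g1] := g01 y.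
  by apply: lerD; [rewrite ger0_norm// (le_trans _ (fl' x y))// ler_piMl
                  |rewrite ger0_norm// (le_trans _ (gl' x y))// ler_piMl].
- have -> : diff2 (fun x => f x * g x) x y = g x * diff2 f x y + f x * diff2 g x y
      + ((f (x + y) - f x) * (g x - g (x + y)) + (f (x - y) - f x) * (g x - g (x - y))).
    by rewrite /diff2; ring.
  have /andP[f0 f1] := f01 x; have /andP[g0 g1] := g01 x.
  apply: (le_trans (ler_normD _ _)).
  rewrite [leRHS](_ : _ = (D1 * enorm y ^+ 2 + D2 * enorm y ^+ 2)
     + (l1 * enorm y * (l2 * enorm y) + l1 * enorm y * (l2 * enorm y))); last by ring.
  apply: lerD; apply: (le_trans (ler_normD _ _)); apply: lerD; rewrite normrM.
  + by rewrite ger0_norm// (le_trans _ (fD x y))// ler_piMl.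
  + by rewrite ger0_norm// (le_trans _ (gD x y))// ler_piMl.
  + apply: ler_pM => //.
      by have := fl' (x + y) x; rewrite addrAC subrr add0r.
    by have := gl' x (x + y); rewrite opprD addNKr enormN.
  + apply: ler_pM => //.
      by have := fl' (x - y) x; rewrite addrAC subrr add0r enormN.
    by have := gl' x (x - y); rewrite opprB subrKC.
Qed.

Lemma c11_bump1 (i : 'I_n) (z : 'rV[R]_n) (r : R) : 0 < r ->
  c11 (8 / r) (128 / r ^+ 2) (fun x => bump1 ((x 0 i - z 0 i) / r)).
Proof.
move=> r0; split=> [x|x y|x y]; first exact: bump101.
- apply: (le_trans (bump1_lip _ ((y 0 i - z 0 i) / r))); rewrite lerD2l.
  rewrite -mulrBl opprB subrKA normrM normfV (gtr0_norm r0).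
  rewrite (_ : 8 / r * _ = 8 * (enorm (x - y) / r)); last by rewrite mulrA mulrAC.
  rewrite ler_pM2l// ler_pM2r ?invr_gt0//.
  by have := ler_coord_enorm (x - y) i; rewrite !mxE.
- have -> : diff2 (fun x => bump1 ((x 0 i - z 0 i) / r)) x y =
    2 * bump1 ((x 0 i - z 0 i) / r) - bump1 ((x 0 i - z 0 i) / r + y 0 i / r)
    - bump1 ((x 0 i - z 0 i) / r - y 0 i / r).
    by rewrite /diff2 !mxE -!mulrDl -!mulrBl (addrAC (x 0 i) (y 0 i)) (addrAC (x 0 i) (- y 0 i)).
  apply: (le_trans (bump1_diff2 _ _)).
  rewrite expr_div_n mulrA [leRHS]mulrAC ler_pM2r ?invr_gt0 ?exprn_gt0//.
  rewrite ler_pM2l// -real_normK ?num_real// ler_pXn2r ?nnegrE ?enorm_ge0//.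
  exact: ler_coord_enorm.
Qed.

Lemma c11_prod (I : Type) (s : seq I) (F : I -> 'rV[R]_n -> R) :
  (forall i, exists l D, c11 l D (F i)) ->
  exists l D, c11 l D (fun x => \prod_(i <- s) F i x).
Proof.
move=> FP; elim: s => [|i s [l [D lD]]].
  exists 0, 0; under eq_fun do rewrite big_nil; exact: c11_cst1.
have [l' [D' lD']] := FP i.
exists (l' + l), (D' + D + 2 * l' * l); under eq_fun do rewrite big_cons.
exact: c11M.
Qed.

(** A product over the coordinates, adapted to the cubes that are the balls of the ambient norm. *)
Definition boxbump (p : 'rV[R]_n * R) (x : 'rV[R]_n) : R :=
  \prod_(i < n) bump1 ((x 0 i - p.1 0 i) / p.2).

Lemma c11_boxbump p : 0 < p.2 -> exists l D, c11 l D (boxbump p).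
Proof.
move=> p0; apply: c11_prod => i; exists (8 / p.2), (128 / p.2 ^+ 2).
exact: c11_bump1.
Qed.

Lemma boxbump_supp p x : 0 < p.2 -> ~ ball p.1 p.2 x -> boxbump p x = 0.
Proof.
move=> p0 px; apply/eqP; rewrite prodf_seq_eq0; apply/hasP.
apply: contrapT => h; apply: px; split=> // i j; rewrite (ord1 i) /ball/= distrC.
rewrite ltNge; apply/negP => pj; apply: h; exists j; first exact: mem_index_enum.
rewrite /= bump1_supp//.
by rewrite normrM normfV (gtr0_norm p0) ler_pdivlMr// mul1r.
Qed.

Lemma boxbump1 p x : 0 < p.2 -> ball p.1 (p.2 / 2) x -> boxbump p x = 1.
Proof.
move=> p0 [_ px]; apply: big1 => i _; apply: bump1_1.
rewrite normrM normfV (gtr0_norm p0) ler_pdivrMr// mulrC ltW//.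
by have := px 0 i; rewrite /ball/= distrC.
Qed.

(** Finitely many cubes inside U have half-size copies covering K. The function 1 - prod (1 - bump)
    is 1 as soon as one bump is 1, and 0 where all bumps vanish. *)
Lemma compact_cutoff (K U : set 'rV[R]_n) : compact K -> open U -> K `<=` U ->
  exists l D h, [/\ c11 l D h, (forall x, K x -> h x = 1) &
    (forall x, ~ U x -> h x = 0)].
Proof.
move=> Kc Uo KU.
have /choice[rho rhoP] : forall z, exists r : R, K z -> 0 < r /\ ball z r `<=` U.
  move=> z; have [Kz|nKz] := pselect (K z); last by exists 0.
  have /nbhs_ballP[r /= r0 rU] : nbhs z U by apply: open_nbhs_nbhs; split => //; exact: KU.
  by exists r.
have [D DK KD] : finite_subset_cover K (fun z => (ball z (rho z / 2))°) K.
  move: Kc; rewrite compact_cover; apply.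
    by move=> z Kz; exact: open_interior.
  move=> z Kz; exists z => //.
  by have [r0 _] := rhoP z Kz; apply: nbhsx_ballx; rewrite divr_gt0.
pose s := enum_fset D.
pose F z : 'rV[R]_n -> R :=
  if 0 < rho z then fun x => 1 - boxbump (z, rho z) x else fun=> 1.
have FP z : exists l D, c11 l D (F z).
  rewrite /F; case: ifPn => [r0|_].
    by have [l [D' h]] := @c11_boxbump (z, rho z) r0; exists l, D'; exact: c11_onem.
  by exists 0, 0; exact: c11_cst1.
have [l [D' h]] := @c11_prod _ s F FP.
exists l, D', (fun x => 1 - \prod_(z <- s) F z x); split; first exact: c11_onem.
- move=> x /KD[z /= zD]; have /set_mem Kz := DK _ zD.
  move=> /interior_subset zx; have [r0 _] := rhoP z Kz.
  rewrite (_ : \prod_(z <- s) F z x = 0) ?subr0//.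
  apply/eqP; rewrite prodf_seq_eq0; apply/hasP; exists z => //=.
  by rewrite /F r0 (@boxbump1 (z, rho z))// subrr.
- move=> x nUx; rewrite big1_seq ?subrr// => z /andP[_ zs].
  have /set_mem Kz := DK _ zs; have [r0 rU] := rhoP z Kz.
  by rewrite /F r0 boxbump_supp ?subr0// => /rU.
Qed.

(** The open 1/(m+1)-neighbourhoods of K decrease to K because K is closed, and the first has finite
    measure because K is bounded; continuity from above concludes. *)
Lemma compact_null_neighborhood (K : set 'rV[R]_n) (eta : R) :
  compact K -> mu K = 0%E -> 0 < eta ->
  exists U, [/\ open U, K `<=` U & (mu U <= eta%:E)%E].
Proof.
move=> Kc K0 eta0.
have clK : closed K by apply: compact_closed => //; exact: norm_hausdorff.
pose V (m : nat) : set 'rV[R]_n := \bigcup_(z in K) eball z m.+1%:R^-1.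
have Vo m : open (V m) by apply: bigcup_open => z _; exact: eball_open.
have KV m : K `<=` V m.
  by move=> z Kz; exists z => //; rewrite eballE subrr enorm0 invr_gt0.
have [M M0 KM] : exists2 M, 0 < M & forall z, K z -> enorm z <= M.
  have /compact_bounded [M [_ Mb]] := Kc.
  have M1 : M < `|M| + 1 by rewrite (le_lt_trans (ler_norm M))// ltrDl.
  exists (n%:R * (`|M| + 1) + 1); first by rewrite ltr_wpDl// mulr_ge0// addr_ge0.
  move=> z /(Mb _ M1) zM; rewrite (le_trans (enorm_normr z))// (le_trans (ler_wpM2l _ zM))//.
  by rewrite lerDl.
have V0 : (mu (V 0%N) < +oo)%E.
  apply: (@le_lt_trans _ _ (mu (eball 0 (M + 1)))); last exact: lebesgue_rV_eball_lty.
  apply: le_measure; rewrite ?inE; [exact: measurable_open_rV|exact: measurable_eball|].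
  move=> x [z Kz]; rewrite !eballE invr1 subr0 => xz.
  rewrite -(subrK z x) addrC; apply: (le_lt_trans (ler_enormD _ _)).
  by apply: ler_ltD; first exact: KM.
have IV : \bigcap_m V m = K.
  apply/seteqP; split=> [x Vx|x Kx m _]; last exact: KV.
  apply: clK => B /nbhs_eballP[r r0 rB].
  have [m _ /(_ m (leqnn m)) /= mr] := near_infty_natSinv_lt (PosNum r0).
  have [z Kz] := Vx m I; rewrite eballE => zx.
  exists z; split=> //; apply: rB; rewrite eballE enormBC.
  exact: lt_trans zx mr.
have cvgV : mu (V m) @[m --> \oo] --> mu (\bigcap_m V m).
  apply: nonincreasing_cvg_mu => //.
  - by move=> m; exact: measurable_open_rV.
  - by rewrite IV; exact: measurable_closed_rV.
  - move=> a b ab; apply/subsetPset => x [z Kz]; rewrite eballE => h; exists z => //.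
    by apply: (lt_le_trans h); rewrite lef_pV2 ?posrE// ler_nat.
move: cvgV; rewrite IV K0 => /fine_cvgP[finV cV].
have /cvgr_lt /(_ _ eta0) Vlt := cV.
have [m _ /(_ m (leqnn m)) [/= Vfin Vm]] := filterI finV Vlt.
by exists (V m); split=> //; rewrite -(fineK Vfin) lee_fin ltW.
Qed.

End cutoff.

(** * Potential of one compact null set *)

Section potential.
Context {R : realType} {n : nat} {s lam Lam : R} {k : 'rV[R]_n -> R}.
Hypothesis kP : kernel_spec s lam Lam k.
Hypothesis n0 : (0 < n)%N.
Local Notation mu := (lebesgue_rV R n).
Local Notation Lop := (@Lop R n k).
Local Notation mass := (@mass R n k).
Local Notation jconv := (@jconv R n k).

Lemma sd0 eta l D (h : 'rV[R]_n -> R) :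
  smooth_density eta l D h -> smooth_density (n:=n) eta l D (fun=> 0).
Proof.
move=> hP; split=> [x|x y|x y|].
- by rewrite lexx ler01.
- by have := sd_lip hP x y; have := sd_lip hP y x; rewrite (enormBC y x); lra.
- rewrite /diff2 mulr0 !subr0 normr0.
  exact: le_trans (normr_ge0 _) (sd_diff2 hP x y).
- rewrite integral0_eq//; apply: le_trans (sd_int hP).
  by apply: integral_ge0 => x _; rewrite lee_fin; case/andP: (sd01 hP x).
Qed.

(** Iterate the map of [sd_step] from 0. Successive increments lie between 0 and q^j with q = mass /
    (1 + mass) < 1, so the iterate solves p + L_e p = h up to mass q^j. Since an approximate
    solution is enough, a finite iterate serves and no limit has to be taken in the class. *)
Lemma sd_resolvent eta l D h (e r : R) : 0 < e -> 0 < r ->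
  smooth_density eta l D h ->
  exists2 p, smooth_density eta l D p &
    forall x, h x - r <= p x + Lop e p x <= h x.
Proof.
move=> e0 r0 hP.
have m0 := mass_ge0 kP e; have m1 : 0 < 1 + mass e by rewrite ltr_wpDr.
pose st (p : 'rV[R]_n -> R) x := (h x + jconv e p x) / (1 + mass e).
pose p j := iter j st (fun=> 0).
have pP j : smooth_density eta l D (p j).
  elim: j => [|j IH]; first exact: sd0 hP.
  exact: (sd_step kP n0 e0 hP IH).
have bp j : bmeas (p j) := sd_bmeas (pP j).
pose q := mass e / (1 + mass e).
have q0 : 0 <= q by rewrite divr_ge0// ltW.
have q1 : q < 1 by rewrite ltr_pdivrMr//; lra.
have inc j x : 0 <= p j.+1 x - p j x <= q ^+ j.
  elim: j x => [|j IH] x; first by rewrite expr0 subr0; exact: sd01 (pP 1%N) x.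
  have -> : p j.+2 x - p j.+1 x = jconv e (fun y => p j.+1 y + -1 * p j y) x / (1 + mass e).
    rewrite (convD kP n0)//; last exact: bmeasZ.
    by rewrite (convZ kP n0)//= /st; ring.
  have := conv_bounds kP n0 x e0 (bmeasD (bp j.+1) (bmeasZ (-1) (bp j))).
  move=> /(_ 0 (q ^+ j)); rewrite mul0r => H.
  have /andP[H0 H1] : 0 <= jconv e (fun y => p j.+1 y + -1 * p j y) x <= q ^+ j * mass e.
    by apply: H => y; rewrite mulN1r.
  by rewrite divr_ge0 ?(ltW m1)//= ler_pdivrMr// exprSr /q mulrA divfK// gt_eqF.
have [j jr] : exists j, mass e * q ^+ j <= r.
  have /cvgr_lt /(_ _ r0) [j _ /(_ j (leqnn j)) jr] : mass e * q ^+ j @[j --> \oo] --> (0 : R).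
    rewrite -[X in _ --> X](mulr0 (mass e)); apply: cvgM; first exact: cvg_cst.
    by apply: cvg_expr; rewrite ger0_norm.
  by exists j; exact: ltW.
exists (p j.+1) => // x.
have e1 : (1 + mass e) * p j.+1 x = h x + jconv e (p j) x.
  by rewrite /= /st mulrC divfK// gt_eqF.
have -> : p j.+1 x + Lop e (p j.+1) x = h x - jconv e (fun y => p j.+1 y + -1 * p j y) x.
  rewrite (LopE kP n0)// (convD kP n0)//; last exact: bmeasZ.
  by rewrite (convZ kP n0)//; lra.
have := conv_bounds kP n0 x e0 (bmeasD (bp j.+1) (bmeasZ (-1) (bp j))).
move=> /(_ 0 (q ^+ j)); rewrite mul0r => H.
have /andP[H0 H1] : 0 <= jconv e (fun y => p j.+1 y + -1 * p j y) x <= q ^+ j * mass e.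
  by apply: H => y; rewrite mulN1r.
by apply/andP; split; lra.
Qed.

Lemma conv_le_int d eta w x : 0 < d -> bmeas w -> (forall y, 0 <= w y) ->
  (\int[mu]_y (w y)%:E <= eta%:E)%E ->
  jconv d w x <= Lam * d `^ (- (n%:R + 2 * s)) * eta.
Proof.
move=> d0 bw w0 weta; have L0 := Lam_ge0 kP n0.
rewrite -lee_fin (conv_EFin kP n0)//.
have mw := measurable_addl x bw.1.
apply: (@le_trans _ _ (\int[mu]_(y in far d) ((Lam * d `^ (- (n%:R + 2 * s))) * w (x + y))%:E)%E).
  apply: ge0_le_integral => //; first exact: measurable_far.
  - by move=> y _; rewrite lee_fin mulr_ge0// (kernel_ge0 kP).
  - apply/measurable_EFinP/measurable_funTS; apply: measurable_funM => //.
    exact: kernel_measurable kP.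
  - by apply/measurable_EFinP/measurable_funTS; apply: measurable_funM.
  - move=> y; rewrite farE => dy; rewrite lee_fin mulrC ler_wpM2r//.
    apply: (le_trans (kernel_le kP y)); rewrite ler_wpM2l//.
    by apply: ler_powR_neg => //; rewrite oppr_le0 ltW// (gam_gt0 kP).
have c0 : 0 <= Lam * d `^ (- (n%:R + 2 * s)) by rewrite mulr_ge0 ?powR_ge0.
rewrite ge0_integralZlR//; first last.
- exact: measurable_funTS.
- exact: measurable_far.
rewrite [leRHS]EFinM lee_wpmul2l ?lee_fin//; apply: le_trans weta.
have -> : (\int[mu]_y (w y)%:E = \int[mu]_y (w (x + y))%:E)%E.
  rewrite -(@ge0_integral_shift R n x (fun y => (w y)%:E)); first last.
  - by move=> y; rewrite lee_fin.
  - by apply/measurable_EFinP; exact: bw.1.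
  by apply: eq_integral => y _; rewrite addrC.
apply: ge0_subset_integral => //.
- exact: measurable_far.
- by apply/measurable_EFinP.
- by move=> y _; rewrite lee_fin.
Qed.

(* Large jumps alone bound the potential of a density of small mass: at an
   almost maximum point the small jumps only help. *)
Lemma sd_sup eta l D p (e d : R) : 0 < e -> e <= d -> smooth_density eta l D p ->
  (forall x, p x + Lop e p x <= 1) ->
  forall x, (1 + mass d) * p x <= 1 + Lam * d `^ (- (n%:R + 2 * s)) * eta.
Proof.
move=> e0 ed pP pL x0; have d0 : 0 < d by exact: lt_le_trans ed.
have bp := sd_bmeas pP; have p01 := sd01 pP.
have me := mass_ge0 kP e; have md := mass_ge0 kP d.
set K := Lam * _ * eta.
have almost t x : 0 <= t -> (forall y, p y <= p x + t) ->
    (1 + mass d) * p x <= 1 + K + t * mass e.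
  move=> t0 pt.
  pose g y := (p x + t) + -1 * p y.
  have g0 y : 0 <= g y by rewrite /g mulN1r subr_ge0.
  have bg : bmeas g by apply: bmeasD; [exact: bmeas_cst|exact: bmeasZ].
  have gd : jconv d g x <= jconv e g x.
    rewrite -lee_fin !(conv_EFin kP n0)//; apply: ge0_subset_integral.
    - exact: measurable_far.
    - exact: measurable_far.
    - apply/measurable_EFinP/measurable_funTS; apply: measurable_funM.
        exact: measurable_addl bg.1.
      exact: kernel_measurable kP.
    - by move=> y _; rewrite lee_fin mulr_ge0// (kernel_ge0 kP).
    - by move=> y; rewrite !farE; exact: le_trans.
  have gE f : 0 < f -> jconv f g x = (p x + t) * mass f - jconv f p x.
    move=> f0; rewrite (convD kP n0)//; [|exact: bmeas_cst|exact: bmeasZ].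
    by rewrite (conv_cst kP n0)// (convZ kP n0)//; ring.
  move: gd; rewrite !gE// => gd.
  have := pL x; rewrite (LopE kP n0)// => pLx.
  have p0 y : 0 <= p y by case/andP: (p01 y).
  have cK : jconv d p x <= K by apply: conv_le_int => //; exact: sd_int pP.
  have tm : 0 <= t * mass d by exact: mulr_ge0.
  lra.
apply/ler_addgt0Pr => r r0.
(* The supremum of [p] need not be attained. Working at a point within [t] of it costs t mass e in
   [almost], and t (1 + mass d) when comparing with the given point: r in total. *)
pose t := r / (1 + mass d + mass e).
have M0 : 0 < 1 + mass d + mass e by rewrite -addrA ltr_wpDr// addr_ge0.
have t0 : 0 < t by exact: divr_gt0.
have hs : has_sup (range p).
  split; first by exists (p x0), x0.
  by exists 1 => _ [y _ <-]; case/andP: (p01 y).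
have [_ [x _ <-] xt] := sup_adherent t0 hs.
have pt y : p y <= p x + t.
  rewrite -lerBlDr; apply: le_trans (ltW xt); rewrite lerD2r.
  by apply: ub_le_sup; [case: hs|exists y].
have H := almost _ _ (ltW t0) pt.
have h1 : (1 + mass d) * p x0 <= (1 + mass d) * (p x + t).
  by rewrite ler_wpM2l// addr_ge0.
have tr : t * (1 + mass d + mass e) = r by rewrite divfK// gt_eqF.
lra.
Qed.

(** A finer truncation adds the jumps between e and e'; bounded second differences make their
    contribution O(e'^(2-2s)), uniformly in e. *)
Lemma Lop_refine : exists2 C, 0 <= C & forall D w (e e' : R) x, 0 < e -> e <= e' ->
  bmeas w -> (forall y, 0 <= w y) ->
  (forall x y, `|diff2 w x y| <= D * enorm y ^+ 2) -> 0 <= D ->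
  Lop e' w x - C * D * e' `^ (2 - 2 * s) <= Lop e w x.
Proof.
have [C C0 Cnear] := kernel_near kP n0; exists C => // D w e e' x e0 ee' bw w0 wD D0.
have e'0 : 0 < e' by exact: lt_le_trans ee'.
suff : 2 * Lop e' w x - D * (C * e' `^ (2 - 2 * s)) <= 2 * Lop e w x.
  have : 0 <= C * D * e' `^ (2 - 2 * s) by rewrite !mulr_ge0 ?powR_ge0.
  by rewrite mulrA (mulrC D); lra.
rewrite !(Lop_diff2 kP n0)//.
pose S : set 'rV[R]_n := far e `&` eball 0 e'.
have mS : measurable S by apply: measurableI; [exact: measurable_far|exact: measurable_eball].
have farU : far e = far e' `|` S.
  apply/seteqP; split=> y; last first.
    by move=> [|[]//]; rewrite !farE; exact: le_trans.
  rewrite farE => ey; have [yl|yg] := leP e' (enorm y); first by left; rewrite farE.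
  by right; split; rewrite ?farE// eballE subr0.
have ie : mu.-integrable (far e) (EFin \o (fun y => diff2 w x y * k y)).
  exact: (integrable_bmeas kP n0 e0 (bmeas_diff2 x bw)).
have iS : mu.-integrable S (EFin \o (fun y => diff2 w x y * k y)).
  apply: integrableS ie => //; first exact: measurable_far.
  by move=> y [].
rewrite farU Rintegral_setU//; first last.
- apply/disj_setPS => y [] ; rewrite farE => h [_]; rewrite eballE subr0 ltNge.
  by rewrite h.
- by rewrite -farU.
- exact: measurable_far.
rewrite lerD2l lerNl; apply: (le_trans (ler_norm _)); rewrite normrN.
apply: (le_trans (le_normr_Rintegral mS iS)).
rewrite /Rintegral -lee_fin fineK; last first.
  by apply: integrable_fin_num => //; exact: integrable_norm.
apply: (@le_trans _ _ (\int[mu]_(y in S) (D * (enorm y ^+ 2 * k y))%:E)%E).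
  have mk := kernel_measurable kP.
  have mn := @measurable_enorm R n.
  have md : measurable_fun setT (diff2 w x : _ -> measurableTypeR R).
    exact: (bmeas_diff2 x bw).1.
  apply: ge0_le_integral => //.
  - apply/measurable_EFinP/measurable_funTS; apply: measurableT_comp => //.
    exact: measurable_funM.
  - apply/measurable_EFinP/measurable_funTS; apply: measurable_funM => //.
    by apply: measurable_funM => //; exact: measurable_funX.
  - move=> y _; rewrite lee_fin normrM (ger0_norm (kernel_ge0 kP y)) mulrA.
    by rewrite ler_wpM2r// (kernel_ge0 kP).
have mnk : measurable_fun setT ((fun y => enorm y ^+ 2 * k y) : _ -> measurableTypeR R).
  apply: measurable_funM; last exact: kernel_measurable kP.
  by apply: measurable_funX; exact: measurable_enorm.
have nk0 y : 0 <= enorm y ^+ 2 * k y by rewrite mulr_ge0 ?sqr_ge0// (kernel_ge0 kP).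
rewrite ge0_integralZlR//; last exact: measurable_funTS.
rewrite [leRHS]EFinM lee_wpmul2l ?lee_fin//; apply: le_trans (Cnear _ e'0).
apply: ge0_subset_integral => //.
- exact: measurable_eball.
- by apply/measurable_EFinP/measurable_funTS.
- by move=> y _; rewrite lee_fin.
- by move=> y [].
Qed.

(** Let [h] be a cutoff equal to 1 on [N] and [p] its resolvent at a truncation e'. Then L p is
    about h - p: large on [N], and nearly nonnegative elsewhere because [p] is small. The order of
    the choices matters: [d] from [sig], with mass d >= 8 / sig; then the integral [eta] of [h] from
    [d], so that [sd_sup] gives p <= sig/4; then the cutoff, whose constant [D] is not controlled;
    finally e' from [D], so that refining the truncation costs at most sig/4. *)
Lemma null_potential (N : set 'rV[R]_n) (sig : R) : compact N -> mu N = 0%E ->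
  0 < sig <= 2^-1 ->
  exists (p : 'rV[R]_n -> R) (e0 : R), [/\ 0 < e0, continuous p, (forall x, 0 <= p x <= sig) &
    forall e x, 0 < e < e0 -> - sig <= Lop e p x /\ (N x -> 2^-1 <= Lop e p x)].
Proof.
move=> Nc N0 /andP[sig0 sig1].
have L0 := Lam_ge0 kP n0.
have [C C0 Crefine] := Lop_refine.
have [d d0 dM] := kernel_far_ge kP n0 (8 / sig).
have md : 8 / sig <= mass d by rewrite -lee_fin (massE kP n0).
set K := Lam * d `^ (- (n%:R + 2 * s)).
have K0 : 0 <= K by rewrite mulr_ge0 ?powR_ge0.
pose eta := (K + 1)^-1.
have K1 : 0 < K + 1 by rewrite ltr_wpDl.
have eta0 : 0 < eta by rewrite invr_gt0.
have [U [Uo NU Ueta]] := compact_null_neighborhood Nc N0 eta0.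
have [l [D [h [[h01 hl hD] hN hU]]]] := compact_cutoff Nc Uo NU.
have mU := measurable_open_rV Uo.
have hP : smooth_density eta l D h.
  split=> //; apply: le_trans Ueta.
  rewrite -[leRHS]mul1e -(integral_cst mu mU) [leRHS]integral_mkcond.
  have mh : measurable_fun setT (h : _ -> measurableTypeR R).
    by apply: continuous_measurable_rV; exact: lipschitz_continuous hl.
  apply: ge0_le_integral => //.
  - by move=> x _; rewrite lee_fin; case/andP: (h01 x).
  - exact/measurable_EFinP.
  - by apply/(measurable_restrictT _ _).1 => //; exact: measurable_cst.
  - move=> x _; rewrite patchE; case: ifPn => [_|xU].
      by rewrite lee_fin; case/andP: (h01 x).
    by rewrite hU// => /mem_set; exact/negP.
have D0 : 0 <= D.
  have := hD 0 (const_mx 1).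
  have e1 : 0 < enorm (const_mx 1 : 'rV[R]_n).
    by apply: lt_le_trans (ler_coord_enorm _ (Ordinal n0)); rewrite mxE normr1.
  by move=> /(le_trans (normr_ge0 _)); rewrite pmulr_lge0// exprn_gt0.
have s2 : 0 < 2 - 2 * s by case/andP: (kernel_s kP) => ? ?; lra.
have [e' [e'0 e'd e'C]] : exists e', [/\ 0 < e', e' <= d & C * D * e' `^ (2 - 2 * s) <= sig / 4].
  have CD0 : 0 <= C * D by exact: mulr_ge0.
  have a0 : 0 < sig / 4 / (C * D + 1) by rewrite !divr_gt0// ltr_wpDl.
  exists (Num.min d ((sig / 4 / (C * D + 1)) `^ (2 - 2 * s)^-1)); split.
  - by rewrite lt_min d0 powR_gt0.
  - by rewrite ge_min lexx.
  - apply: (@le_trans _ _ (C * D * (sig / 4 / (C * D + 1)))).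
      rewrite ler_wpM2l//.
      have E : (sig / 4 / (C * D + 1)) `^ (2 - 2 * s)^-1 `^ (2 - 2 * s) = sig / 4 / (C * D + 1).
        by rewrite -powRrM mulVf ?gt_eqF// powRr1// ltW.
      rewrite -[leRHS]E; apply: ge0_ler_powR; first exact: ltW.
      + by rewrite nnegrE le_min (ltW d0) powR_ge0.
      + by rewrite nnegrE powR_ge0.
      + by rewrite ge_min lexx orbT.
    rewrite mulrCA ler_piMr ?divr_ge0 ?(ltW sig0)// ler_pdivrMr ?ltr_wpDl// mul1r.
    by rewrite lerDl.
have sig4 : 0 < sig / 4 by rewrite divr_gt0.
have [p pP pL] := sd_resolvent e'0 sig4 hP.
have bp := sd_bmeas pP.
have psig x : p x <= sig / 4.
  have pL1 y : p y + Lop e' p y <= 1.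
    by have /andP[_ /le_trans] := pL y; apply; case/andP: (h01 y).
  have := sd_sup e'0 e'd pP pL1 x.
  have : K * eta <= 1 by rewrite /eta ler_pdivrMr// mul1r lerDl.
  rewrite -/K => h1 h2; have px0 : 0 <= p x by case/andP: (sd01 pP x).
  have h3 : 8 / sig * p x <= mass d * p x by rewrite ler_wpM2r.
  have : 8 / sig * p x <= 2 by lra.
  by rewrite mulrAC ler_pdivrMr//; lra.
exists p, e'; split=> //.
- exact: sd_continuous pP.
- by move=> x; case/andP: (sd01 pP x) => -> _ /=; have := psig x; lra.
move=> e x /andP[e0 ee'].
have := Crefine D p e e' x e0 (ltW ee') bp (fun y => (andP (sd01 pP y)).1) (sd_diff2 pP) D0.
have /andP[pLx _] := pL x; have := psig x; have /andP[h0 _] := h01 x.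
by split=> [|/hN hx]; lra.
Qed.

End potential.

(** * One potential for a sequence of compact null sets *)

Section sum_potential.
Context {R : realType} {n : nat} {s lam Lam : R} {k : 'rV[R]_n -> R}.
Hypothesis kP : kernel_spec s lam Lam k.
Hypothesis n0 : (0 < n)%N.
Local Notation mu := (lebesgue_rV R n).
Local Notation Lop := (@Lop R n k).
Local Notation mass := (@mass R n k).
Variable N : nat -> set 'rV[R]_n.
Hypothesis Ncompact : forall j, compact (N j).
Hypothesis Nnull : forall j, mu (N j) = 0%E.

Lemma continuous_bmeas (p : 'rV[R]_n -> R) a b :
  continuous p -> (forall x, a <= p x <= b) -> bmeas p.
Proof.
move=> cp pb; split; first exact: continuous_measurable_rV.
exists (`|a| + `|b|) => x; have /andP[h1 h2] := pb x.
by rewrite ler_norml; have := ler_norm b; have := ler_norm (- a);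
  rewrite normrN; have := normr_ge0 a; have := normr_ge0 b; lra.
Qed.

Lemma Lop_ge_sup e t b x : 0 < e -> bmeas t -> (forall y, 0 <= t y <= b) ->
  - (b * mass e) <= Lop e t x.
Proof.
move=> e0 bt tb; rewrite (LopE kP n0)//.
have /andP[_ h] := conv_bounds kP n0 x e0 bt tb.
have /andP[t0 _] := tb x; have m0 := mass_ge0 kP e.
by have := mulr_ge0 m0 t0; lra.
Qed.

(** [b] is the sup-norm budget left for term j and all later ones, [E'] the threshold below which
    the bounds on the term [p] hold, and [e] the truncation at which the first j+1 terms are tested.
    The next budget [b'] is small relative to the jump rate at [e], so that all later terms together
    lower L_e by at most 1/4. *)
Let step_spec (j : nat) (b E : R) (q : ('rV[R]_n -> R) * R * R * R) : Prop :=
  let: (p, E', e, b') := q in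
  [/\ continuous p, (forall x, 0 <= p x <= b / 2), 0 < E' <= E,
      (forall f x, 0 < f < E' -> - (b / 2) <= Lop f p x /\ (N j x -> 2^-1 <= Lop f p x)) &
      [/\ 0 < e < E', e <= j.+1%:R^-1, 0 < b' <= b / 2, b' * mass e <= 4^-1 & b' <= j.+2%:R^-1]].

Let step_ex j b E : exists q, 0 < b <= 1 -> 0 < E -> step_spec j b E q.
Proof.
have [[/andP[b0 b1] E0]|nb] := pselect (0 < b <= 1 /\ 0 < E); last first.
  by exists (cst 0, 0, 0, 0) => ? ?; exfalso; exact: nb.
have b2 : 0 < b / 2 <= 2^-1 by rewrite divr_gt0//=; lra.
have [p [e0 [e00 cp pb pL]]] := null_potential kP n0 (@Ncompact j) (Nnull j) b2.
pose E' := Num.min E e0.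
have E'0 : 0 < E' by rewrite lt_min E0.
pose e := Num.min (E' / 2) j.+1%:R^-1.
have e0' : 0 < e by rewrite lt_min divr_gt0//= invr_gt0.
have eE : e < E' by rewrite gt_min; apply/orP; left; lra.
have m0 := mass_ge0 kP e.
have m1 : 0 < 1 + mass e by rewrite ltr_wpDr.
pose b' := Num.min (Num.min (b / 2) (4^-1 / (1 + mass e))) j.+2%:R^-1.
have b'0 : 0 < b' by rewrite !lt_min !divr_gt0//= invr_gt0.
exists (p, E', e, b') => _ _; split=> //.
- by rewrite E'0 ge_min lexx.
- move=> f x /andP[f0 fE]; apply: pL; rewrite f0/=; apply: lt_le_trans fE _.
  by rewrite ge_min lexx orbT.
- split.
  + by rewrite e0' eE.
  + by rewrite ge_min lexx orbT.
  + by rewrite b'0 !ge_min lexx.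
  + apply: (@le_trans _ _ (4^-1 / (1 + mass e) * mass e)).
      by rewrite ler_wpM2r// !ge_min lexx orbT.
    by rewrite mulrAC ler_pdivrMr// ler_pM2l ?invr_gt0//; lra.
  + by rewrite ge_min lexx orbT.
Qed.

(** At truncation e j every one of the first j+1 sets that contains x contributes at least 1/2,
    while all losses together stay below 1. A point that lies in all sets from index m on thus sees
    a lower bound growing like (j + 1 - m) / 2. *)
Lemma sum_potential (tau : R) : 0 < tau ->
  exists (p : 'rV[R]_n -> R) (e : nat -> R),
  [/\ continuous p, (forall x, 0 <= p x <= tau), (forall j, 0 < e j <= j.+1%:R^-1),
      (forall j x, -1 <= Lop (e j) p x) &
      forall x m M, (forall j, (m <= j)%N -> N j x) ->
        exists J, forall j, (J <= j)%N -> M <= Lop (e j) p x].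
Proof.
move=> tau0.
have /choice[F FP] : forall jbE : nat * R * R, exists q,
    0 < jbE.1.2 <= 1 -> 0 < jbE.2 -> step_spec jbE.1.1 jbE.1.2 jbE.2 q.
  by move=> [[j b] E]; exact: step_ex.
pose b0 := Num.min tau 2^-1.
have b00 : 0 < b0 by rewrite lt_min tau0 invr_gt0 ltr0n.
have b0tau : b0 <= tau by rewrite ge_min lexx.
have b02 : b0 <= 2^-1 by rewrite ge_min lexx orbT.
pose st := fix st (j : nat) : R * R :=
  if j is i.+1 then let: (p, E', e, b') := F (i, (st i).1, (st i).2) in (b', E')
  else (b0, 1).
pose b j := (st j).1; pose E j := (st j).2.
pose q j := F (j, b j, E j).
pose p j := (q j).1.1.1; pose e j := (q j).1.2.
have stS j : b j.+1 = (q j).2 /\ E j.+1 = (q j).1.1.2.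
  by rewrite /b /E /q /=; case: (F _) => [[[? ?] ?] ?].
have stP j : 0 < b j <= 1 /\ 0 < E j.
  elim: j => [|j [/andP[bj0 bj1] Ej0]]; first by rewrite /b /E /= b00 ltr01; split=> //; lra.
  have [-> ->] := stS j; have := FP (j, b j, E j); rewrite /= bj0 bj1 -/(q j) => /(_ isT Ej0).
  rewrite /step_spec; case: (q j) => [[[p' E'] e'] b'] [_ _ /andP[E0 _] _ [_ _ /andP[b'0 b'1] _ _]] /=.
  by rewrite b'0 E0; split=> //; lra.
have spec j : [/\ continuous (p j), (forall x, 0 <= p j x <= b j / 2), 0 < E j.+1 <= E j,
      (forall f x, 0 < f < E j.+1 -> - (b j / 2) <= Lop f (p j) x /\ (N j x -> 2^-1 <= Lop f (p j) x)) &
      [/\ 0 < e j < E j.+1, e j <= j.+1%:R^-1, 0 < b j.+1 <= b j / 2, b j.+1 * mass (e j) <= 4^-1 & b j.+1 <= j.+2%:R^-1]].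
  have [bj Ej] := stP j; have := FP (j, b j, E j) bj Ej; have [-> ->] := stS j.
  by rewrite /p /e -/(q j) /step_spec /=; case: (q j) => [[[p' E'] e'] b'].
have Emon i j : (i <= j)%N -> E j <= E i.
  move=> /subnKC <-; elim: (j - i)%N => [|d IH]; first by rewrite addn0.
  by rewrite addnS; apply: le_trans IH; have [_ _ /andP[]] := spec (i + d)%N.
pose P j x := \sum_(i < j) p i x.
have PS j x : P j.+1 x = P j x + p j x by rewrite /P big_ord_recr.
have P0 x : P 0%N x = 0 by rewrite /P big_ord0.
have Pmon i j x : (i <= j)%N -> P i x <= P j x.
  move=> /subnKC <-; elim: (j - i)%N => [|d IH]; first by rewrite addn0.
  rewrite addnS PS; apply: (le_trans IH); rewrite lerDl.
  by have [_ /(_ x)/andP[]] := spec (i + d)%N.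
have Pb i j x : (i <= j)%N -> P j x + b j <= P i x + b i.
  move=> /subnKC <-; elim: (j - i)%N => [|d IH]; first by rewrite addn0.
  rewrite addnS PS; apply: le_trans IH.
  by have [_ /(_ x)/andP[? ?] _ _ [_ _ /andP[? ?] _ _]] := spec (i + d)%N; lra.
have Pub i j x : P j x <= P i x + b i.
  have [ij|/ltnW ji] := leqP i j.
    by have := Pb _ _ x ij; have [/andP[+ _] _] := stP j; lra.
  by have := Pmon _ _ x ji; have [/andP[+ _] _] := stP i; lra.
pose pp x := sup (range (P ^~ x)).
have hs x : has_sup (range (P ^~ x)).
  by split; [exists (P 0%N x), 0%N|exists (P 0%N x + b 0%N) => _ [j _ <-]].
have Ple j x : P j x <= pp x by apply: ub_le_sup; [case: (hs x)|exists j].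
have leP' j x : pp x <= P j x + b j.
  by apply: ge_sup; [case: (hs x)|move=> _ [i _ <-]].
have cP j : continuous (P j).
  elim: j => [|j IH].
    by rewrite (_ : P 0%N = cst 0); [exact: cst_continuous|apply/funext => x; rewrite P0].
  rewrite (_ : P j.+1 = P j \+ p j); last by apply/funext => x; rewrite PS.
  by have [cpj _ _ _ _] := spec j; move=> x; exact: (cvgD (IH x) (cpj x)).
have cpp : continuous pp.
  move=> x; have FF : Filter (nbhs x) by exact: nbhs_filter.
  apply/cvgrPdist_lt => r r0.
  have r3 : 0 < r / 3 by rewrite divr_gt0.
  have [j _ /(_ j (leqnn j)) /= jr] := near_infty_natSinv_lt (PosNum r3).
  have bj : b j.+1 < r / 3.
    have [_ _ _ _ [_ _ _ _ h]] := spec j; apply: (le_lt_trans h); apply: lt_trans jr.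
    by rewrite ltf_pV2 ?posrE// ltr_nat.
  have /cvgrPdist_lt /(_ _ r3) := cP j.+1 x; apply: filterS => y.
  rewrite !ltr_norml => /andP[h1 h2].
  have := Ple j.+1 x; have := Ple j.+1 y; have := leP' j.+1 x; have := leP' j.+1 y.
  by move=> *; apply/andP; split; lra.
have pp0 x : 0 <= pp x <= tau.
  by have := Ple 0%N x; have := leP' 0%N x; rewrite P0 /b /= -/b0; lra.
have PbndD j x : 0 <= P j x <= b0.
  by have := Pmon 0%N j x isT; have := Pub 0%N j x; rewrite P0 /b /= -/b0; lra.
have bmP j : bmeas (P j) by apply: continuous_bmeas (cP j) (PbndD j).
have bmp j : bmeas (p j) by have [h1 h2 _ _ _] := spec j; exact: continuous_bmeas h1 h2.
have e0 j : 0 < e j by have [_ _ _ _ [/andP[]]] := spec j.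
(* The losses telescope, since b i / 2 <= b i - b (i+1). Truncated subtraction keeps the number of
   hits at 0 as long as J <= m. *)
have LP j J m x : (J <= j.+1)%N -> (forall i, (m <= i)%N -> (i < J)%N -> N i x) ->
    - (b0 - b J) + 2^-1 * (J - m)%:R <= Lop (e j) (P J) x.
  elim: J => [|J IH] Jj Nx.
    rewrite sub0n mulr0 /b /= subrr oppr0 add0r.
    rewrite (LopE kP n0)// (_ : P 0%N = fun=> 0 * 0); last by apply/funext => y; rewrite P0 mulr0.
    by rewrite (convZ kP n0 0 (f := fun=> 0))// ?mul0r ?mulr0 ?subr0//; exact: bmeas_cst.
  have {}IH := IH (ltnW Jj) (fun i mi iJ => Nx i mi (ltnW iJ)).
  rewrite (_ : P J.+1 = fun x => P J x + p J x); last by apply/funext => y; rewrite PS.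
  rewrite (LopD kP n0)//.
  have [_ _ _ pL [_ _ /andP[_ bJ] _ _]] := spec J.
  have ej : 0 < e j < E J.+1.
    rewrite e0; have [_ _ _ _ [/andP[_ h] _ _ _ _]] := spec j.
    by apply: (lt_le_trans h); exact: Emon.
  have [h1 h2] := pL _ x ej; have [/andP[bJ0 _] _] := stP J.
  have [mJ|Jm] := leqP m J.
    by have := h2 (Nx J mJ (ltnSn J)); rewrite subSn// -[(J - m).+1%:R]natr1 mulrDr mulr1; lra.
  have z1 : (J - m = 0)%N by apply/eqP; rewrite subn_eq0 ltnW.
  have z2 : (J.+1 - m = 0)%N by apply/eqP; rewrite subn_eq0.
  by move: IH; rewrite z1 z2 mulr0; lra.
have Lpp j m x : (forall i, (m <= i)%N -> (i < j.+1)%N -> N i x) ->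
    - 1 + 2^-1 * (j.+1 - m)%:R <= Lop (e j) pp x.
  move=> Nx; have h := LP j j.+1 m x (leqnn _) Nx.
  pose t y := pp y + -1 * P j.+1 y.
  have bt : bmeas t by apply: bmeasD; [exact: continuous_bmeas cpp pp0|exact: bmeasZ].
  have tb y : 0 <= t y <= b j.+1.
    by rewrite /t mulN1r; have := Ple j.+1 y; have := leP' j.+1 y; lra.
  have ht := Lop_ge_sup x (e0 j) bt tb.
  rewrite (_ : pp = fun y => P j.+1 y + t y); last by apply/funext => y; rewrite /t; ring.
  rewrite (LopD kP n0)//; have [_ _ _ _ [_ _ _ hm _]] := spec j.
  by have [/andP[bJ0 _] _] := stP j.+1; lra.
exists pp, e; split=> //.
- by move=> j; rewrite e0/=; have [_ _ _ _ [_ + _ _ _]] := spec j.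
- move=> j x; have := Lpp j j.+1 x; rewrite subnn mulr0 addr0; apply=> i h1 h2.
  by move: (leq_ltn_trans h1 h2); rewrite ltnn.
- move=> x m M Nx.
  exists (m + (Num.truncn (2 * (`|M| + 1))).+1)%N => j Jj.
  apply: le_trans (Lpp j m x (fun i mi _ => Nx i mi)).
  have h : (Num.truncn (2 * (`|M| + 1))).+1%:R <= (j.+1 - m)%:R :> R.
    by rewrite ler_nat leq_subRL ?(leq_trans Jj)// (leq_trans _ (leqW Jj))// leq_addr.
  have := truncnS_gt (2 * (`|M| + 1)); have := ler_norm M; lra.
Qed.

End sum_potential.

(** * The barrier *)

Section line.
Context {R : realType}.
Local Notation leb := (@lebesgue_measure R).

Lemma ge0_integral_scale_cy (kap a : R) (f : R -> R) : 0 < kap ->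
  measurable_fun setT (f : measurableTypeR R -> measurableTypeR R) ->
  (forall x, kap * a <= x -> 0 <= f x) ->
  (\int[leb]_(t in `[a, +oo[) (f (kap * t))%:E =
   kap^-1%:E * \int[leb]_(t in `[(kap * a)%R, +oo[) (f t)%:E)%E.
Proof.
move=> kap0 mf f0.
pose g (t : R) : \bar R := ((EFin \o f) \_ `[(kap * a)%R, +oo[%classic) t.
have mg : measurable_fun setT (g : measurableTypeR R -> \bar R).
  apply/(measurable_restrictT _ _).1 => //.
  by apply/measurable_EFinP; exact: measurable_funTS.
have g0 t : (0 <= g t)%E.
  by apply: erestrict_ge0 => x; rewrite /= in_itv/= andbT => /f0; rewrite lee_fin.
have maff : measurable_fun setT
    (fun t : measurableTypeR R => kap * t + 0 : measurableTypeR R).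
  by apply: measurable_funD => //; exact: measurable_funM.
have nng : 0 <= kap^-1 by rewrite invr_ge0 ltW.
transitivity (\int[leb]_t g (kap * t + 0)%R)%E.
  rewrite integral_mkcond; apply: eq_integral => t _; rewrite !patchE addr0.
  have -> : (t \in `[a, +oo[%classic) = (kap * t \in `[kap * a, +oo[%classic).
    by apply/idP/idP; rewrite !inE /= !in_itv/= !andbT ler_pM2l.
  by [].
transitivity (\int[pushforward leb (fun t : measurableTypeR R => kap * t + 0 : measurableTypeR R)%R]_t g t)%E.
  by rewrite (ge0_integral_pushforward maff).
transitivity (\int[mscale (NngNum nng) leb]_t g t)%E.
  apply: eq_measure_integral => C mC _.
  rewrite [RHS]/= /mscale /= -[kap in RHS](gtr0_norm kap0).
  by apply: lebesgue_measure_affine => //; rewrite gt_eqF.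
rewrite ge0_integral_mscale//; congr (_ * _)%E.
by rewrite [RHS]integral_mkcond.
Qed.

Variable s : R.
Hypothesis s01 : 0 < s < 1.

(** Along a line with value D and slope m, the drop of the s-th power on the descending side;
    [lineout] is the gain on the other. Rescaling t by m / D gives [innerf] and [outerf]. *)
Definition linein (D m t : R) : R := D `^ s - (Num.max 0 (D - m * t)) `^ s.
Definition lineout (D m t : R) : R := (D + m * t) `^ s - D `^ s.

(** The fractions x / (x + y) and y / (x + y) lie in [0, 1], where z <= z^s, and they sum to 1. *)
Lemma powR_subadd (x y : R) : 0 < x -> 0 <= y -> (x + y) `^ s <= x `^ s + y `^ s.
Proof.
move=> x0 y0; have /andP[s0 s1] := s01.
have xy0 : 0 < x + y by rewrite ltr_wpDr.
have sle : 0 < s <= 1 by rewrite s0 ltW.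
have h1 : x / (x + y) <= (x / (x + y)) `^ s.
  by apply: ler_powR_inv => //; rewrite divr_ge0 ?(ltW x0) ?(ltW xy0)//= ler_pdivrMr// mul1r lerDl.
have h2 : y / (x + y) <= (y / (x + y)) `^ s.
  apply: ler_powR_inv => //; rewrite divr_ge0 ?(ltW xy0)//= ler_pdivrMr// mul1r lerDr.
  exact: ltW.
have e1 : x / (x + y) + y / (x + y) = 1 by rewrite -mulrDl mulfV ?gt_eqF.
have : 1 <= (x `^ s + y `^ s) * (x + y)^-1 `^ s.
  rewrite mulrDl -!powRM ?invr_ge0 ?(ltW x0) ?(ltW xy0)//; lra.
have -> : (x + y)^-1 `^ s = ((x + y) `^ s)^-1.
  by rewrite -(powR_inv1 (ltW xy0)) -powRrM mulN1r powRN.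
by rewrite ler_pdivlMr ?powR_gt0// mul1r.
Qed.

Lemma linein_ge0 D m t : 0 < D -> 0 <= m -> 0 <= t -> 0 <= linein D m t.
Proof.
move=> D0 m0 t0; have /andP[s0 _] := s01; rewrite subr_ge0.
apply: ge0_ler_powR; first exact: ltW.
- by rewrite nnegrE le_max lexx.
- by rewrite nnegrE ltW.
- by rewrite ge_max (ltW D0)/= gerBl mulr_ge0.
Qed.

Lemma lineout_ge0 D m t : 0 < D -> 0 <= m -> 0 <= t -> 0 <= lineout D m t.
Proof.
move=> D0 m0 t0; have /andP[s0 _] := s01; rewrite subr_ge0.
have mt : 0 <= m * t by exact: mulr_ge0.
apply: ge0_ler_powR; first exact: ltW.
- by rewrite nnegrE ltW.
- by rewrite nnegrE addr_ge0// ltW.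
- by rewrite lerDl.
Qed.

Lemma measurable_linein D m : measurable_fun setT
  (fun t : measurableTypeR R => linein D m t : measurableTypeR R).
Proof.
apply: measurable_funB => //; apply: (measurableT_comp (measurable_powR _)).
by apply: measurable_maxr => //; apply: measurable_funB => //; exact: measurable_funM.
Qed.

Lemma measurable_lineout D m : measurable_fun setT
  (fun t : measurableTypeR R => lineout D m t : measurableTypeR R).
Proof.
apply: measurable_funB => //; apply: (measurableT_comp (measurable_powR _)).
by apply: measurable_funD => //; exact: measurable_funM.
Qed.

(** [integral_inner_outer] rescaled; m a < D says that the rescaled endpoint is below 1. For fixed D
    and m the error tends to 0 with a. *)
Lemma integral_linein_out (D m a : R) : 0 < D -> 0 <= m -> 0 < a -> m * a < D ->
  (\int[leb]_(t in `[a, +oo[) (linein D m t * t `^ (- 1 - 2 * s))%:E <=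
   \int[leb]_(t in `[a, +oo[) (lineout D m t * t `^ (- 1 - 2 * s))%:E +
   (D `^ s * ((m / D) ^+ 2 * a `^ (2 - 2 * s)) / s)%:E)%E.
Proof.
move=> D0 m0 a0 ma; have /andP[s0 s1] := s01.
have c0 : 0 <= D `^ s * ((m / D) ^+ 2 * a `^ (2 - 2 * s)) / s.
  apply: divr_ge0; last exact: ltW.
  by apply: mulr_ge0; [exact: powR_ge0|apply: mulr_ge0; [exact: sqr_ge0|exact: powR_ge0]].
have [m_eq0|mN0] := eqVneq m 0.
  rewrite integral0_eq => [|t _].
    rewrite adde_ge0 ?lee_fin//; apply: integral_ge0 => t.
    rewrite /= in_itv/= andbT => at_; rewrite lee_fin mulr_ge0 ?powR_ge0//.
    by apply: lineout_ge0 => //; rewrite (le_trans _ at_)// ltW.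
  by rewrite /linein m_eq0 mul0r subr0 max_r ?subrr ?mul0r// ltW.
have mp : 0 < m by rewrite lt_def mN0.
pose kap := m / D; have kap0 : 0 < kap by exact: divr_gt0.
have ka : 0 < kap * a by exact: mulr_gt0.
have ka1 : kap * a < 1 by rewrite /kap mulrAC ltr_pdivrMr// mul1r.
pose K := D `^ s * kap `^ (1 + 2 * s).
have K0 : 0 <= K by rewrite mulr_ge0 ?powR_ge0.
have Dk t : m * t = D * (kap * t) by rewrite /kap; field; rewrite gt_eqF.
have kt t : 0 < t -> t `^ (- 1 - 2 * s) = kap `^ (1 + 2 * s) * (kap * t) `^ (- 1 - 2 * s).
  move=> t0; rewrite powRM ?(ltW kap0) ?(ltW t0)// mulrA -powRDp//.
  by rewrite (_ : 1 + 2 * s + (- 1 - 2 * s) = 0) ?powRr0 ?mul1r//; lra.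
have iE t : 0 < t -> linein D m t * t `^ (- 1 - 2 * s) = K * innerf s (kap * t).
  move=> t0; rewrite (kt t t0) /linein /innerf /K Dk.
  have -> : Num.max 0 (D - D * (kap * t)) = D * Num.max 0 (1 - kap * t).
    by rewrite maxr_pMr ?(ltW D0)// mulr0 mulrBr mulr1.
  rewrite powRM ?(ltW D0) ?le_max ?lexx//; ring.
have oE t : 0 < t -> lineout D m t * t `^ (- 1 - 2 * s) = K * outerf s (kap * t).
  move=> t0; rewrite (kt t t0) /lineout /outerf /K Dk.
  have -> : D + D * (kap * t) = D * (1 + kap * t) by ring.
  rewrite powRM ?(ltW D0)//; first by ring.
  by rewrite addr_ge0// mulr_ge0// ltW.
have mi := measurable_innerf s; have mo := measurable_outerf s.
have i0 x : kap * a <= x -> 0 <= innerf s x.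
  by move=> kx; apply: innerf_ge0 => //; exact: lt_le_trans kx.
have o0 x : kap * a <= x -> 0 <= outerf s x.
  by move=> kx; apply: outerf_ge0 => //; exact: lt_le_trans kx.
have mk : measurable_fun setT (fun t : measurableTypeR R => kap * t : measurableTypeR R).
  exact: measurable_funM.
have -> : (\int[leb]_(t in `[a, +oo[) (linein D m t * t `^ (- 1 - 2 * s))%:E =
    (K / kap)%:E * \int[leb]_(t in `[(kap * a)%R, +oo[) (innerf s t)%:E)%E.
  rewrite EFinM -muleA -ge0_integral_scale_cy// -ge0_integralZlR//.
  - by apply: eq_integral => t; rewrite inE /= in_itv/= andbT => at_; rewrite iE// (lt_le_trans a0).
  - by apply: measurable_funTS; exact: (measurableT_comp mi mk).
  - by move=> t /=; rewrite in_itv/= andbT => at_; apply: i0; rewrite ler_pM2l.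
have -> : (\int[leb]_(t in `[a, +oo[) (lineout D m t * t `^ (- 1 - 2 * s))%:E =
    (K / kap)%:E * \int[leb]_(t in `[(kap * a)%R, +oo[) (outerf s t)%:E)%E.
  rewrite EFinM -muleA -ge0_integral_scale_cy// -ge0_integralZlR//.
  - by apply: eq_integral => t; rewrite inE /= in_itv/= andbT => at_; rewrite oE// (lt_le_trans a0).
  - by apply: measurable_funTS; exact: (measurableT_comp mo mk).
  - by move=> t /=; rewrite in_itv/= andbT => at_; apply: o0; rewrite ler_pM2l.
have Kk : 0 <= K / kap by rewrite divr_ge0// ltW.
have ka01 : 0 < kap * a < 1 by rewrite ka.
apply: (le_trans (lee_wpmul2l _ (integral_inner_outer s01 ka01))); first by rewrite lee_fin.
rewrite muleDr//; last first.
  by apply: ge0_adde_def; rewrite inE; [apply: integral_ge0 => t; rewrite /= in_itv/= andbT => /o0; rewrite lee_fin|rewrite lee_fin divr_ge0 ?powR_ge0// ltW].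
rewrite leeD2l// -EFinM lee_fin -/kap.
rewrite /K powRM ?(ltW kap0) ?(ltW a0)//.
have -> : kap ^+ 2 = kap `^ (1 + 2 * s) * kap^-1 * kap `^ (2 - 2 * s).
  rewrite -(powR_inv1 (ltW kap0)) -!powRDp// -powR_mulrn ?(ltW kap0)//.
  by congr (_ `^ _); lra.
by rewrite le_eqVlt; apply/orP; left; apply/eqP; ring.
Qed.

(** This gives finiteness of the outer integral at a fixed truncation, so that it can be cancelled
    from both sides in the barrier bound although it may diverge as the truncation shrinks. *)
Lemma integral_lineout_le (D m a : R) : 0 < D -> 0 <= m -> 0 < a ->
  (\int[leb]_(t in `[a, +oo[) (lineout D m t * t `^ (- 1 - 2 * s))%:E <=
   (m `^ s * (a `^ (- s) / s))%:E)%E.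
Proof.
move=> D0 m0 a0; have /andP[s0 s1] := s01.
apply: (@le_trans _ _ (\int[leb]_(t in `[a, +oo[) (m `^ s * t `^ (- s - 1))%:E)%E).
  apply: ge0_le_integral => //.
  - move=> t /=; rewrite in_itv/= andbT => at_; rewrite lee_fin mulr_ge0 ?powR_ge0//.
    by apply: lineout_ge0 => //; rewrite (le_trans _ at_)// ltW.
  - apply/measurable_EFinP/measurable_funTS; apply: measurable_funM.
      exact: measurable_lineout.
    exact: measurable_powR.
  - apply/measurable_EFinP/measurable_funTS; apply: measurable_funM.
      exact: measurable_cst.
    exact: measurable_powR.
  - move=> t /=; rewrite in_itv/= andbT => at_.
    have t0 : 0 < t by exact: lt_le_trans at_.
    have -> : t `^ (- s - 1) = t `^ s * t `^ (- 1 - 2 * s).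
      by rewrite -powRDp//; congr (_ `^ _); lra.
    rewrite lee_fin mulrA ler_wpM2r ?powR_ge0// -powRM ?(ltW t0)//.
    by rewrite /lineout lerBlDl powR_subadd// mulr_ge0// ltW.
rewrite ge0_integralZlR//.
- by rewrite EFinM lee_wpmul2l ?lee_fin ?powR_ge0//; exact: integral_powR_cy.
- by apply: measurable_funTS; exact: measurable_powR.
- by move=> t _; exact: powR_ge0.
- exact: powR_ge0.
Qed.
End line.

Section barrier.
Context {R : realType} {n : nat} {s lam Lam : R} {k : 'rV[R]_n -> R}.
Hypothesis kP : kernel_spec s lam Lam k.
Hypothesis n0 : (0 < n)%N.
Local Notation mu := (lebesgue_rV R n).
Local Notation leb := (@lebesgue_measure R).
Local Notation Lop := (@Lop R n k).

Let s01 := kernel_s kP.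
Let s0 : 0 < s. Proof. by case/andP: s01. Qed.
Let s1 : s < 1. Proof. by case/andP: s01. Qed.

(** Up to a factor, Getoor's torsion function of the ball for the fractional Laplacian. It is
    homogeneous of degree 2s in (r, x - z), so the bound on its operator can be uniform in r. *)
Definition psi (z : 'rV[R]_n) (r : R) (x : 'rV[R]_n) : R :=
  (Num.max 0 (r ^+ 2 - enorm (x - z) ^+ 2)) `^ s.

Lemma psi_ge0 z r x : 0 <= psi z r x.
Proof. exact: powR_ge0. Qed.

Lemma psi_out z r x : 0 < r -> r <= enorm (x - z) -> psi z r x = 0.
Proof.
move=> r0 rx; rewrite /psi max_l ?powR0 ?gt_eqF//.
by rewrite subr_le0 ler_pXn2r// nnegrE ?enorm_ge0// ltW.
Qed.

Lemma psi_le z r x : psi z r x <= (r ^+ 2) `^ s.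
Proof.
apply: ge0_ler_powR; first exact: ltW.
- by rewrite nnegrE le_max lexx.
- by rewrite nnegrE sqr_ge0.
- by rewrite ge_max sqr_ge0 gerBl sqr_ge0.
Qed.

(** Subadditivity of the s-th power makes this function Hölder continuous of exponent s, including
    at the origin. *)
Lemma powR_max_continuous : continuous (fun t : R => (Num.max 0 t) `^ s).
Proof.
have hold a b : 0 <= a -> a <= b -> b `^ s - a `^ s <= (b - a) `^ s.
  move=> a0 ab; have [->|aN0] := eqVneq a 0; first by rewrite powR0 ?gt_eqF// !subr0.
  have ap : 0 < a by rewrite lt_def aN0.
  rewrite lerBlDl; have := @powR_subadd _ _ s01 a (b - a) ap.
  by rewrite subr_ge0 subrKC; apply.
have hold2 t u : `|(Num.max 0 t) `^ s - (Num.max 0 u) `^ s| <= `|t - u| `^ s.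
  wlog tu : t u / t <= u => [hw|].
    have [|/ltW ut] := leP t u; first exact: hw.
    by rewrite distrC (distrC t); exact: hw.
  have M : Num.max 0 t <= Num.max 0 u by rewrite ge_max !le_max lexx tu orbT.
  have t0 : 0 <= Num.max 0 t by rewrite le_max lexx.
  rewrite ler0_norm; last first.
    rewrite subr_le0; apply: ge0_ler_powR => //; first exact: ltW.
    by rewrite nnegrE (le_trans t0).
  rewrite opprB (le_trans (hold _ _ t0 M))//; apply: ge0_ler_powR; first exact: ltW.
  - by rewrite nnegrE subr_ge0.
  - by rewrite nnegrE.
  - rewrite ler0_norm ?subr_le0// opprB.
    by have [] := leP 0 t; have [] := leP 0 u; lra.
move=> t; have FF : Filter (nbhs t) by exact: nbhs_filter.
apply/cvgrPdist_lt => e e0; have es : 0 < e `^ s^-1 by exact: powR_gt0.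
have es' : e = e `^ s^-1 `^ s by rewrite -powRrM mulVf ?gt_eqF// powRr1// ltW.
have /cvgrPdist_lt/(_ _ es) : u @[u --> t] --> t by exact: cvg_id.
apply: filterS => u tu; apply: (le_lt_trans (hold2 t u)); rewrite es'.
apply: gt0_ltr_powR => //; rewrite nnegrE ?powR_ge0//; exact: normr_ge0.
Qed.

Lemma psi_continuous z r : continuous (psi z r).
Proof.
move=> x.
have FF : Filter (nbhs x) by exact: nbhs_filter.
have cz := @continuous_enormB R n z x.
have c1 : r ^+ 2 - enorm (y - z) ^+ 2 @[y --> x] --> r ^+ 2 - enorm (x - z) ^+ 2.
  by apply: cvgB; [exact: cvg_cst|exact: (cvgM cz cz)].
have := powR_max_continuous (x := r ^+ 2 - enorm (x - z) ^+ 2); rewrite /continuous_at => c2.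
exact: (cvg_comp _ _ c1 c2).
Qed.

Lemma psi_bmeas z r : bmeas (psi z r).
Proof.
apply: (@continuous_bmeas _ _ _ 0 ((r ^+ 2) `^ s)); first exact: psi_continuous.
by move=> x; rewrite psi_ge0 psi_le.
Qed.

(** Drop of the tangent in the direction of [y] plus the two chord errors, on either side of [x].
    All pieces are nonnegative, so each may be integrated along rays by Tonelli. *)
Definition innerp (D : R) (v y : 'rV[R]_n) : R :=
  linein s D `|2 * dotv v y| 1 + (chordE s D (2 * dotv v y) (enorm y ^+ 2) 1
    + chordE s D (- (2 * dotv v y)) (enorm y ^+ 2) 1).

Definition outerp (D : R) (v y : 'rV[R]_n) : R := lineout s D `|2 * dotv v y| 1.

(* Along each line through [x] the barrier is a concave parabola to the power
   [s]; [innerp - outerp] compares it with its tangent at [x]. *)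
Lemma psi_diff2 z r x y : 0 < r ^+ 2 - enorm (x - z) ^+ 2 ->
  diff2 (psi z r) x y + outerp (r ^+ 2 - enorm (x - z) ^+ 2) (x - z) y =
  innerp (r ^+ 2 - enorm (x - z) ^+ 2) (x - z) y.
Proof.
set D := r ^+ 2 - _ => D0; rewrite /diff2 /innerp /outerp /linein /lineout /chordE.
set m := 2 * dotv (x - z) y; set q := enorm y ^+ 2.
have e1 : r ^+ 2 - enorm (x + y - z) ^+ 2 = D - m - q.
  rewrite /D /m /q addrAC !sqr_enorm dotvDl !(dotvDr (x - z) y) (dotvC y (x - z)); ring.
have e2 : r ^+ 2 - enorm (x - y - z) ^+ 2 = D + m - q.
  rewrite /D /m /q addrAC !sqr_enorm dotvDl !(dotvDr (x - z) (- y)) dotvNl !dotvNr (dotvC y (x - z)).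
  by rewrite dotvNl; ring.
have alg (a b c d e : R) : 2 * a - b - c + (d - a) = a - e + (d - c + (e - b)) by ring.
rewrite /psi e1 e2 -/D (max_r (ltW D0)) !mulr1 expr1n !mulr1.
have [m0|/ltW m0] := leP 0 m.
  rewrite (ger0_norm m0) (@max_r _ _ 0 (D + m)); last by rewrite addr_ge0// ltW.
  exact: alg.
rewrite (ler0_norm m0) (@max_r _ _ 0 (D - m)); last by lra.
have alg2 (a b c d e : R) : 2 * a - b - c + (d - a) = a - e + (e - c + (d - b)) by ring.
by rewrite opprK; exact: alg2.
Qed.

Lemma measurable_dotv v : measurable_fun setT ((fun y : 'rV[R]_n => dotv v y) : _ -> measurableTypeR R).
Proof.
apply: measurable_sum => i; apply: measurable_funM => //.
exact: measurable_coord.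
Qed.

Lemma measurable_outerp D v : measurable_fun setT (outerp D v : _ -> measurableTypeR R).
Proof.
apply: measurable_funB => //; apply: (measurableT_comp (measurable_powR _)).
apply: measurable_funD => //; apply: measurable_funM => //.
by apply: measurableT_comp => //; apply: measurable_funM => //; exact: measurable_dotv.
Qed.

Lemma measurable_innerp D v : measurable_fun setT (innerp D v : _ -> measurableTypeR R).
Proof.
have md := measurable_dotv v.
have m2 : measurable_fun setT ((fun y : 'rV[R]_n => 2 * dotv v y) : _ -> measurableTypeR R).
  exact: measurable_funM.
have mN : measurable_fun setT ((fun y : 'rV[R]_n => - (2 * dotv v y)) : _ -> measurableTypeR R).
  by apply: measurableT_comp.
have ms : measurable_fun setT ((fun y : 'rV[R]_n => enorm y ^+ 2) : _ -> measurableTypeR R).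
  by apply: measurable_funX; exact: measurable_enorm.
have mc (f : 'rV[R]_n -> R) : measurable_fun setT (f : _ -> measurableTypeR R) ->
    measurable_fun setT ((fun y => chordE s D (f y) (enorm y ^+ 2) 1) : _ -> measurableTypeR R).
  move=> mf; apply: measurable_funB; apply: (measurableT_comp (measurable_powR _));
    apply: measurable_maxr => //.
    by apply: measurable_funD => //; exact: measurable_funM.
  by apply: measurable_funB; [apply: measurable_funD => //; exact: measurable_funM|exact: measurable_funM].
apply: measurable_funD; last by apply: measurable_funD; exact: mc.
apply: measurable_funB => //; apply: (measurableT_comp (measurable_powR _)).
apply: measurable_maxr => //; apply: measurable_funB => //; apply: measurable_funM => //.
by apply: measurableT_comp.
Qed.

Lemma outerp_ge0 D v y : 0 < D -> 0 <= outerp D v y.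
Proof. by move=> D0; apply: lineout_ge0. Qed.

Lemma innerp_ge0 D v y : 0 < D -> 0 <= innerp D v y.
Proof.
move=> D0; apply: addr_ge0; first by apply: linein_ge0.
by apply: addr_ge0; apply: chordE_ge0 => //; exact: sqr_ge0.
Qed.

Definition farf (G : 'rV[R]_n -> R) e (y : 'rV[R]_n) : R :=
  \1_(far e) y * (G y * k y).

Lemma measurable_farf G e : measurable_fun setT (G : _ -> measurableTypeR R) ->
  measurable_fun setT (farf G e : _ -> measurableTypeR R).
Proof.
move=> mG; have mk := kernel_measurable kP; apply: measurable_funM.
  by apply: measurable_indic; exact: measurable_far.
exact: measurable_funM.
Qed.

Lemma integral_farf_ray G e y : 0 < e ->
  measurable_fun setT (G : _ -> measurableTypeR R) -> (forall y, 0 <= G y) ->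
  shell y ->
  (\int[leb]_(t in `]0%R, +oo[) (farf G e (t *: y) * (t ^+ n / t))%:E =
   (k y)%:E * \int[leb]_(t in `[(e / enorm y)%R, +oo[)
     (G (t *: y) * t `^ (- 1 - 2 * s))%:E)%E.
Proof.
move=> e0 mG G0 /andP[y1 y2]; have k0 := kernel_ge0 kP.
have y0 : 0 < enorm y by exact: lt_le_trans y1.
rewrite -ge0_integralZlR//; last 2 first.
- apply: measurable_funTS; apply: measurable_funM; last exact: measurable_powR.
  by apply: (measurableT_comp mG); apply: measurable_funZ.
- by move=> t _; rewrite mulr_ge0 ?powR_ge0.
rewrite [LHS]integral_mkcond [RHS]integral_mkcond; apply: eq_integral => t _.
rewrite !patchE /farf indicE.
have a0 : 0 < e / enorm y by exact: divr_gt0.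
case: ifPn => [|tn]; last first.
  rewrite ifN//; apply: contra tn; rewrite !inE /= !in_itv/= !andbT.
  exact: lt_le_trans.
rewrite inE /= in_itv/= andbT => t0.
have -> : (t *: y \in far e) = (t \in `[e / enorm y, +oo[%classic).
  apply/idP/idP; rewrite !inE farE /= in_itv/= andbT enormZ gtr0_norm// ler_pdivrMr//.
case: (_ \in _); last by rewrite mul0r mul0r.
rewrite mul1r (kernel_hom kP)//; congr (_%:E).
have -> : t ^+ n / t = t `^ (n%:R - 1).
  by rewrite powRDp// powR_mulrn ?(ltW t0)// powR_inv1// ltW.
have -> : - 1 - 2 * s = - (n%:R + 2 * s) + (n%:R - 1) by lra.
by rewrite (powRDp (- (n%:R + 2 * s)) _ t0); ring.
Qed.

Lemma far_polar (G : 'rV[R]_n -> R) e : 0 < e ->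
  measurable_fun setT (G : _ -> measurableTypeR R) -> (forall y, 0 <= G y) ->
  ((ln 2)%:E * \int[mu]_(y in far e) (G y * k y)%:E =
   \int[mu]_(y in @shell R n) ((k y)%:E *
     \int[leb]_(t in `[(e / enorm y)%R, +oo[) (G (t *: y) * t `^ (- 1 - 2 * s))%:E))%E.
Proof.
move=> e0 mG G0; have k0 := kernel_ge0 kP.
have -> : (\int[mu]_(y in far e) (G y * k y)%:E = \int[mu]_y (farf G e y)%:E)%E.
  rewrite integral_mkcond; apply: eq_integral => y _; rewrite patchE /farf indicE.
  by case: (_ \in _); rewrite ?mul1r ?mul0r.
rewrite ge0_integral_polar//; last 3 first.
- exact: measurable_farf.
- by move=> y; rewrite /farf indicE !mulr_ge0.
- by rewrite /farf (kernel0 kP) !mulr0.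
by apply: eq_integral => y; rewrite inE => ys; exact: integral_farf_ray.
Qed.

Lemma measurable_far_polar (G : 'rV[R]_n -> R) e : 0 < e ->
  measurable_fun setT (G : _ -> measurableTypeR R) -> (forall y, 0 <= G y) ->
  measurable_fun (@shell R n) (fun y => (k y)%:E *
     \int[leb]_(t in `[(e / enorm y)%R, +oo[) (G (t *: y) * t `^ (- 1 - 2 * s))%:E)%E.
Proof.
move=> e0 mG G0.
pose I0 (t : measurableTypeR R) : R := \1_(`]0%R, +oo[%classic : set (measurableTypeR R)) t.
pose H (p : measurableTypeR R * 'rV[R]_n) : \bar R :=
  (I0 p.1 * (farf G e (p.1 *: p.2) * p.1 `^ (n%:R - 1)))%:E.
have mH : measurable_fun setT H.
  apply/measurable_EFinP; apply: measurable_funM.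
    by apply: (measurableT_comp (f := I0)) => //; exact: measurable_indic.
  apply: measurable_funM; last exact: (measurableT_comp (measurable_powR _) measurable_fst).
  have mF : measurable_fun setT (farf G e : _ -> measurableTypeR R) by exact: measurable_farf.
  by apply: (measurableT_comp mF); apply: measurable_funZ.
have H0 p : (0 <= H p)%E.
  by rewrite lee_fin /H /I0 /farf !indicE !mulr_ge0 ?powR_ge0// (kernel_ge0 kP).
have := @measurable_fun_fubini_tonelli_G _ _ _ _ _ leb H mH H0.
move=> /(@measurable_funTS _ _ _ _ (@shell R n)); apply: eq_measurable_fun => y.
rewrite inE => ys; rewrite -integral_farf_ray// [RHS]integral_mkcond.
apply: eq_integral => t _; rewrite patchE /H /I0 /= indicE.
case: ifPn => [|tn]; last by rewrite mul0r.
rewrite inE /= in_itv/= andbT => t0; rewrite mul1r.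
by rewrite powRDp// powR_mulrn ?(ltW t0)// powR_inv1// ltW.
Qed.

Lemma innerp_hom D v y t : 0 < t -> innerp D v (t *: y) =
  linein s D `|2 * dotv v y| t + (chordE s D (2 * dotv v y) (enorm y ^+ 2) t
    + chordE s D (- (2 * dotv v y)) (enorm y ^+ 2) t).
Proof.
move=> t0; rewrite /innerp dotvZr enormZ exprMn real_normK ?num_real// mulrCA.
rewrite /linein /chordE normrM (gtr0_norm t0) !mulr1 expr1n !mulr1.
by rewrite mulNr (mulrC t) (mulrC t) (mulrC (t ^+ 2)).
Qed.

Lemma outerp_hom D v y t : 0 < t -> outerp D v (t *: y) = lineout s D `|2 * dotv v y| t.
Proof.
by move=> t0; rewrite /outerp /lineout dotvZr mulrCA normrM (gtr0_norm t0) mulr1 (mulrC t).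
Qed.

End barrier.

(** * The operator of the barrier is bounded above uniformly in the ball *)

Section barrier_bound.
Context {R : realType} {n : nat} {s lam Lam : R} {k : 'rV[R]_n -> R}.
Hypothesis kP : kernel_spec s lam Lam k.
Hypothesis n0 : (0 < n)%N.
Local Notation mu := (lebesgue_rV R n).
Local Notation leb := (@lebesgue_measure R).
Local Notation Lop := (@Lop R n k).
Local Notation psi := (@psi R n s).
Local Notation innerp := (@innerp R n s).
Local Notation outerp := (@outerp R n s).

Let s01 := kernel_s kP.
Let s0 : 0 < s. Proof. by case/andP: s01. Qed.
Let s1 : s < 1. Proof. by case/andP: s01. Qed.

Lemma le_normr_dotv (v y : 'rV[R]_n) : `|dotv v y| <= enorm v * enorm y.
Proof.
rewrite ler_norml dotv_enormM andbT lerNl -dotvNl -(enormN v).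
exact: dotv_enormM.
Qed.

Let chord_cst : R := (1 - s)^-1 + s^-1.

Let wgt (t : R) := t `^ (- 1 - 2 * s).

Let chord_ray_le (D a p y : R) : 0 < D -> 0 < a -> 1 <= y <= 2 ->
  (\int[leb]_(t in `[a, +oo[) (chordE s D p (y ^+ 2) t * wgt t)%:E <= (4 * chord_cst)%:E)%E.
Proof.
move=> D0 a0 /andP[y1 y2]; have y0 : 0 < y by exact: lt_le_trans y1.
have q0 : 0 < y ^+ 2 by exact: exprn_gt0.
have q4 : (y ^+ 2) `^ s <= 4.
  apply: (@le_trans _ _ (4 `^ s)); last first.
    by rewrite -{2}(powRr1 (ler0n R 4)) ler_powR ?ler1n// ltW.
  apply: ge0_ler_powR; first exact: ltW.
  - by rewrite nnegrE ltW.
  - by rewrite nnegrE.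
  - have -> : 4 = 2 ^+ 2 :> R by rewrite -natrX.
    by rewrite ler_pXn2r// nnegrE// ltW.
have c0 : 0 <= chord_cst by rewrite addr_ge0// invr_ge0 ?subr_ge0 ltW.
have hq : (y ^+ 2) `^ s * chord_cst <= 4 * chord_cst by rewrite ler_wpM2r.
apply: (@le_trans _ _ ((y ^+ 2) `^ s * chord_cst)%:E); last by rewrite lee_fin.
apply: le_trans (integral_chordE p s01 D0 q0).
apply: ge0_subset_integral; [exact: measurable_itv|exact: measurable_itv| | |].
- apply/measurable_EFinP; apply: measurable_funTS; apply: measurable_funM.
    exact: measurable_chordE.
  exact: measurable_powR.
- move=> t _; rewrite lee_fin mulr_ge0 ?powR_ge0//.
  by apply: chordE_ge0 => //; exact: ltW.
- by move=> t /=; rewrite !in_itv/= !andbT; exact: lt_le_trans.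
Qed.

Let lin_ray_le (D m r a e : R) : 0 < D -> 0 < r -> 0 <= m <= 4 * r -> 0 < a <= e ->
  4 * r * e < D -> D `^ s * ((4 * r / D) ^+ 2 * e `^ (2 - 2 * s)) / s <= 1 ->
  (\int[leb]_(t in `[a, +oo[) (linein s D m t * wgt t)%:E <=
   \int[leb]_(t in `[a, +oo[) (lineout s D m t * wgt t)%:E + 1%:E)%E.
Proof.
move=> D0 r0 /andP[m0 m4] /andP[a0 ae] eD eQ.
have e0 : 0 < e by exact: lt_le_trans ae.
have ma : m * a < D by apply: le_lt_trans eD; apply: ler_pM => //; exact: ltW.
have bd : D `^ s * ((m / D) ^+ 2 * a `^ (2 - 2 * s)) / s <= 1.
  apply: le_trans eQ; rewrite ler_wpM2r ?invr_ge0 ?(ltW s0)// ler_wpM2l ?powR_ge0//.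
  apply: ler_pM; [exact: sqr_ge0|exact: powR_ge0| |].
    rewrite ler_pXn2r ?nnegrE ?divr_ge0 ?(ltW D0)// ?mulr_ge0 ?(ltW r0)//.
    by rewrite ler_wpM2r// invr_ge0 ltW.
  apply: ge0_ler_powR => //; first by have := s1; lra.
  - by rewrite nnegrE ltW.
  - by rewrite nnegrE ltW.
apply: (le_trans (integral_linein_out s01 D0 m0 a0 ma)).
by apply: leeD2l; rewrite lee_fin.
Qed.

Let integral_inner_ray (D a : R) v y : 0 < D -> 0 < a ->
  (\int[leb]_(t in `[a, +oo[) (innerp D v (t *: y) * wgt t)%:E =
   \int[leb]_(t in `[a, +oo[) (linein s D `|2 * dotv v y| t * wgt t)%:E +
   (\int[leb]_(t in `[a, +oo[) (chordE s D (2 * dotv v y) (enorm y ^+ 2) t * wgt t)%:E +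
    \int[leb]_(t in `[a, +oo[) (chordE s D (- (2 * dotv v y)) (enorm y ^+ 2) t * wgt t)%:E))%E.
Proof.
move=> D0 a0.
have mw : measurable_fun setT (wgt : measurableTypeR R -> measurableTypeR R) by exact: measurable_powR.
have tpos t : t \in `[a, +oo[%classic -> 0 < t.
  by rewrite inE /= in_itv/= andbT => /(lt_le_trans a0).
transitivity (\int[leb]_(t in `[a, +oo[) ((linein s D `|2 * dotv v y| t * wgt t)%:E +
    ((chordE s D (2 * dotv v y) (enorm y ^+ 2) t * wgt t)%:E +
     (chordE s D (- (2 * dotv v y)) (enorm y ^+ 2) t * wgt t)%:E)))%E.
  apply: eq_integral => t /tpos t0; rewrite innerp_hom// -!EFinD.
  by rewrite -[in RHS]mulrDl -[in RHS]mulrDl.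
move: (enorm y ^+ 2) (sqr_ge0 (enorm y)) => q q0.
move: (2 * dotv v y) (normr_ge0 (2 * dotv v y)) => p; move: `|p| => m m0.
have mc p' : measurable_fun `[a, +oo[%classic
    ((fun t => (chordE s D p' q t * wgt t)%:E) : measurableTypeR R -> \bar R).
  apply/measurable_EFinP; apply: measurable_funTS; apply: measurable_funM => //.
  exact: measurable_chordE.
have ml : measurable_fun `[a, +oo[%classic
    ((fun t => (linein s D m t * wgt t)%:E) : measurableTypeR R -> \bar R).
  apply/measurable_EFinP; apply: measurable_funTS; apply: measurable_funM => //.
  exact: measurable_linein.
have c0 p' t : `[a, +oo[%classic t -> (0 <= (chordE s D p' q t * wgt t)%:E)%E.
  by move=> _; rewrite lee_fin mulr_ge0 ?powR_ge0//; apply: chordE_ge0.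
have l0 t : `[a, +oo[%classic t -> (0 <= (linein s D m t * wgt t)%:E)%E.
  move=> /mem_set/tpos/ltW t0; rewrite lee_fin mulr_ge0 ?powR_ge0//.
  exact: (linein_ge0 s01).
have ma' := @measurable_itv R `[a, +oo[.
have mcc : measurable_fun `[a, +oo[%classic
    ((fun t => (chordE s D p q t * wgt t)%:E + (chordE s D (- p) q t * wgt t)%:E)%E : measurableTypeR R -> \bar R).
  exact: (emeasurable_funD (mc p) (mc (- p))).
have cc0 t : `[a, +oo[%classic t ->
    (0 <= (chordE s D p q t * wgt t)%:E + (chordE s D (- p) q t * wgt t)%:E)%E.
  by move=> ta; apply: adde_ge0; exact: c0.
have eD1 := ge0_integralD leb ma' l0 ml cc0 mcc.
have eD2 := ge0_integralD leb ma' (c0 p) (mc p) (c0 (- p)) (mc (- p)).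
exact: etrans eD1 (congr1 (adde _) eD2).
Qed.

Let ray_le D v y r e : 0 < D -> 0 < r -> enorm v < r -> shell y -> 0 < e ->
  4 * r * e < D -> D `^ s * ((4 * r / D) ^+ 2 * e `^ (2 - 2 * s)) / s <= 1 ->
  (\int[leb]_(t in `[(e / enorm y)%R, +oo[) (innerp D v (t *: y) * wgt t)%:E <=
   \int[leb]_(t in `[(e / enorm y)%R, +oo[) (outerp D v (t *: y) * wgt t)%:E
   + (1 + (4 * chord_cst + 4 * chord_cst))%:E)%E.
Proof.
move=> D0 r0 vr ys e0 eD eQ; have /andP[y1 y2] := ys.
have y0 : 0 < enorm y by exact: lt_le_trans y1.
set a := e / enorm y; have a0 : 0 < a by exact: divr_gt0.
have ae : 0 < a <= e by rewrite a0 ler_pdivrMr// ler_peMr// ltW.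
pose m := `|2 * dotv v y|; have m0 : 0 <= m by exact: normr_ge0.
have m4 : 0 <= m <= 4 * r.
  rewrite m0/= /m normrM ger0_norm//.
  have := le_normr_dotv v y; have : enorm v * enorm y <= r * 2.
    by apply: ler_pM; rewrite ?enorm_ge0// ltW.
  by lra.
have eO : (\int[leb]_(t in `[a, +oo[) (outerp D v (t *: y) * wgt t)%:E =
   \int[leb]_(t in `[a, +oo[) (lineout s D m t * wgt t)%:E)%E.
  apply: eq_integral => t; rewrite inE /= in_itv/= andbT => /(lt_le_trans a0) t0.
  by rewrite outerp_hom.
have h1 := lin_ray_le D0 r0 m4 ae eD eQ.
have := leeD h1 (leeD (chord_ray_le (2 * dotv v y) D0 a0 ys)
   (chord_ray_le (- (2 * dotv v y)) D0 a0 ys)).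
have e1 := integral_inner_ray v y D0 a0.
rewrite e1 eO => h; apply: (le_trans h).
by rewrite (EFinD 1) (EFinD (4 * chord_cst)) -[leLHS]addeA.
Qed.

Let out_ray_le D v (y : 'rV[R]_n) r e : 0 < D -> 0 < r -> enorm v < r -> shell y -> 0 < e ->
  (\int[leb]_(t in `[(e / enorm y)%R, +oo[) (outerp D v (t *: y) * wgt t)%:E <=
   ((4 * r) `^ s * ((e / 2) `^ (- s) / s))%:E)%E.
Proof.
move=> D0 r0 vr /andP[y1 y2] e0; have y0 : 0 < enorm y by exact: lt_le_trans y1.
have a0 : 0 < e / enorm y by exact: divr_gt0.
have b : `|2 * dotv v y| `^ s * ((e / enorm y) `^ (- s) / s) <=
    (4 * r) `^ s * ((e / 2) `^ (- s) / s).
  apply: ler_pM; [exact: powR_ge0|by rewrite divr_ge0 ?powR_ge0// ltW| |].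
    apply: ge0_ler_powR; first exact: ltW.
    - by rewrite nnegrE normr_ge0.
    - by rewrite nnegrE mulr_ge0// ltW.
    rewrite normrM ger0_norm//; have := le_normr_dotv v y.
    have : enorm v * enorm y <= r * 2 by apply: ler_pM; rewrite ?enorm_ge0// ltW.
    by lra.
  rewrite ler_wpM2r ?invr_ge0 ?(ltW s0)//; apply: ler_powR_neg.
  - by rewrite divr_gt0.
  - by rewrite ler_wpM2l ?(ltW e0)// lef_pV2 ?posrE.
  - by rewrite oppr_le0 ltW.
have -> : (\int[leb]_(t in `[(e / enorm y)%R, +oo[) (outerp D v (t *: y) * wgt t)%:E =
  \int[leb]_(t in `[(e / enorm y)%R, +oo[) (lineout s D `|2 * dotv v y| t * wgt t)%:E)%E.
  apply: eq_integral => t; rewrite inE /= in_itv/= andbT => /(lt_le_trans a0) t0.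
  by rewrite outerp_hom.
by apply: (le_trans (integral_lineout_le s01 D0 (normr_ge0 _) a0)); rewrite lee_fin.
Qed.

(** On each ray the inner integral exceeds the outer one by at most a constant independent of z, r
    and x: the chord errors are scale invariant, and the linear comparison costs 1 once e is small.
    Only the threshold for e depends on the depth of x in the ball. *)
Lemma psi_Lop_le : exists2 C, 0 <= C & forall z r x, 0 < r -> enorm (x - z) < r ->
  exists2 e0, 0 < e0 & forall e, 0 < e < e0 -> Lop e (psi z r) x <= C.
Proof.
have ln20 : 0 < ln 2 :> R by rewrite ln_gt0// ltr1n.
have Lam0 := Lam_ge0 kP n0; have k0 := kernel_ge0 kP.
have shfin : mu (@shell R n) \is a fin_num by rewrite ge0_fin_numE ?measure_ge0// mu_shell_fin.
have sh0 : 0 <= fine (mu (@shell R n)) by exact: fine_ge0.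
pose K := 1 + (4 * chord_cst + 4 * chord_cst).
have cc0 : 0 <= chord_cst by rewrite addr_ge0// invr_ge0 ?subr_ge0 ltW.
have K0 : 0 <= K by rewrite /K; lra.
pose C := (ln 2)^-1 * (Lam * K * fine (mu (@shell R n))).
have C0 : 0 <= C by rewrite mulr_ge0 ?invr_ge0 ?(ltW ln20)// !mulr_ge0.
exists (C / 2); first by rewrite divr_ge0.
move=> z r x r0 xr; pose D := r ^+ 2 - enorm (x - z) ^+ 2.
have D0 : 0 < D by rewrite subr_gt0 ltr_pXn2r// nnegrE ?enorm_ge0// ltW.
pose Q := D `^ s * (4 * r / D) ^+ 2 / s.
have rD0 : 0 < 4 * r / D by rewrite divr_gt0// mulr_gt0.
have Q0 : 0 < Q by rewrite /Q divr_gt0// mulr_gt0 ?powR_gt0// exprn_gt0.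
have s22 : 0 < 2 - 2 * s by have := s1; lra.
(* The slope along a ray of the shell is at most 4 r. The first bound keeps e below the zero of the
   tangent; the second makes the error of the linear comparison at most 1. *)
exists (Num.min (D / (4 * r)) (Q^-1 `^ (2 - 2 * s)^-1)).
  by rewrite lt_min divr_gt0 ?mulr_gt0//= powR_gt0// invr_gt0.
move=> e /andP[e0]; rewrite lt_min => /andP[e1 e2].
have eD : 4 * r * e < D by rewrite ltr_pdivlMr ?mulr_gt0// mulrC in e1.
have eQ : D `^ s * ((4 * r / D) ^+ 2 * e `^ (2 - 2 * s)) / s <= 1.
  have -> : D `^ s * ((4 * r / D) ^+ 2 * e `^ (2 - 2 * s)) / s = Q * e `^ (2 - 2 * s).
    by rewrite /Q; ring.
  rewrite mulrC -ler_pdivlMr// div1r.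
  have -> : Q^-1 = Q^-1 `^ (2 - 2 * s)^-1 `^ (2 - 2 * s).
    by rewrite -powRrM mulVf ?gt_eqF// powRr1// invr_ge0 ltW.
  by apply: ge0_ler_powR; rewrite ?nnegrE ?powR_ge0// ltW.
pose v := x - z.
have mI : measurable_fun setT (innerp D v : _ -> measurableTypeR R) by exact: measurable_innerp.
have mO : measurable_fun setT (outerp D v : _ -> measurableTypeR R) by exact: measurable_outerp.
have I0 y : 0 <= innerp D v y by exact: (innerp_ge0 kP).
have O0 y : 0 <= outerp D v y by exact: (outerp_ge0 kP).
have pI := far_polar kP e0 mI I0; have pO := far_polar kP e0 mO O0.
have mpI := measurable_far_polar kP e0 mI I0; have mpO := measurable_far_polar kP e0 mO O0.
set JI := (\int[mu]_(y in far e) (innerp D v y * k y)%:E)%E in pI.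
set JO := (\int[mu]_(y in far e) (outerp D v y * k y)%:E)%E in pO.
have msh := @measurable_shell R n.
have ray0 (G : 'rV[R]_n -> R) y : (forall y, 0 <= G y) -> (0 <= \int[leb]_(t in `[(e / enorm y)%R, +oo[)
    (G (t *: y) * wgt t)%:E)%E.
  by move=> G0; apply: integral_ge0 => t _; rewrite lee_fin mulr_ge0 ?powR_ge0.
have IO : ((ln 2)%:E * JI <= (ln 2)%:E * JO + (Lam * K * fine (mu (@shell R n)))%:E)%E.
  rewrite pI pO.
  have -> : ((Lam * K * fine (mu (@shell R n)))%:E = \int[mu]_(y in @shell R n) (Lam * K)%:E)%E.
    by rewrite integral_cst// EFinM fineK.
  rewrite -ge0_integralD//; last 2 first.
  - by move=> y _; rewrite mule_ge0 ?lee_fin//; exact: ray0.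
  - by move=> y _; rewrite lee_fin mulr_ge0.
  apply: ge0_le_integral => //.
  - by move=> y _; rewrite mule_ge0 ?lee_fin//; exact: ray0.
  - by apply: emeasurable_funD.
  - move=> y ys.
    apply: (le_trans (lee_wpmul2l _ (ray_le D0 r0 xr ys e0 eD eQ))); first by rewrite lee_fin.
    rewrite muleDr//; last by rewrite ge0_adde_def// inE ?ray0 ?lee_fin.
    rewrite leeD2l// -EFinM lee_fin ler_wpM2r//.
    exact: (kernel_shell_le kP).
have JO0 : (0 <= JO)%E by apply: integral_ge0 => y _; rewrite lee_fin mulr_ge0.
have JI0 : (0 <= JI)%E by apply: integral_ge0 => y _; rewrite lee_fin mulr_ge0.
have e20 : 0 < e / 2 by exact: divr_gt0.
(* Finiteness of [JO], and then of [JI], is what allows the integral of second differences to be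
   split into a difference of the two. *)
have JOfin : JO \is a fin_num.
  rewrite ge0_fin_numE//.
  suff : ((ln 2)%:E * JO < +oo)%E.
    move=> h; have [//|] := ltP JO +oo%E.
    by rewrite leye_eq => /eqP Ioo; rewrite Ioo gt0_muley ?lte_fin// ltxx in h.
  rewrite pO; apply: (@le_lt_trans _ _ (\int[mu]_(y in @shell R n)
    (Lam * ((4 * r) `^ s * ((e / 2) `^ (- s) / s)))%:E))%E; last first.
    rewrite integral_cst// lte_mul_pinfty ?mu_shell_fin// lee_fin.
    by rewrite !mulr_ge0 ?powR_ge0// ?invr_ge0 ltW.
  apply: ge0_le_integral => //.
  - by move=> y _; rewrite mule_ge0 ?lee_fin//; exact: ray0.
  - move=> y ys; rewrite EFinM; apply: lee_pmul; rewrite ?lee_fin//; first exact: ray0.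
      exact: (kernel_shell_le kP).
    exact: out_ray_le.
have JIfin : JI \is a fin_num.
  rewrite ge0_fin_numE//; have [//|] := ltP JI +oo%E.
  rewrite leye_eq => /eqP Ioo; move: IO; rewrite Ioo gt0_muley ?lte_fin//.
  by rewrite -(fineK JOfin) -EFinM -EFinD leye_eq.
have Cle : fine JI <= fine JO + C.
  move: IO; rewrite -(fineK JOfin) -(fineK JIfin) -!EFinM -EFinD lee_fin => h.
  by rewrite -(ler_pM2l ln20) mulrDr /C mulrA divff ?gt_eqF// mul1r.
have mk := kernel_measurable kP; have mfar := @measurable_far R n e.
have integ (G : 'rV[R]_n -> R) : measurable_fun setT (G : _ -> measurableTypeR R) -> (forall y, 0 <= G y) ->
    (\int[mu]_(y in far e) (G y * k y)%:E)%E \is a fin_num ->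
    mu.-integrable (far e) (EFin \o (fun y => G y * k y)).
  move=> mG G0 Gf; apply/integrableP; split.
    by apply/measurable_EFinP; apply: measurable_funTS; exact: measurable_funM.
  have G0' : (0 <= \int[mu]_(y in far e) (G y * k y)%:E)%E.
    by apply: integral_ge0 => y _; rewrite lee_fin mulr_ge0.
  rewrite ge0_fin_numE// in Gf; apply: le_lt_trans Gf.
  rewrite le_eqVlt; apply/orP; left; apply/eqP; apply: eq_integral => y _.
  by rewrite /= ger0_norm// mulr_ge0.
rewrite -(@ler_pM2l _ 2)// (Lop_diff2 kP n0)//; last 2 first.
- exact: (psi_bmeas kP).
- by move=> y; exact: psi_ge0.
have -> : 2 * (C / 2) = C by field.
have -> : \int[mu]_(y in far e) (diff2 (psi z r) x y * k y) =
    \int[mu]_(y in far e) (innerp D v y * k y) - \int[mu]_(y in far e) (outerp D v y * k y).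
  rewrite -RintegralB//; [|exact: integ|exact: integ].
  apply: eq_Rintegral => y _; rewrite -mulrBl; congr (_ * _).
  by rewrite -(psi_diff2 _ D0) addrK.
by rewrite lerBlDl.
Qed.
End barrier_bound.

(** * Comparison principle *)

Section sublevel.
Context {R : realType} {n : nat} {s lam Lam : R} {k : 'rV[R]_n -> R}.
Hypothesis kP : kernel_spec s lam Lam k.
Hypothesis n0 : (0 < n)%N.
Local Notation mu := (lebesgue_rV R n).
Local Notation Lop := (@Lop R n k).

Lemma continuous_cvg_seq (v : 'rV[R]_n -> R) (x_ : nat -> 'rV[R]_n) x :
  continuous v -> (forall i, enorm (x_ i - x) < i.+1%:R^-1) ->
  v (x_ i) @[i --> \oo] --> v x.
Proof.
move=> cv xx; apply/cvgrPdist_lt => d d0.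
have : \forall y \near x, `|v x - v y| < d.
  by have := cv x; move=> /cvgrPdist_lt/(_ _ d0).
move=> /nbhs_eballP[r r0 rv].
have := near_infty_natSinv_lt (PosNum r0); apply: filterS => i /= ir.
by apply: rv; rewrite eballE (lt_trans (xx i)).
Qed.

Lemma Lop_cvg_seq e (v : 'rV[R]_n -> R) (x_ : nat -> 'rV[R]_n) x : 0 < e ->
  continuous v -> bmeas v -> (forall i, enorm (x_ i - x) < i.+1%:R^-1) ->
  Lop e v (x_ i) @[i --> \oo] --> Lop e v x.
Proof.
move=> e0 cv bv xx; have vx := continuous_cvg_seq cv xx.
have [mv [M vM]] := bv; have mk := kernel_measurable kP.
have -> : (fun i => Lop e v (x_ i)) =
    (fun i => mass (k := k) e * v (x_ i) - jconv (k := k) e v (x_ i)).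
  by apply/funext => i; rewrite (LopE kP n0).
rewrite (LopE kP n0)//; apply: cvgB; first by apply: cvgM => //; exact: cvg_cst.
apply: fine_cvg; rewrite (conv_EFin kP n0)//.
have mf z : measurable_fun (far e) (fun y => (v (z + y) * k y)%:E).
  apply/measurable_EFinP; apply: measurable_funTS; apply: measurable_funM => //.
  exact: measurable_addl.
have ig : mu.-integrable (far e) (EFin \o (fun y => M * k y)).
  exact: (integrable_bmeas kP n0 e0 (bmeas_cst M)).
have cvy y : far e y -> (v (x_ i + y) * k y)%:E @[i --> \oo] --> (v (x + y) * k y)%:E.
  move=> _; apply: cvg_EFin; first exact: nearW.
  apply: cvgM; last exact: cvg_cst.
  apply: continuous_cvg_seq => // i; rewrite opprD addrACA subrr addr0.
  exact: xx.
have dom i y : far e y -> (`|(v (x_ i + y) * k y)%:E| <= (M * k y)%:E)%E.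
  move=> _; rewrite /= lee_fin normrM (ger0_norm (kernel_ge0 kP _)).
  by rewrite ler_wpM2r// (kernel_ge0 kP).
by have [_ _] := dominated_convergence (@measurable_far R n e)
  (fun i => mf (x_ i)) (mf x) (aeW _ cvy) ig (aeW _ (fun y i => dom i y)).
Qed.

(** For each fixed e > 0 the truncated operator is continuous in x by dominated convergence. The set
    is an intersection of such sublevels, hence closed, although the limit as e tends to 0 need not
    be continuous. *)
Lemma closed_Lop_le (v : 'rV[R]_n -> R) (D : set 'rV[R]_n) c a :
  closed D -> continuous v -> bmeas v ->
  closed (D `&` [set x | forall e, 0 < e < c -> Lop e v x <= a]).
Proof.
move=> cD cv bv x cx.
have /choice[x_ x_P] : forall i : nat, exists y, eball x i.+1%:R^-1 y /\
    (D y /\ forall e, 0 < e < c -> Lop e v y <= a).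
  move=> i; have [|y [Dy xy]] := cx (eball x i.+1%:R^-1).
    by apply/nbhs_eballP; exists i.+1%:R^-1 => //; rewrite invr_gt0.
  by exists y.
split; first by apply: cD => B /cx[y [[Dy _] By]]; exists y.
move=> e /andP[e0 ec]; have h := Lop_cvg_seq e0 cv bv (fun i => (x_P i).1).
apply: (cvgr_to_le h); apply: nearW => i; apply: (x_P i).2.2.
by rewrite e0.
Qed.

End sublevel.

Section comparison.
Context {R : realType} {n : nat} {s lam Lam : R} {k : 'rV[R]_n -> R}.
Hypothesis kP : kernel_spec s lam Lam k.
Hypothesis n0 : (0 < n)%N.
Local Notation mu := (lebesgue_rV R n).
Local Notation Lop := (@Lop R n k).
Local Notation mass := (@mass R n k).
Local Notation psi := (@psi R n s).
Local Notation gam := (n%:R + 2 * s).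

Let s01 := kernel_s kP.
Let s0 : 0 < s. Proof. by case/andP: s01. Qed.
Let s1 : s < 1. Proof. by case/andP: s01. Qed.

Lemma bmeas_indic (A : set 'rV[R]_n) : measurable A -> bmeas (\1_A : 'rV[R]_n -> R).
Proof.
move=> mA; split; first exact: measurable_indic.
by exists 1 => x; rewrite indicE; case: (_ \in _); rewrite ?normr1 ?normr0.
Qed.

Lemma Rintegral_indic_far d e : 0 < e <= d ->
  \int[mu]_(y in far e) (\1_(far d) y * k y) = mass d.
Proof.
move=> /andP[e0 ed]; rewrite /mass /Rintegral; congr fine.
rewrite integral_mkcond [RHS]integral_mkcond; apply: eq_integral => y _.
rewrite !patchE indicE; case: ifPn => [|/negP ye].
  by rewrite inE farE => _; case: (_ \in _); rewrite ?mul1r ?mul0r.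
rewrite ifN//; apply/negP => yd; apply: ye; move: yd; rewrite !inE !farE.
exact: le_trans.
Qed.

Lemma ge_Rintegral_indic (P : set 'rV[R]_n) e c : 0 < e -> measurable P ->
  P `<=` far e -> 0 <= c -> (forall y, P y -> c <= k y) ->
  ((c%:E * mu P) <= (\int[mu]_(y in far e) (\1_P y * k y))%:E)%E.
Proof.
move=> e0 mP Pfar c0 ck; rewrite /Rintegral fineK; last first.
  exact: (integrable_fin_num (measurable_far e) (integrable_bmeas kP n0 e0 (bmeas_indic mP))).
have -> : (c%:E * mu P = \int[mu]_(y in far e) (c * \1_P y)%:E)%E.
  rewrite ge0_integralZlR//.
  - by rewrite integral_indic//; [rewrite setIidl|exact: measurable_far].
  - exact: measurable_far.
apply: ge0_le_integral; first exact: measurable_far.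
- by move=> y _; rewrite lee_fin mulr_ge0// indicE.
- by apply/measurable_EFinP; apply: measurable_funTS; exact: (bmeasZ c (bmeas_indic mP)).1.
- apply/measurable_EFinP; apply: measurable_funTS; apply: measurable_funM.
    exact: measurable_indic.
  exact: kernel_measurable kP.
- move=> y _; rewrite lee_fin mulrC indicE.
  by case: (boolP (y \in P)) => [/[!inE]/ck|_]; rewrite ?mul0r// !mul1r.
Qed.

(* At a minimum of [w] the operator is nonpositive up to far away
   contributions, and the ball where [w] is large pushes it further down. *)
Lemma Lop_at_min (w : 'rV[R]_n -> R) (x z : 'rV[R]_n) B K d r e :
  bmeas w -> 0 <= B -> 0 <= K -> 0 < r -> 0 < e -> e <= d -> e <= r / 4 ->
  (forall y, enorm y < d -> w x <= w (x + y)) ->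
  (forall y, w x - w (x + y) <= B) ->
  (forall y, eball z (r / 4) (x + y) -> w x - w (x + y) <= - K) ->
  r / 2 <= enorm (x - z) <= 6 * r ->
  Lop e w x <= B * mass d -
    K * (lam * (7 * r) `^ (- gam) * ((r / 4) ^+ n * fine (mu (eball 0 1)))).
Proof.
move=> bw B0 K0 r0 e0 ed er wd wB wP /andP[xz1 xz2].
pose P : set 'rV[R]_n := eball (z - x) (r / 4).
have mP : measurable P by exact: measurable_eball.
have PE y : P y -> eball z (r / 4) (x + y).
  by rewrite /P !eballE opprB addrA (addrC y).
(* The point x is between r/2 and 6 r away from z, and x + y is within r/4 of z. *)
have Py y : P y -> r / 4 <= enorm y <= 7 * r.
  move=> /PE; rewrite eballE => h.
  have t1 : enorm (x - z) <= enorm (x + y - z) + enorm y.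
    have := ler_enormB (x + y - z) y.
    have := ler_enormD (x + y - z) (- y); rewrite enormN addrAC addrK; lra.
  have t2 : enorm y <= enorm (x + y - z) + enorm (x - z).
    have := ler_enormD (x + y - z) (- (x - z)); rewrite enormN.
    by rewrite (_ : x + y - z - (x - z) = y)// opprB addrA subrK addrAC subrr add0r.
  by lra.
have Pfar : P `<=` far e by move=> y /Py /andP[h _]; rewrite farE (le_trans er).
have c0 : 0 <= lam * (7 * r) `^ (- gam) by rewrite mulr_ge0 ?powR_ge0// ltW// (kernel_lam kP).
have ck y : P y -> lam * (7 * r) `^ (- gam) <= k y.
  move=> /Py/andP[y1 y2]; apply: le_trans (kernel_ge kP y).
  rewrite ler_wpM2l ?(ltW (kernel_lam kP))//; apply: ler_powR_neg => //.
    by apply: lt_le_trans y1; rewrite divr_gt0.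
  by rewrite oppr_le0 ltW// (gam_gt0 kP).
have := ge_Rintegral_indic e0 mP Pfar c0 ck.
have r40 : 0 < r / 4 by exact: divr_gt0.
rewrite {1}/P (lebesgue_rV_eball _ r40).
rewrite -[X in (_ * (_ * X))%E]fineK; last first.
  by rewrite ge0_fin_numE ?measure_ge0// lebesgue_rV_eball_lty.
rewrite -!EFinM lee_fin => hP.
have bP := bmeas_indic mP; have bF := @bmeas_indic (far d) (measurable_far d).
have bdiff : bmeas (fun y => B * \1_(far d) y - K * \1_P y).
  by apply: bmeasB; exact: bmeasZ.
(* Jumps shorter than [d] contribute at most 0, longer ones at most [B], and those landing in the
   small ball at most -[K], which is below B - K when the jump is also long. *)
have ub : Lop e w x <= \int[mu]_(y in far e) ((B * \1_(far d) y - K * \1_P y) * k y).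
  apply: le_Rintegral; first exact: measurable_far.
  - exact: (integrable_bmeas kP n0 e0 (bmeasB (bmeas_cst (w x)) (bmeas_shift x bw))).
  - exact: (integrable_bmeas kP n0 e0 bdiff).
  - move=> y _; rewrite ler_wpM2r ?(kernel_ge0 kP)// !indicE.
    have [yP|yP] := boolP (y \in P).
      rewrite mulr1; rewrite inE in yP; have := wP _ (PE _ yP).
      by case: (_ \in _); rewrite ?mulr1 ?mulr0; lra.
    rewrite mulr0 subr0; have [yd|yd] := boolP (y \in far d); rewrite ?mulr1 ?mulr0//.
    rewrite subr_le0; apply: wd; rewrite ltNge; apply/negP => yd'; move/negP: yd; apply.
    by rewrite inE farE.
apply: (le_trans ub).
have -> : \int[mu]_(y in far e) ((B * \1_(far d) y - K * \1_P y) * k y) =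
    B * mass d - K * \int[mu]_(y in far e) (\1_P y * k y).
  rewrite -(Rintegral_indic_far (d := d) (e := e)) ?e0//.
  have i1 := integrable_bmeas kP n0 e0 bF; have i2 := integrable_bmeas kP n0 e0 bP.
  have mf := @measurable_far R n e.
  have i3 := integrable_bmeas kP n0 e0 (bmeasZ B bF).
  have i4 := integrable_bmeas kP n0 e0 (bmeasZ K bP).
  rewrite -(RintegralZl B mf i1) -(RintegralZl K mf i2).
  under [in RHS]eq_Rintegral do rewrite mulrA.
  under [X in _ - X]eq_Rintegral do rewrite mulrA.
  rewrite -(RintegralB mf i3 i4).
  by apply: eq_Rintegral => y _; rewrite -mulrBl.
by rewrite lerD2l lerN2 ler_wpM2l.
Qed.

End comparison.

Lemma near_right0P (R : realType) (P : R -> Prop) :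
  (\forall e \near 0^'+, P e) <-> exists2 d, 0 < d & forall e, 0 < e < d -> P e.
Proof.
split=> [/nbhs_ballP[d d0 h]|[d d0 h]].
  exists d => // e /andP[e0 ed]; apply: h => //=.
  by rewrite /ball/= sub0r normrN gtr0_norm.
apply/nbhs_ballP; exists d => // e; rewrite /ball/= sub0r normrN => ed e0.
by apply: h; rewrite e0/= (le_lt_trans (ler_norm _)).
Qed.

Section comparison_principle.
Context {R : realType} {n : nat} {s lam Lam : R} {k : 'rV[R]_n -> R}.
Hypothesis kP : kernel_spec s lam Lam k.
Hypothesis n0 : (0 < n)%N.
Local Notation mu := (lebesgue_rV R n).
Local Notation Lop := (@Lop R n k).
Local Notation mass := (@mass R n k).
Local Notation psi := (@psi R n s).
Local Notation gam := (n%:R + 2 * s).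

Let s01 := kernel_s kP.
Let s0 : 0 < s. Proof. by case/andP: s01. Qed.
Let s1 : s < 1. Proof. by case/andP: s01. Qed.

Variables (v : 'rV[R]_n -> R) (G N0 : set 'rV[R]_n) (x0 : 'rV[R]_n).
Variables (rho B M : R).
Hypothesis cv : continuous v.
Hypothesis vB : forall x, `|v x| <= B.
Hypothesis Gcvg : forall x, G x -> cvg (Lop e v x @[e --> 0^'+]).
Hypothesis GM : forall x, G x -> ~ N0 x -> \forall e \near 0^'+, - M <= Lop e v x.
Hypothesis mN0 : measurable N0.
Hypothesis N0null : mu N0 = 0%E.
Hypothesis rho0 : 0 < rho.
Hypothesis v0 : forall x, eball x0 rho x -> 0 <= v x.

Let bv : bmeas v.
Proof. by split; [exact: continuous_measurable_rV|exists B]. Qed.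

(* At [x] either the truncated operators of [v] stay above [- M - 2], or [x] is
   in the exceptional sets and the potential [p] compensates. *)
Let potential_compensates (D : set 'rV[R]_n) (tau : R) : compact D -> D `<=` G -> 0 < tau ->
  exists p : 'rV[R]_n -> R, [/\ continuous p, (forall x, 0 <= p x <= tau) &
    forall x d, D x -> 0 < d -> exists2 e, 0 < e < d & - M - 3 <= Lop e v x + Lop e p x].
Proof.
move=> cD DG tau0.
(* These sets increase with j, and a point of [D] where the limit is below - M - 1 lies in all of
   them from some index on. Each is closed by continuity at fixed e, and null because [GM] excludes
   it off [N0]. *)
pose E (j : nat) := D `&` [set x | forall e, 0 < e < j.+1%:R^-1 -> Lop e v x <= - M - 1].
have clD : closed D by apply: compact_closed => //; exact: norm_hausdorff.
have clE j : closed (E j) by exact: (closed_Lop_le kP n0).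
have cE j : compact (E j).
  by apply: (subclosed_compact (clE j) cD) => x [].
have nE j : mu (E j) = 0%E.
  apply/eqP; rewrite -measure_le0 -N0null; apply: le_measure; rewrite ?inE//.
    by apply: measurable_closed_rV; exact: clE.
  move=> x [Dx Ex]; apply: contrapT => N0x.
  have /near_right0P[d d0 h] := GM (DG _ Dx) N0x.
  have j0 : 0 < j.+1%:R^-1 :> R by rewrite invr_gt0.
  pose e := Num.min d j.+1%:R^-1 / 2.
  have m0 : 0 < Num.min d j.+1%:R^-1 by rewrite lt_min d0.
  have e0 : 0 < e by rewrite divr_gt0.
  have em : e < Num.min d j.+1%:R^-1 by rewrite /e; lra.
  move: (em); rewrite lt_min => /andP[ed ej].
  have := h e; have := Ex e; rewrite e0 ed ej => /(_ isT) h1 /(_ isT) h2; lra.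
have [p [e_ [cp pt eb pL pB]]] := sum_potential kP n0 cE nE tau0.
exists p; split=> // x d Dx d0.
have /near_right0P[d1 d10 hl] : \forall e \near 0^'+, `|lim (Lop e v x @[e --> 0^'+]) - Lop e v x| < 1.
  by have /cvgrPdist_lt := Gcvg (DG _ Dx); exact.
set l := lim _ in hl.
pose d2 := Num.min d d1; have d20 : 0 < d2 by rewrite lt_min d0.
have [J hJ] : exists J, forall j, (J <= j)%N -> j.+1%:R^-1 < d2.
  by have [J _ hJ] := near_infty_natSinv_lt (PosNum d20); exists J => j Jj; exact: (hJ j).
have ej j : (J <= j)%N -> [/\ 0 < e_ j, e_ j < d & e_ j < d1].
  move=> /hJ jd; have /andP[e0 e1] := eb j.
  by have := le_lt_trans e1 jd; rewrite lt_min => /andP[].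
have hlj j : (J <= j)%N -> l - 1 <= Lop (e_ j) v x /\ Lop (e_ j) v x <= l + 1.
  move=> /ej[h1 h2 h3]; have := hl (e_ j); rewrite h1 h3 => /(_ isT).
  by rewrite ltr_norml => /andP[]; lra.
(* If the limit is at least - M - 1, then L_e v >= - M - 2 for small e and the lower bound -1 on the
   potential suffices. Otherwise the potential blows up at x, while L_e v stays above l - 1. *)
have [lM|lM] := leP (- M - 1) l.
  have [h1 h2 h3] := ej J (leqnn J); exists (e_ J); first by rewrite h1.
  by have [h4 _] := hlj J (leqnn J); have := pL J x; lra.
have [m hm] : exists m, forall j, (m <= j)%N -> E j x.
  have l0 : 0 < - M - 1 - l by lra.
  have /near_right0P[d3 d30 hl3] : \forall e \near 0^'+, `|l - Lop e v x| < - M - 1 - l.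
    by have /cvgrPdist_lt := Gcvg (DG _ Dx); exact.
  have [m _ hm] := near_infty_natSinv_lt (PosNum d30); exists m => j mj; split=> // e /andP[e0 e1].
  have := hl3 e; rewrite e0 (lt_trans e1 (hm j mj)) => /(_ isT).
  by rewrite ltr_norml => /andP[]; lra.
have [J2 hJ2] := pB x m (- M - 3 - (l - 1)) hm.
pose j := maxn J J2; have Jj : (J <= j)%N by exact: leq_maxl.
have [h1 h2 h3] := ej j Jj; exists (e_ j); first by rewrite h1.
have [h4 _] := hlj j Jj; have := hJ2 j (leq_maxr _ _); lra.
Qed.

(** If [v] drops below A psi at [x1], then v - A psi + p has a negative minimum over the closed
    ball. At one common truncation its operator is bounded below by [potential_compensates] and the
    barrier bound, and above by [Lop_at_min]. *)
Let touching_below z r z' K A C x1 : 0 < r -> eball z r `<=` G ->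
  enorm (z - x0) + r <= rho / 2 -> enorm (z - z') <= 5 * r ->
  (forall y, eball z' (r / 2) y -> K <= v y) -> 0 < K -> 0 < A ->
  A * r `^ (2 * s) <= K / 2 ->
  (forall x, enorm (x - z) < r -> exists2 e0, 0 < e0 &
    forall e, 0 < e < e0 -> Lop e (psi z r) x <= C) ->
  eball z r x1 -> v x1 < A * psi z r x1 ->
  - M - 3 - A * C <= B * mass (rho / 2) -
    K / 2 * (lam * (7 * r) `^ (- gam) * ((r / 4) ^+ n * fine (mu (eball 0 1)))).
Proof.
move=> r0 BG zr zz' zK K0 A0 AK hC x1z x1lt.
have B0 : 0 <= B by apply: le_trans (vB 0).
pose phi x := A * psi z r x.
pose dl := phi x1 - v x1; have dl0 : 0 < dl by rewrite subr_gt0.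
have aux1 (a b c d : R) : a - b + c <= - d -> 0 <= a -> 0 <= c -> d <= b by move=> *; lra.
have aux2 (a b c d : R) : d <= a -> b <= d / 2 -> 0 <= c -> d / 2 <= a - b + c by move=> *; lra.
have aux3 (a b : R) : a <= rho / 2 -> b < rho / 2 -> a + b < rho by move=> *; lra.
have aux4 (a b c : R) : a <= 0 -> - B <= b -> 0 <= c -> a - (b + c) <= B by move=> *; lra.
have aux5 (a b c d : R) : a - b + c <= d -> b <= C * A -> - M - 3 <= a + c ->
  - M - 3 - A * C <= d by move=> *; lra.
have rho2 : rho / 2 < rho by have := rho0; lra.
have r42 : r / 4 <= r / 2 by lra.
have r6 : r + 5 * r <= 6 * r by lra.
have phiK x : phi x <= K / 2.
  apply: le_trans AK; rewrite /phi ler_wpM2l ?(ltW A0)//.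
  by rewrite powRrM powR_mulrn ?(ltW r0)//; exact: (psi_le kP).
have cphi : continuous phi.
  move=> x; have FF : Filter (nbhs x) by exact: nbhs_filter.
  by apply: cvgM; [exact: cvg_cst|exact: (psi_continuous kP)].
have psi0 x : r <= enorm (x - z) -> psi z r x = 0 by exact: (psi_out kP).
pose D := [set x | dl / 2 <= phi x].
have Dball : D `<=` eball z r.
  move=> x Dx; rewrite eballE ltNge; apply/negP => /psi0 h.
  by move: Dx; rewrite /D /= /phi h mulr0 leNgt divr_gt0.
have cD : compact D.
  have clD : closed D.
    have /continuous_closedP h := cphi; apply: (h [set t | dl / 2 <= t]).
    exact: closed_ge.
  apply: (subclosed_compact clD (@ecball_compact R n z r)) => x /Dball.
  by rewrite eballE => /ltW.
have dl20 : 0 < dl / 2 by exact: divr_gt0.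
have [p [cp pt pcomp]] := potential_compensates cD (subset_trans Dball BG) dl20.
have p0 x : 0 <= p x by case/andP: (pt x).
pose w x := v x + - A * psi z r x + p x.
have cw : continuous w.
  move=> x; have FF : Filter (nbhs x) by exact: nbhs_filter.
  apply: cvgD; last exact: cp.
  apply: cvgD; first exact: cv.
  by apply: cvgM; [exact: cvg_cst|exact: (psi_continuous kP)].
have [xs xsr xsmin] : exists2 xs, enorm (xs - z) <= r &
    forall y, enorm (y - z) <= r -> w xs <= w y.
  have [|xs xsin xsmin] := @compact_EVT_min _ _ w [set x | enorm (x - z) <= r] _
    (@ecball_compact R n z r) (continuous_subspaceT cw).
    by exists z; rewrite /= subrr enorm0 ltW.
  exists xs; first by move: xsin; rewrite inE.
  by move=> y yr; apply: xsmin; rewrite inE.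
have wxs : w xs <= - (dl / 2).
  apply: (le_trans (xsmin x1 (ltW x1z))).
  have -> : w x1 = p x1 - dl by rewrite /w /dl /phi; ring.
  have /andP[_ px1] := pt x1; rewrite lerBlDl (le_trans px1)//.
  by rewrite -{2}(subrK (dl / 2) dl) -[in leRHS]addrA subrr addr0; lra.
have wxs0 : w xs < 0 by apply: le_lt_trans wxs _; rewrite oppr_lt0.
have near0 y : enorm (y - z) <= r -> enorm (y - x0) <= rho / 2.
  move=> h; apply: le_trans zr; rewrite [leRHS]addrC -(subrKA z y (- x0)).
  by apply: (le_trans (ler_enormD _ _)); rewrite lerD2r.
have near0' y : enorm (y - z) <= r -> eball x0 rho y.
  by move=> /near0 h; rewrite eballE (le_lt_trans h).
have Dxs : D xs.
  rewrite /w mulNr in wxs.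
  exact: aux1 wxs (v0 (near0' _ xsr)) (p0 xs).
have xsb : enorm (xs - z) < r by exact: Dball.
have wge0 y : r <= enorm (y - z) -> eball x0 rho y -> 0 <= w y.
  by move=> h /v0 vy; rewrite /w (psi0 _ h) mulr0 addr0 addr_ge0.
have wK y : eball z' (r / 2) y -> K / 2 <= w y.
  by move=> /zK vy; rewrite /w mulNr; exact: aux2 vy (phiK y) (p0 y).
have [e0 e00 hbar] := hC xs xsb.
(* One truncation below all thresholds: [e0] for the barrier at the minimum, rho/2 for the range
   where the minimum property holds, and r/4 so that no jump into the pushing ball is cut off. *)
pose d := Num.min (Num.min e0 (rho / 2)) (r / 4).
have d0 : 0 < d by rewrite !lt_min e00 !divr_gt0.
have [e /andP[e_gt0 ed] he] := pcomp xs d Dxs d0.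
move: ed; rewrite !lt_min -andbA => /and3P[ee0 erho er].
(* In the ball of radius r/2 about z' one has w >= K / 2, so the negative minimum cannot lie
   there. *)
have xz1 : r / 2 <= enorm (xs - z').
  rewrite leNgt; apply/negP => /wK/le_lt_trans/(_ wxs0).
  by rewrite ltNge divr_ge0// ltW.
have xz2 : enorm (xs - z') <= 6 * r.
  rewrite -(subrKA z xs (- z')); apply: (le_trans (ler_enormD _ _)).
  by apply: le_trans r6; rewrite lerD.
(* A jump shorter than rho/2 stays in the ball about x0 where [v] is nonnegative; if it leaves the
   small ball, the barrier vanishes and w >= 0 there. *)
have wd y : enorm y < rho / 2 -> w xs <= w (xs + y).
  move=> yr; have [|h] := leP (enorm (xs + y - z)) r; first exact: xsmin.
  apply: (@le_trans _ _ 0); first exact: ltW.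
  apply: wge0; first exact: ltW.
  rewrite eballE addrAC; apply: (le_lt_trans (ler_enormD _ _)).
  exact: aux3 (near0 _ xsr) yr.
have wB y : w xs - w (xs + y) <= B.
  have [/xsmin h|h] := leP (enorm (xs + y - z)) r.
    by apply: le_trans B0; rewrite subr_le0.
  have -> : w (xs + y) = v (xs + y) + p (xs + y).
    by rewrite /w psi0 ?mulr0 ?addr0// ltW.
  have := vB (xs + y); rewrite ler_norml => /andP[vl _].
  exact: aux4 (ltW wxs0) vl (p0 _).
have wP y : eball z' (r / 4) (xs + y) -> w xs - w (xs + y) <= - (K / 2).
  rewrite eballE => h; have := wK (xs + y); rewrite eballE => /(_ (lt_le_trans h r42)) wy.
  by rewrite -(add0r (- (K / 2))) lerD ?(ltW wxs0)// lerN2.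
have bpsi : bmeas (psi z r) by exact: (psi_bmeas kP).
have bp : bmeas p by exact: continuous_bmeas pt.
have bvp : bmeas (fun x => v x + - A * psi z r x) by apply: bmeasD => //; exact: bmeasZ.
have bw : bmeas w by exact: bmeasD.
have K20 : 0 <= K / 2 by rewrite divr_ge0// ltW.
have xz12 : r / 2 <= enorm (xs - z') <= 6 * r by rewrite xz1.
have ub := Lop_at_min kP n0 bw B0 K20 r0 e_gt0 (ltW erho) (ltW er) wd wB wP xz12.
have eqL : Lop e w xs = Lop e v xs + - A * Lop e (psi z r) xs + Lop e p xs.
  rewrite (LopD kP n0 _ e_gt0 bvp bp) (LopD kP n0 _ e_gt0 bv (bmeasZ (- A) bpsi)).
  by rewrite (LopZ kP n0 _ _ e_gt0 bpsi).
have hb : Lop e (psi z r) xs <= C by apply: hbar; rewrite e_gt0.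
rewrite eqL mulNr in ub; apply: (aux5 _ _ _ _ ub _ he).
by rewrite mulrC ler_wpM2r// ltW.
Qed.

(** With T = K / r^(2s) the push equals c2 T, the powers of r cancelling by homogeneity. The choice
    of [th] gives A r^(2s) <= K / 2 and lets the barrier use at most half of the push; T >= Cst
    makes the other half exceed the bounded terms. *)
Lemma comparison : exists C th, [/\ 0 < C, 0 < th &
  forall z r z' K, 0 < r -> eball z r `<=` G -> enorm (z - x0) + r <= rho / 2 ->
  enorm (z - z') <= 5 * r -> (forall y, eball z' (r / 2) y -> K <= v y) ->
  C <= K / r `^ (2 * s) ->
  forall x, eball z r x -> th * (K / r `^ (2 * s)) * psi z r x <= v x].
Proof.
have [C C0 hC] := psi_Lop_le kP n0.
have B0 : 0 <= B by apply: le_trans (vB 0).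
pose om := fine (mu (eball 0 1)).
have om0 : 0 < om by rewrite fine_gt0// lebesgue_rV_eball_gt0//= lebesgue_rV_eball_lty.
pose c2 := lam * 7 `^ (- gam) * (4^-1 ^+ n * om) / 2.
have c20 : 0 < c2.
  by rewrite divr_gt0// !mulr_gt0 ?powR_gt0 ?(kernel_lam kP)// exprn_gt0// invr_gt0.
pose kap := mass (rho / 2); have kap0 : 0 <= kap by exact: (mass_ge0 kP).
pose th := Num.min 2^-1 (c2 / (2 * (C + 1))).
have C1 : 0 < 2 * (C + 1) by lra.
have th0 : 0 < th by rewrite lt_min invr_gt0 ltr0n divr_gt0.
have th2 : th <= 2^-1 by rewrite ge_min lexx.
have thC : th * C <= c2 / 2.
  have : th <= c2 / (2 * (C + 1)) by rewrite ge_min lexx orbT.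
  by rewrite ler_pdivlMr//; have := ltW th0; nra.
pose Cst := 2 * (B * kap + `|M| + 4) / c2.
have BK0 : 0 <= B * kap by exact: mulr_ge0.
have Cst0 : 0 < Cst by rewrite divr_gt0//; have := normr_ge0 M; lra.
exists Cst, th; split=> // z r z' K r0 BG zr zz' zK KC x1 x1z.
rewrite leNgt; apply/negP => x1lt.
pose T := K / r `^ (2 * s).
have rs0 : 0 < r `^ (2 * s) by exact: powR_gt0.
have T0 : 0 < T by exact: lt_le_trans KC.
have KT : K = T * r `^ (2 * s) by rewrite /T divfK// gt_eqF.
have K0 : 0 < K by rewrite KT mulr_gt0.
pose A := th * T; have A0 : 0 < A by exact: mulr_gt0.
have AK : A * r `^ (2 * s) <= K / 2.
  by rewrite /A -mulrA -KT mulrC ler_wpM2l// ltW.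
have ub := touching_below r0 BG zr zz' zK K0 A0 AK (fun x => hC z r x r0) x1z x1lt.
have rr : r `^ (2 * s) * r `^ (- gam) * r ^+ n = 1.
  rewrite -powR_mulrn ?(ltW r0)// -!powRDp//.
  by rewrite (_ : 2 * s + - gam + n%:R = 0) ?powRr0//; ring.
have push : K / 2 * (lam * (7 * r) `^ (- gam) * ((r / 4) ^+ n * om)) = c2 * T.
  rewrite powRM ?(ltW r0)// exprMn KT /c2.
  transitivity (r `^ (2 * s) * r `^ (- gam) * r ^+ n *
    (T * lam * 7 `^ (- gam) * (4^-1 ^+ n * om) / 2)); first by ring.
  by rewrite rr; ring.
rewrite push -/kap in ub.
have AC : A * C <= c2 / 2 * T by rewrite /A mulrAC ler_wpM2r// ltW.
have KC' : B * kap + `|M| + 4 <= c2 / 2 * T.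
  by move: KC; rewrite -/T /Cst ler_pdivrMr//; lra.
have := ler_norm M.
by move: ub AC KC'; lra.
Qed.
End comparison_principle.

(** * The operator of the statement *)

Section null_set.
Import HBNNSimple.

(* [f] and [g] need not be measurable: the coefficient of the operator is only
   measurable for the completed measure. *)
Lemma eq_integral_off_null d (T : measurableType d) (R : realType)
    (m : {measure set T -> \bar R}) (D Z : set T) (f g : T -> \bar R) :
  measurable Z -> m Z = 0%E -> (forall x, D x -> ~ Z x -> f x = g x) ->
  (\int[m]_(x in D) f x = \int[m]_(x in D) g x)%E.
Proof.
move=> mZ Z0.
have sup_le (f' g' : T -> \bar R) : (forall x, 0 <= g' x)%E ->
    (forall x, ~ Z x -> f' x = g' x) ->
    (ereal_sup [set sintegral m h | h in [set h : {nnsfun T >-> R} | forall x, ((h x)%:E <= f' x)%E]] <=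
     ereal_sup [set sintegral m h | h in [set h : {nnsfun T >-> R} | forall x, ((h x)%:E <= g' x)%E]])%E.
  move=> g0 fg; apply: ge_ereal_sup => _ [h /= hf <-].
  (* Multiplying a simple function by the indicator of the complement of [Z] keeps its integral and
     brings it below the other integrand, where the two may differ arbitrarily on [Z]. *)
  apply: ereal_sup_ubound; exists (proj_nnsfun h (measurableC mZ)).
    move=> x /=; rewrite mindicE; have [xZ|xZ] := boolP (x \in ~` Z).
      by rewrite mulr1 -fg//; move: xZ; rewrite inE.
    by rewrite mulr0.
  rewrite -!integralT_nnsfun; apply: ae_eq_integral => //.
  - exact/measurable_EFinP.
  - exact/measurable_EFinP.
  - exists Z; split=> // x hx; apply: contrapT => xZ; apply: hx => _ /=.
    by rewrite mindicE mem_set// mulr1.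
move=> fg; rewrite /integral.
have fgp x : ~ Z x -> (f \_ D)^\+%E x = (g \_ D)^\+%E x.
  move=> xZ; rewrite !funeposE !patchE; case: ifPn => // /[!inE] Dx.
  by rewrite fg.
have fgn x : ~ Z x -> (f \_ D)^\-%E x = (g \_ D)^\-%E x.
  move=> xZ; rewrite !funenegE !patchE; case: ifPn => // /[!inE] Dx.
  by rewrite fg.
have sup_eq (f' g' : T -> \bar R) : (forall x, 0 <= f' x)%E -> (forall x, 0 <= g' x)%E ->
    (forall x, ~ Z x -> f' x = g' x) ->
    (ereal_sup [set sintegral m h | h in [set h : {nnsfun T >-> R} | forall x, ((h x)%:E <= f' x)%E]] =
     ereal_sup [set sintegral m h | h in [set h : {nnsfun T >-> R} | forall x, ((h x)%:E <= g' x)%E]])%E.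
  move=> f0 g0 e; apply/eqP; rewrite eq_le !sup_le// => x /e //.
by congr (_ - _)%E; apply: sup_eq.
Qed.

End null_set.

Section kernel_of_coefficient.
Context {R : realType} {n : nat}.
Local Notation mu := (lebesgue_rV R n).
Variables (s lam Lam : R) (a : 'rV[R]_n -> R).
Hypothesis n0 : (0 < n)%N.
Hypothesis s01 : 0 < s < 1.
Hypothesis lam0 : 0 < lam <= Lam.
Hypothesis aL : Linfty (surface_measure R n) (usphere R n) a.
Hypothesis asym : forall theta, usphere R n theta -> a theta = a (- theta).
Hypothesis abd : forall theta, usphere R n theta -> lam <= a theta <= Lam.
Local Notation gam := (n%:R + 2 * s).

Lemma normalizeZ (t : R) (y : 'rV[R]_n) : 0 < t -> normalize (t *: y) = normalize y.
Proof.
move=> t0; rewrite /normalize enormZ gtr0_norm// invfM scalerA mulrAC mulVf ?gt_eqF//.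
by rewrite mul1r.
Qed.

Lemma normalizeN (y : 'rV[R]_n) : normalize (- y) = - normalize y.
Proof. by rewrite /normalize enormN scalerN. Qed.

Lemma usphere_normalize (y : 'rV[R]_n) : 0 < enorm y -> usphere R n (normalize y).
Proof.
by move=> y0; rewrite /usphere /= enormZ gtr0_norm ?invr_gt0// mulVf// gt_eqF.
Qed.

(** A null set of the cone measure spans a null truncated cone, and the whole cone is the countable
    union of the dilates of the latter by j+1. *)
Lemma null_cone (B : set 'rV[R]_n) : measurable B -> surface_measure R n B = 0%E ->
  exists2 Z, measurable Z /\ mu Z = 0%E &
    forall y, 0 < enorm y -> B (normalize y) -> Z y.
Proof.
move=> mB B0; pose C := [set x | 0 < enorm x < 1] `&` @normalize R n @^-1` B.
have mC : measurable C.
  apply: measurableI; first exact: (@measurable_enorm_itv R n `]0, 1[).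
  by rewrite -[X in measurable X]setTI; exact: measurable_normalize.
have C0 : mu C = 0%E.
  move: B0; rewrite /surface_measure -/C => /eqP; rewrite mule_eq0 eqe pnatr_eq0.
  by rewrite gtn_eqF//= => /eqP.
pose Cj (j : nat) := (fun y : 'rV[R]_n => j.+1%:R^-1 *: y + 0) @^-1` C.
have mCj j : measurable (Cj j).
  by rewrite -[X in measurable X]setTI; exact: measurable_affine_rV.
exists (\bigcup_j Cj j).
  split; first exact: bigcup_measurable.
  apply/eqP; rewrite -measure_le0.
  apply: (@le_trans _ _ (\sum_(0 <= j <oo) mu (Cj j))%E).
    by apply: measure_sigma_subadditive => //; exact: bigcup_measurable.
  rewrite eseries0// => j _ _; rewrite /Cj lebesgue_rV_affine ?C0 ?mule0//.
move=> y y0 By; exists (Num.trunc (enorm y)).+1 => //.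
have hj : enorm y < (Num.trunc (enorm y)).+2%:R.
  by rewrite (lt_trans (truncnS_gt _))// ltr_nat.
rewrite /Cj /C /= addr0 normalizeZ; last by rewrite invr_gt0.
split=> //=; rewrite enormZ gtr0_norm ?invr_gt0//.
by rewrite mulr_gt0 ?invr_gt0//= -ltr_pdivlMl ?invr_gt0// invrK mulr1.
Qed.

Lemma coefficient_kernel : exists k, kernel_spec s lam Lam k /\
  exists2 Z, measurable Z /\ mu Z = 0%E &
    forall y, 0 < enorm y -> ~ Z y -> a (normalize y) / enorm y `^ gam = k y.
Proof.
have [[g mg [B [mB B0 ag]]] _] := aL.
have [Z [mZ Z0] hZ] := null_cone mB B0.
(* Clipping to [lam, Lam] and, in [k], averaging with the reflection make bounds and evenness hold
   everywhere. Neither changes the value at directions where [g] agrees with [a] together with the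
   opposite one. *)
pose g1 y := Num.min Lam (Num.max lam (g y)).
have mg1 : measurable_fun setT (g1 : _ -> measurableTypeR R).
  by apply: measurable_minr => //; exact: measurable_maxr.
pose nu (y : 'rV[R]_n) := normalize y.
have mnu : measurable_fun setT nu by exact: measurable_normalize.
have mneg : measurable_fun setT (fun y : 'rV[R]_n => - y).
  have := @measurable_affine_rV R n (-1) 0; congr measurable_fun.
  by apply/funext => y; rewrite scaleN1r addr0.
pose k y := (g1 (nu y) + g1 (- nu y)) / 2 * enorm y `^ (- gam).
have [lam_gt0 lamL] := andP lam0.
have g1b y : lam <= g1 y <= Lam.
  by rewrite /g1 ge_min lexx/= le_min lamL le_max lexx.
have gam0 : 0 < gam by case/andP: s01 => s0 _; rewrite ltr_wpDl// mulr_gt0.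
exists k; split; first (split; [exact: s01|exact: lam_gt0|idtac..]).
- apply: measurable_funM.
    apply: measurable_funM => //; apply: measurable_funD; first exact: measurableT_comp.
    by apply: (measurableT_comp mg1); exact: measurableT_comp.
  exact: (measurableT_comp (measurable_powR _) (measurable_enorm (n:=n))).
- by move=> y; rewrite /k /nu normalizeN opprK enormN (addrC (g1 _)).
- move=> t y t0; rewrite /k /nu normalizeZ// enormZ gtr0_norm//.
  by rewrite powRM ?(ltW t0) ?enorm_ge0//; ring.
- move=> y; rewrite ler_wpM2r ?powR_ge0//.
  by have := g1b (nu y); have := g1b (- nu y); lra.
- move=> y; rewrite ler_wpM2r ?powR_ge0//.
  by have := g1b (nu y); have := g1b (- nu y); lra.
exists (Z `|` (fun y : 'rV[R]_n => - y) @^-1` Z).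
  have mNZ : measurable ((fun y : 'rV[R]_n => - y) @^-1` Z).
    by rewrite -[X in measurable X]setTI; exact: mneg.
  split; first exact: measurableU.
  apply: null_set_setU => //.
  have mu0 : mu ((fun y : 'rV[R]_n => (-1) *: y + 0) @^-1` Z) = 0%E.
    by rewrite lebesgue_rV_affine ?oppr_eq0 ?oner_eq0// Z0 mule0.
  have <- : (fun y : 'rV[R]_n => (-1) *: y + 0) @^-1` Z = (fun y : 'rV[R]_n => - y) @^-1` Z.
    by apply/seteqP; split=> y /=; rewrite scaleN1r addr0.
  exact: mu0.
move=> y y0 /not_orP[yZ yNZ].
have sy := usphere_normalize y0.
have syN : usphere R n (- nu y) by rewrite /usphere /= enormN.
have gE (t : 'rV[R]_n) : usphere R n t -> ~ B t -> g1 t = a t.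
  move=> st Bt; have e : a t = g t.
    by apply: contrapT => h; apply: Bt; apply: ag => /(_ st).
  by have /andP[h1 h2] := abd st; rewrite /g1 -e max_r// min_r.
rewrite /k !gE//.
- have -> : a (- nu y) = a (nu y) by rewrite -asym.
  have -> : (a (nu y) + a (nu y)) / 2 = a (nu y) by field.
  by rewrite powRN.
- by move=> h; apply: yNZ; apply: hZ; rewrite ?enormN// normalizeN.
- by move=> h; apply: yZ; apply: hZ.
Qed.
End kernel_of_coefficient.

(** Turns an essential bound on the negative part into a pointwise lower bound off a measurable null
    set. *)
Lemma Linfty_funrneg_ge d (T : measurableType d) (R : realType)
    (m : {measure set T -> \bar R}) (D : set T) (f : T -> R) :
  (0 < m setT)%E -> Linfty m D f^\- ->
  exists M N, [/\ 0 <= M, measurable N, m N = 0%E & forall x, D x -> ~ N x -> - M <= f x].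
Proof.
move=> m0 [_]; rewrite /finite_norm unlock m0.
have -> : abse \o (EFin \o f^\- \_ D) = EFin \o (fun x => `|(f^\- \_ D) x|) by [].
move=> /ess_supr_bounded[M [N [mN N0 NM]]].
exists (Num.max 0 M), N; split=> //; first by rewrite le_max lexx.
move=> x Dx Nx; have : `|(f^\- \_ D) x| <= M.
  by apply: contrapT => h; apply: Nx; exact: NM.
rewrite patchE mem_set// ger0_norm// /funrneg ge_max => /andP[fM _].
by rewrite lerNl le_max fM orbT.
Qed.

(** * Reduction of the solution to the comparison principle *)

Section solution.
Context {R : realType} {n : nat} {s lam Lam : R} {k a : 'rV[R]_n -> R}.
Hypothesis kP : kernel_spec s lam Lam k.
Hypothesis n0 : (0 < n)%N.
Local Notation mu := (lebesgue_rV R n).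
Local Notation Lop := (@Lop R n k).
Local Notation psi := (@psi R n s).
Local Notation gam := (n%:R + 2 * s).
Variable Z : set 'rV[R]_n.
Hypothesis mZ : measurable Z.
Hypothesis Z0 : mu Z = 0%E.
Hypothesis ak : forall y, 0 < enorm y -> ~ Z y -> a (normalize y) / enorm y `^ gam = k y.

Let s01 := kernel_s kP.
Let s0 : 0 < s. Proof. by case/andP: s01. Qed.

Lemma truncatedLE w x e : 0 < e -> truncatedL s a w x e = Lop e w x.
Proof.
move=> e0; rewrite /truncatedL /Rintegral; congr fine.
apply: (eq_integral_off_null mZ Z0) => y ye yZ.
have y0 : 0 < enorm y by apply: lt_le_trans e0 _; move: ye; rewrite -/(far e y) farE.
by rewrite -ak//; congr (_%:E); ring.
Qed.

Let wt_ge0 (x : 'rV[R]_n) : 0 < 1 + enorm x `^ gam.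
Proof. by rewrite ltr_wpDr// powR_ge0. Qed.

(** For |y| >= e one has |x + y| <= (1 + |x| / e) |y|, so the weight centred at the origin is
    comparable with the kernel centred at x. *)
Let kernel_weight_le (x y : 'rV[R]_n) e : 0 < e -> e <= enorm y ->
  k y <= Lam * (e `^ (- gam) + (1 + enorm x / e) `^ gam) / (1 + enorm (x + y) `^ gam).
Proof.
move=> e0 ye; have y0 : 0 < enorm y by exact: lt_le_trans ye.
have g0 := gam_gt0 kP; have Lam0 := Lam_ge0 kP n0.
have xe : 0 <= 1 + enorm x / e by rewrite addr_ge0// divr_ge0 ?enorm_ge0// ltW.
apply: (le_trans (kernel_le kP y)).
rewrite -mulrA ler_wpM2l// ler_pdivlMr// powRN mulrC ler_pdivrMr ?powR_gt0// [leRHS]mulrDl.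
apply: lerD.
  rewrite powRN mulrC ler_pdivlMr ?powR_gt0// mul1r.
  apply: ge0_ler_powR => //; first exact: ltW.
  - by rewrite nnegrE ltW.
  - by rewrite nnegrE enorm_ge0.
rewrite -powRM ?enorm_ge0//; apply: ge0_ler_powR; first exact: ltW.
- by rewrite nnegrE enorm_ge0.
- by rewrite nnegrE mulr_ge0 ?enorm_ge0.
apply: (le_trans (ler_enormD _ _)); rewrite mulrDl mul1r addrC lerD2l.
by rewrite mulrAC ler_pdivlMr// ler_wpM2l ?enorm_ge0.
Qed.

Lemma integrable_shift_kernel (u : 'rV[R]_n -> R) x e : 0 < e -> continuous u ->
  (\int[mu]_x (`|u x| / (1 + enorm x `^ gam))%:E < +oo)%E ->
  mu.-integrable (far e) (EFin \o (fun y => u (x + y) * k y)).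
Proof.
move=> e0 cu uI; have mu_ := continuous_measurable_rV cu.
have Lam0 := Lam_ge0 kP n0.
pose W (y : 'rV[R]_n) := `|u y| * (1 + enorm y `^ gam) `^ (-1).
have WE y : W y = `|u y| / (1 + enorm y `^ gam) by rewrite /W powR_inv1// ltW.
have mW : measurable_fun setT (W : _ -> measurableTypeR R).
  apply: measurable_funM; first exact: measurableT_comp.
  apply: (measurableT_comp (measurable_powR _)); apply: measurable_funD => //.
  exact: (measurableT_comp (measurable_powR _) (measurable_enorm (n:=n))).
have W0 y : 0 <= W y by apply: mulr_ge0; [exact: normr_ge0|exact: powR_ge0].
have mWx := measurable_addl x mW.
pose c := Lam * (e `^ (- gam) + (1 + enorm x / e) `^ gam).
have c0 : 0 <= c by rewrite mulr_ge0// addr_ge0 ?powR_ge0.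
have cW0 y : 0 <= c * W y by exact: mulr_ge0.
have mcW : measurable_fun setT ((fun y => c * W (x + y)) : _ -> measurableTypeR R).
  by apply: measurable_funM; [exact: measurable_cst|exact: mWx].
have uW y : far e y -> `|u (x + y) * k y| <= `|c * W (x + y)|.
  rewrite farE => ye; rewrite normrM (ger0_norm (kernel_ge0 kP _)) (ger0_norm (cW0 _)).
  rewrite WE mulrCA ler_wpM2l// mulrC.
  by apply: (le_trans (kernel_weight_le x e0 ye)); rewrite mulrC.
have mEW : measurable_fun setT (fun y => (W y)%:E) by apply/measurable_EFinP; exact: mW.
have WI : (\int[mu]_y (W (x + y))%:E < +oo)%E.
  have sh := ge0_integral_shift x mEW (fun y => W0 y : (0 <= (W y)%:E)%E).
  have e1 : (\int[mu]_y (W (x + y))%:E = \int[mu]_y (W (y + x)%R)%:E)%E.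
    by apply: eq_integral => y _; rewrite addrC.
  have e2 : (\int[mu]_y (W y)%:E = \int[mu]_x (`|u x| / (1 + enorm x `^ gam))%:E)%E.
    by apply: eq_integral => y _; rewrite WE.
  by rewrite e1 sh e2.
have mf := @measurable_far R n e.
have iW : mu.-integrable (far e) (EFin \o (fun y => c * W (x + y))).
  apply: (@integrableS _ _ _ _ setT) => //.
  apply/integrableP; split; first by apply/measurable_EFinP; exact: mcW.
  have e1 : (\int[mu]_y `|(EFin \o (fun y => c * W (x + y))%R) y| =
      c%:E * \int[mu]_y (W (x + y))%:E)%E.
    rewrite -ge0_integralZlR//; apply: eq_integral => y _.
    by rewrite /= (ger0_norm (cW0 _)).
  rewrite e1; exact: lte_mul_pinfty.
apply: (@le_integrable _ _ _ _ _ mf _ (EFin \o (fun y => c * W (x + y)))) => //.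
apply/measurable_EFinP; apply: measurable_funTS; apply: measurable_funM.
  exact: measurable_addl.
exact: kernel_measurable kP.
Qed.


Variables (Omega : set 'rV[R]_n) (u V : 'rV[R]_n -> R) (x0 : 'rV[R]_n) (rho : R).
Hypothesis uZ : Zspace s a Omega u.
Hypothesis Vm : Linfty mu Omega V^\-.
Hypothesis um : Linfty mu setT u^\-.
Hypothesis ueq : forall x, Omega x -> V x * u x <= nonlocalL s a u x.
Hypothesis ux0 : u x0 = 0.
Hypothesis rho0 : 0 < rho.
Hypothesis u_ge0 : forall x, eball x0 rho x -> 0 <= u x.
Hypothesis u_gt0 : forall x, (eball x0 rho `&` Omega) x -> 0 < u x.

Let cu : continuous u. Proof. by case: uZ. Qed.

Let mu_setT_gt0 : (0 < mu setT)%E.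
Proof.
apply: (@lt_le_trans _ _ (mu (eball 0 1))); first exact: lebesgue_rV_eball_gt0.
by apply: le_measure; rewrite ?inE//; exact: measurable_eball.
Qed.

(** By continuity the set where u < - B is open; being null, it is empty. *)
Let u_bounded_below : exists2 B, 0 <= B & forall x, - B <= u x.
Proof.
have [B [N [B0 mN N0 hB]]] := Linfty_funrneg_ge mu_setT_gt0 um.
exists B => // x; rewrite leNgt; apply/negP => ux.
have /nbhs_eballP[r r0 ru] : \forall y \near x, u y < - B.
  have d0 : 0 < - B - u x by rewrite subr_gt0.
  have /cvgrPdist_lt/(_ _ d0) := @cu x; apply: filterS => y.
  by rewrite ltr_norml => /andP[]; lra.
suff : (mu (eball x r) <= 0)%E by rewrite leNgt lebesgue_rV_eball_gt0.
rewrite -N0; apply: le_measure; rewrite ?inE//; first exact: measurable_eball.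
move=> y /ru uy; apply: contrapT => Ny; have := hB y I Ny.
by rewrite leNgt uy.
Qed.

Let uI x e : 0 < e -> mu.-integrable (far e) (EFin \o (fun y => u (x + y) * k y)).
Proof. by move=> e0; apply: integrable_shift_kernel => //; case: uZ. Qed.

(** The truncation [v] is bounded and equals [u] near x0; [q] is the excess cut off. *)
Let v x := Num.min (u x) 1.
Let q x := Num.max (u x - 1) 0.

Let vq x : v x = u x - q x.
Proof. by rewrite /v /q; case: (leP (u x) 1) => h; [rewrite max_r|rewrite max_l]; lra. Qed.

Let cv : continuous v.
Proof.
move=> x; have FF : Filter (nbhs x) by exact: nbhs_filter.
apply/cvgrPdist_lt => e e0; have /cvgrPdist_lt/(_ _ e0) := @cu x.
apply: filterS => y; apply: le_lt_trans; rewrite /v.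
have [h1|h1] := leP (u x) 1; have [h2|h2] := leP (u y) 1; rewrite ?subrr ?normr0//.
- by rewrite !ler0_norm; lra.
- by rewrite !ger0_norm; lra.
Qed.

Let q_ge0 x : 0 <= q x. Proof. by rewrite /q le_max lexx orbT. Qed.

(** The excess vanishes within distance d of x, so it is felt only by jumps of length at least d,
    through a nonnegative amount that does not depend on the truncation. *)
Let truncation_excess x d : 0 < d -> (forall y, enorm y < d -> q (x + y) = 0) ->
  exists2 I, 0 <= I & forall e, 0 < e < d -> Lop e v x = Lop e u x + I.
Proof.
move=> d0 qd; have [B B0 uB] := u_bounded_below.
have bv : bmeas v.
  split; first exact: continuous_measurable_rV.
  exists (B + 1) => y; rewrite ler_norml /v le_min ge_min; have := uB y.
  by move=> h; apply/andP; split; [apply/andP; split|apply/orP; right]; lra.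
exists (\int[mu]_(y in far d) (q (x + y) * k y)).
  by apply: Rintegral_ge0 => y _; rewrite mulr_ge0// (kernel_ge0 kP).
move=> e /andP[e0 ed].
have qx : q x = 0 by have := qd 0; rewrite addr0 enorm0; exact.
have -> : \int[mu]_(y in far d) (q (x + y) * k y) = \int[mu]_(y in far e) (q (x + y) * k y).
  rewrite /Rintegral; congr fine; rewrite integral_mkcond [RHS]integral_mkcond.
  apply: eq_integral => y _; rewrite !patchE.
  have [yd|yd] := leP d (enorm y); last by rewrite qd// mul0r !if_same.
  rewrite !mem_set//; by rewrite farE// (le_trans _ yd)// ltW.
have mf := @measurable_far R n e.
have iv := integrable_bmeas kP n0 e0 (bmeasB (bmeas_cst (v x)) (bmeas_shift x bv)).
have iu : mu.-integrable (far e) (EFin \o (fun y => (u x - u (x + y)) * k y)).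
  have h := integrableB mf (integrable_bmeas kP n0 e0 (bmeas_cst (u x))) (uI x e0).
  by apply: (eq_integrable mf _ _ _ h) => y _ /=; rewrite -EFinB mulrBl.
apply/eqP; rewrite addrC -subr_eq; apply/eqP; rewrite /Lop -RintegralB//.
by apply: eq_Rintegral => y _; rewrite !vq qx; ring.
Qed.

Lemma local_comparison : exists rho1 C th, [/\ 0 < rho1 <= rho, 0 < C, 0 < th &
  forall z r z' K, 0 < r -> eball z r `<=` Omega -> enorm (z - x0) + r <= rho1 / 2 ->
  enorm (z - z') <= 5 * r -> eball z' (r / 2) `<=` eball x0 rho1 ->
  (forall y, eball z' (r / 2) y -> K <= u y) ->
  C <= K / r `^ (2 * s) ->
  forall x, eball z r x -> th * (K / r `^ (2 * s)) * psi z r x <= u x].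
Proof.
have [B B0 uB] := u_bounded_below.
have [M [N [M0 mN N0 hM]]] := Linfty_funrneg_ge mu_setT_gt0 Vm.
have [rho1 rho10 hrho1] : exists2 rho1, 0 < rho1 <= rho & forall y, eball x0 rho1 y -> u y < 1.
  have /cvgrPdist_lt/(_ _ ltr01) := @cu x0; rewrite ux0 => /nbhs_eballP[r r0 ru].
  exists (Num.min r rho); first by rewrite lt_min r0 rho0 ge_min lexx orbT.
  move=> y; rewrite eballE lt_min => /andP[yr _]; have := ru y yr.
  by rewrite sub0r normrN; apply: le_lt_trans; exact: ler_norm.
have [rho1_gt0 rho1_le] := andP rho10.
pose G := Omega `&` eball x0 rho1.
have sub1 y : eball x0 rho1 y -> eball x0 rho y by rewrite !eballE => /lt_le_trans; apply.
have vB x : `|v x| <= B + 1.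
  rewrite ler_norml /v le_min ge_min; have h := uB x.
  by apply/andP; split; [apply/andP; split|apply/orP; right]; lra.
have vu x : eball x0 rho1 x -> v x = u x by move=> /hrho1/ltW h; rewrite /v min_l.
have excess x : G x -> exists2 d, 0 < d & exists2 I, 0 <= I &
    forall e, 0 < e < d -> Lop e v x = Lop e u x + I.
  move=> [_ xr]; exists (rho1 - enorm (x - x0)); first by rewrite subr_gt0.
  apply: truncation_excess; first by rewrite subr_gt0.
  move=> y yd; rewrite /q max_r// subr_le0 ltW// hrho1// eballE addrAC.
  by apply: (le_lt_trans (ler_enormD _ _)); lra.
have ucvg x : G x -> Lop e u x @[e --> 0^'+] --> nonlocalL s a u x.
  move=> [Ox _]; have [_ _ /(_ _ Ox) h] := uZ.
  apply: cvg_trans h; apply: near_eq_cvg.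
  by apply/near_right0P; exists 1 => // e /andP[e0 _]; rewrite truncatedLE.
have vcvg x : G x -> exists2 I, 0 <= I & Lop e v x @[e --> 0^'+] --> nonlocalL s a u x + I.
  move=> Gx; have [d d0 [I I0 hI]] := excess x Gx; exists I => //.
  have h : Lop e u x + I @[e --> 0^'+] --> nonlocalL s a u x + I.
    by apply: cvgD; [exact: ucvg|exact: cvg_cst].
  apply: cvg_trans h; apply: near_eq_cvg.
  by apply/near_right0P; exists d => // e ed; rewrite hI.
have Gcvg x : G x -> cvg (Lop e v x @[e --> 0^'+]).
  by move=> /vcvg[I _ h]; apply/cvg_ex; exists (nonlocalL s a u x + I).
(* Here 0 < u < 1, so V u >= - M wherever V >= - M, and the truncation only adds the nonnegative
   [I]. *)
have GM x : G x -> ~ N x -> \forall e \near 0^'+, - (M + 1) <= Lop e v x.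
  move=> Gx Nx; have [Ox xr] := Gx; have [I I0 h] := vcvg x Gx.
  have u1 := hrho1 _ xr; have u0 := u_gt0 (conj (sub1 _ xr) Ox).
  have Mx := hM _ Ox Nx; have Lx := ueq Ox.
  have LM : - M <= nonlocalL s a u x by apply: le_trans Lx; nra.
  have /cvgrPdist_lt/(_ _ ltr01) := h; apply: filterS => e.
  by rewrite ltr_norml => /andP[]; lra.
have v0 x : eball x0 rho1 x -> 0 <= v x.
  by move=> h; rewrite vu//; apply: u_ge0; exact: sub1.
have [C [th [C0 th0 hC]]] := comparison kP n0 cv vB Gcvg GM mN N0 rho1_gt0 v0.
exists rho1, C, th; split=> // z r z' K r0 zO zr zz' z'r Ku CK x xz.
have inball y : eball z r y -> eball x0 rho1 y.
  rewrite !eballE => h; rewrite -(subrKA z y (- x0)).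
  by apply: (le_lt_trans (ler_enormD _ _)); lra.
rewrite -vu; last exact: inball.
apply: (hC z r z' K) => //.
- by move=> y yz; split; [exact: zO|exact: inball].
- by move=> y yz; rewrite vu ?Ku//; exact: z'r.
Qed.

End solution.

(** * Growth at the boundary point *)

Section boundary_growth.
Context {R : realType} {n : nat} {s : R}.
Hypothesis s01 : 0 < s < 1.
Local Notation psi := (@psi R n s).

Let s0 : 0 < s. Proof. by case/andP: s01. Qed.

Variables (Omega : set 'rV[R]_n) (u : 'rV[R]_n -> R) (x0 : 'rV[R]_n).

(** In dimension 0 the space is a single point and no set has a boundary point. *)
Lemma boundary_dim_gt0 : boundary Omega x0 -> (0 < n)%N.
Proof.
case=> clx nix; case: (posnP n) => // n_eq0; exfalso; apply: nix.
have eq0 (x y : 'rV[R]_n) : x = y.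
  by apply/rowP => i; exfalso; move: (ltn_ord i); rewrite [X in (_ < X)%N]n_eq0.
have [|y [Oy _]] := clx setT; first by apply: filterT; exact: nbhs_filter.
apply/nbhs_eballP; exists 1 => // z _; by rewrite (eq0 z y).
Qed.

Lemma boundary_eball z r : boundary (eball z r) x0 -> enorm (x0 - z) = r.
Proof.
case=> clx nix; apply/eqP; rewrite eq_le; apply/andP; split; last first.
  rewrite leNgt; apply/negP => h; apply: nix.
  have := @eball_open R n z r; rewrite openE => /(_ x0); exact.
have h := @ecball_closed R n z r; apply: h => B /clx[y [yr By]].
by exists y; split=> //=; exact: ltW.
Qed.

Lemma boundary_notin : open Omega -> boundary Omega x0 -> ~ Omega x0.
Proof. by rewrite openE => oO [_ nix] /oO. Qed.

Lemma psi_ge z r x b : 0 <= b -> b <= r ^+ 2 - enorm (x - z) ^+ 2 -> b `^ s <= psi z r x.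
Proof.
move=> b0 bx; apply: ge0_ler_powR; first exact: ltW.
- by rewrite nnegrE.
- by rewrite nnegrE le_max lexx.
- by rewrite le_max bx orbT.
Qed.

Variables (rho C th : R).
Hypothesis rho0 : 0 < rho.
Hypothesis C0 : 0 < C.
Hypothesis th0 : 0 < th.
Hypothesis cmp : forall z r z' K, 0 < r -> eball z r `<=` Omega ->
  enorm (z - x0) + r <= rho / 2 -> enorm (z - z') <= 5 * r ->
  eball z' (r / 2) `<=` eball x0 rho -> (forall y, eball z' (r / 2) y -> K <= u y) ->
  C <= K / r `^ (2 * s) ->
  forall x, eball z r x -> th * (K / r `^ (2 * s)) * psi z r x <= u x.

(* One application of the comparison at a scale [r0] where [u] is large; it
   makes [u] large compared with [r^2s] at all smaller scales, in balls of an
   arbitrary direction. *)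
Lemma growth_all_scales z0 r0 : 0 < r0 -> enorm (x0 - z0) = r0 -> r0 <= rho / 4 ->
  eball z0 r0 `<=` Omega -> (forall x, eball z0 (r0 / 2) x -> C * r0 `^ (2 * s) <= u x) ->
  exists c r1, [/\ 0 < c, 0 < r1 & forall z r, 0 < r <= r1 -> enorm (z - x0) = r ->
    eball z r `<=` Omega -> forall x, eball z r x -> c * r `^ (- s) * psi z r x <= u x].
Proof.
move=> r00 xz0 r0rho zO0 ul; pose A0 := th * C.
have A00 : 0 < A0 by exact: mulr_gt0.
have u1 x : eball z0 r0 x -> A0 * psi z0 r0 x <= u x.
  move=> xz; have rs0 : 0 < r0 `^ (2 * s) by exact: powR_gt0.
  have KE : C * r0 `^ (2 * s) / r0 `^ (2 * s) = C by rewrite mulfK// gt_eqF.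
  (* The pushing ball is taken concentric with the comparison ball, and K is the smallest admissible
     value. *)
  have := @cmp z0 r0 z0 (C * r0 `^ (2 * s)) r00 zO0; rewrite KE; apply=> //.
  - by rewrite enormBC xz0; lra.
  - by rewrite subrr enorm0 mulr_ge0// ltW.
  - move=> y; rewrite !eballE => h; rewrite -(subrKA z0 y (- x0)).
    apply: (le_lt_trans (ler_enormD _ _)); rewrite (enormBC z0) xz0.
    by have := rho0; lra.
(* The axis point at distance 4 r from x0. Its ball of radius r/2 lies at depth at least 7r/2 in the
   ball of radius r0, so there the barrier is at least (r0 r)^s. Any interior centre at distance r
   from x0 is within r + 4 r of it, which is the origin of the factor 5 in the comparison. *)
pose p r := x0 + (4 * r / r0) *: (z0 - x0).
have pz r y : 0 < r -> 4 * r <= r0 -> enorm (y - p r) < r / 2 ->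
    enorm (y - z0) <= r0 - 7 / 2 * r.
  move=> rp rr0 yp; rewrite -(subrKA (p r) y (- z0)).
  apply: (le_trans (ler_enormD _ _)).
  have -> : p r - z0 = (1 - 4 * r / r0) *: (x0 - z0).
    rewrite /p -(opprB x0 z0) scalerN scalerBl scale1r.
    by rewrite addrAC.
  rewrite enormZ xz0 ger0_norm; last by rewrite subr_ge0 ler_pdivrMr// mul1r.
  by rewrite mulrBl mul1r divfK ?gt_eqF//; lra.
pose c1 := A0 * r0 `^ s; have c10 : 0 < c1 by rewrite mulr_gt0 ?powR_gt0.
have uK r y : 0 < r -> 4 * r <= r0 -> enorm (y - p r) < r / 2 -> c1 * r `^ s <= u y.
  move=> rp rr0 yp; have h := pz r y rp rr0 yp.
  have yz : eball z0 r0 y by rewrite eballE; lra.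
  apply: le_trans (u1 y yz); rewrite /c1 -mulrA ler_wpM2l ?(ltW A00)//.
  rewrite -powRM ?(ltW r00) ?(ltW rp)//; apply: psi_ge.
    by rewrite mulr_ge0 ?(ltW r00) ?(ltW rp).
  have := enorm_ge0 (y - z0); nra.
(* r <= r0/4 keeps the axis point within r0 of x0, r <= rho/5 keeps both balls near x0, and the last
   bound gives c1 r^(-s) >= C, the threshold of the comparison. *)
pose r1 := Num.min (Num.min (r0 / 4) (rho / 5)) ((c1 / C) `^ s^-1).
have r10 : 0 < r1 by rewrite !lt_min !divr_gt0// powR_gt0// divr_gt0.
exists (th * c1), r1; split=> //; first exact: mulr_gt0.
move=> z r /andP[rp]; rewrite !le_min => /andP[/andP[ra rb] rc] zx zO x xz.
have q0 : 0 <= 4 * r / r0 by rewrite divr_ge0 ?mulr_ge0 ?(ltW rp) ?(ltW r00).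
have KE : c1 * r `^ s / r `^ (2 * s) = c1 * r `^ (- s).
  rewrite -mulrA -powRN -powRDp//; congr (_ * _ `^ _); ring.
have := @cmp z r (p r) (c1 * r `^ s) rp zO; rewrite KE mulrA; apply=> //.
- by rewrite zx; lra.
- have -> : z - p r = (z - x0) - (4 * r / r0) *: (z0 - x0) by rewrite /p opprD addrA.
  apply: (le_trans (ler_enormD _ _)); rewrite enormN enormZ (enormBC z0) zx xz0.
  by rewrite (ger0_norm q0) divfK ?gt_eqF//; lra.
- move=> y; rewrite !eballE => h; rewrite -(subrKA (p r) y (- x0)).
  apply: (le_lt_trans (ler_enormD _ _)); rewrite {2}/p addrAC subrr add0r enormZ (enormBC z0) xz0.
  by rewrite (ger0_norm q0) divfK ?gt_eqF//; lra.
- by move=> y; rewrite eballE => h; apply: uK => //; lra.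
- rewrite powRN ler_pdivlMr ?powR_gt0// mulrC -ler_pdivlMr//.
  have -> : c1 / C = (c1 / C) `^ s^-1 `^ s.
    by rewrite -powRrM mulVf ?gt_eqF// powRr1// divr_ge0// ltW.
  apply: ge0_ler_powR => //; first exact: ltW.
  - by rewrite nnegrE ltW.
  - by rewrite nnegrE powR_ge0.
Qed.

End boundary_growth.

(** For x at distance t take the ball of radius r = t / sg touching x0 inside the given ball. The
    cone condition gives r^2 - |x - z|^2 = 2 r (x - x0).e - t^2 >= t^2, so the barrier is at least
    t^(2s), and r^(-s) t^(2s) = sg^s t^s. Shrinking one fixed ball keeps the direction e fixed. *)
Lemma cone_growth (R : realType) (n : nat) (s : R) (Omega : set 'rV[R]_n)
    (u : 'rV[R]_n -> R) (x0 e : 'rV[R]_n) (c r1 r2 sg : R) : 0 < s < 1 ->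
  0 < c -> 0 < r1 ->
  (forall z r, 0 < r <= r1 -> enorm (z - x0) = r -> eball z r `<=` Omega ->
    forall x, eball z r x -> c * r `^ (- s) * psi (s := s) z r x <= u x) ->
  enorm e = 1 -> 0 < r2 -> eball (x0 + r2 *: e) r2 `<=` Omega -> 0 < sg ->
  exists c' t1, [/\ 0 < c', 0 < t1 & forall x, 0 < enorm (x - x0) < t1 ->
    sg * enorm (x - x0) <= dotv (x - x0) e -> c' * enorm (x - x0) `^ s <= u x].
Proof.
move=> s01 c0 r10 hc e1 r20 eO sg0; have /andP[s0 s1] := s01.
exists (c * sg `^ s), (sg * Num.min r1 r2); split.
- by rewrite mulr_gt0// powR_gt0.
- by rewrite mulr_gt0// lt_min r10.
move=> x /andP[]; set t := enorm (x - x0) => t0 tlt xe.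
have : t / sg < Num.min r1 r2 by rewrite ltr_pdivrMr// mulrC.
set r := t / sg; rewrite lt_min => /andP[rr1 rr2].
have r0 : 0 < r by exact: divr_gt0.
have tr : t = r * sg by rewrite /r divfK// gt_eqF.
pose z := x0 + r *: e.
have zx : enorm (z - x0) = r by rewrite /z addrC addKr enormZ e1 mulr1 gtr0_norm.
have zO : eball z r `<=` Omega.
  move=> y; rewrite eballE => yz; apply: eO; rewrite eballE.
  rewrite -(subrKA z y (- (x0 + r2 *: e))); apply: (le_lt_trans (ler_enormD _ _)).
  have -> : z - (x0 + r2 *: e) = (r - r2) *: e.
    by rewrite /z opprD addrACA subrr add0r -scalerBl.
  by rewrite enormZ e1 mulr1 ltr0_norm ?subr_lt0//; lra.
have key (w : 'rV[R]_n) : enorm (w - r *: e) ^+ 2 = enorm w ^+ 2 - 2 * r * dotv w e + r ^+ 2.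
  have ee : dotv e e = 1 by rewrite -sqr_enorm e1 expr1n.
  rewrite !sqr_enorm dotvDl !dotvDr !dotvNl !dotvNr !dotvZl !dotvZr (dotvC e w) ee; ring.
have dist2 : t ^+ 2 <= r ^+ 2 - enorm (x - z) ^+ 2.
  have -> : x - z = (x - x0) - r *: e by rewrite /z opprD addrA.
  rewrite key -/t; have : r * (sg * t) <= r * dotv (x - x0) e by rewrite ler_pM2l.
  by rewrite mulrA -tr -expr2; lra.
have xb : eball z r x.
  rewrite eballE -(@ltr_pXn2r _ 2)// ?nnegrE ?enorm_ge0 ?ltW//.
  by rewrite -subr_gt0 (lt_le_trans _ dist2)// exprn_gt0.
apply: le_trans (hc z r _ zx zO x xb); last by rewrite r0 ltW.
apply: (@le_trans _ _ (c * r `^ (- s) * (t ^+ 2) `^ s)); last first.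
  rewrite ler_wpM2l ?mulr_ge0 ?powR_ge0 ?(ltW c0)//.
  exact: (psi_ge s01 (sqr_ge0 t) dist2).
have -> : (t ^+ 2) `^ s = t `^ s * (r `^ s * sg `^ s).
  by rewrite expr2 powRM ?(ltW t0)// {2}tr powRM ?(ltW r0) ?(ltW sg0).
rewrite powRN le_eqVlt; apply/orP; left; apply/eqP; field.
by rewrite gt_eqF// powR_gt0.
Qed.

Lemma limf_esup_frequent (R : realType) (f : R -> R) :
  limf_esup (fun r => (f r)%:E) 0^'+ = +oo%E ->
  forall A d, 0 < d -> exists2 r, 0 < r < d & A <= f r.
Proof.
move=> fy A d d0; apply: contrapT => h.
suff : (limf_esup (fun r => (f r)%:E) 0^'+ <= A%:E)%E by rewrite fy leye_eq.
apply: (@le_trans _ _ (ereal_sup ((fun r => (f r)%:E) @` [set r | 0 < r < d]))).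
  apply: ereal_inf_lbound; exists [set r | 0 < r < d] => //.
  by apply/near_right0P; exists d.
apply: ge_ereal_sup => _ [r rd <-]; rewrite lee_fin leNgt; apply/negP => Af.
by apply: h; exists r => //; exact: ltW.
Qed.

Lemma ge_limf_einf (R : realType) (T : choiceType) (X : filteredType T)
    (f : X -> \bar R) (F : set_system X) (A : set X) (c : \bar R) :
  F A -> (forall x, A x -> (c <= f x)%E) -> (c <= limf_einf f F)%E.
Proof.
move=> FA cf; rewrite /limf_einf leeNr.
apply: (@le_trans _ _ (ereal_sup ((\- f)%E @` A))).
  by apply: ereal_inf_lbound; exists A.
by apply: ge_ereal_sup => _ [x Ax <-]; rewrite leeN2 cf.
Qed.

Lemma dotv_ge_of_angle (R : realType) (n : nat) (x y : 'rV[R]_n) (b : R) :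
  0 < b < pi / 2 -> 0 < enorm x -> 0 < enorm y -> angle x y < b ->
  cos b * (enorm x * enorm y) <= dotv x y.
Proof.
move=> /andP[b0 b2] x0 y0; rewrite /angle => ab.
have xy0 : 0 < enorm x * enorm y by exact: mulr_gt0.
set q := dotv x y / _ in ab.
have q1 : -1 <= q <= 1.
  rewrite ler_pdivlMr// ler_pdivrMr// mul1r mulN1r lerNl dotv_enormM andbT.
  by rewrite -dotvNl -(enormN x) dotv_enormM.
have p0 := pi_gt0 R.
have : cos b < cos (acos q).
  rewrite ltr_cos//.
    by rewrite in_itv/= acos_ge0// acos_lepi.
  by rewrite in_itv/=; apply/andP; split; lra.
by rewrite acosK ?in_itv//= ltr_pdivlMr// => /ltW.
Qed.

Lemma dist_to_le (R : realType) (n : nat) (A : set 'rV[R]_n) (x y : 'rV[R]_n) :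
  A y -> dist_to A x <= enorm (x - y).
Proof.
move=> Ay; apply: ge_inf; last by exists y.
by exists 0 => _ [z _ <-]; exact: enorm_ge0.
Qed.

Lemma dist_to_boundary_gt0 (R : realType) (n : nat) (A : set 'rV[R]_n) (x y : 'rV[R]_n) :
  open A -> boundary A y -> A x -> 0 < dist_to (boundary A) x.
Proof.
move=> oA bA Ax; have /nbhs_eballP[d d0 dA] : nbhs x A by move: oA; rewrite openE => /(_ x Ax).
apply: (lt_le_trans d0); apply: lb_le_inf; first by exists (enorm (x - y)), y.
move=> _ [z bz <-]; rewrite leNgt; apply/negP => zx.
by apply: (boundary_notin oA bz); apply: dA; rewrite eballE enormBC.
Qed.

Theorem theorem1p2 (R : realType) (n : nat)
    (Omega : set 'rV[R]_n) (x0 : 'rV[R]_n)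
    (rbar : R) (c : R -> 'rV[R]_n)
    (s lambda Lambda : R) (a : 'rV[R]_n -> R)
    (u V : 'rV[R]_n -> R) (rho : R) :
  open Omega ->
  boundary Omega x0 ->
  interior_balls Omega x0 rbar c ->
  0 < s < 1 ->
  0 < lambda <= Lambda ->
  Linfty (surface_measure R n) (usphere R n) a ->
  (forall theta, usphere R n theta -> a theta = a (- theta)) ->
  (forall theta, usphere R n theta -> lambda <= a theta <= Lambda) ->
  Zspace s a Omega u ->
  u x0 = 0 ->
  Linfty (lebesgue_rV R n) setT u^\- ->
  L1loc Omega V ->
  Linfty (lebesgue_rV R n) Omega V^\- ->
  (forall x, Omega x -> V x * u x <= nonlocalL s a u x) ->
  0 < rho ->
  (forall x, eball x0 rho x -> 0 <= u x) ->
  (forall x, (eball x0 rho `&` Omega) x -> 0 < u x) ->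
  grows_faster s x0 c u ->
  (forall beta r : R, 0 < beta < pi / 2 -> 0 < r <= rbar ->
    (0 < limf_einf (fun x => (u x / enorm (x - x0) `^ s)%:E)
      (within [set x | Omega x /\
                       (angle (x - x0) (c r - x0) < pi / 2 - beta)%R]
              (nbhs x0)))%E)
  /\
  (forall g : 'rV[R]_n -> R,
    continuous_extension Omega x0
      (fun x => u x / dist_to (boundary Omega) x `^ s) g ->
    0 < g x0).
Proof.
move=> oO bO [rbar0 ib] s01 lamL aL asym abd uZ u0 um VL Vm ueq rho0 uge ugt [_ _ gr].
have n0 := boundary_dim_gt0 bO.
have [k [kP [Z [mZ Z0] ak]]] := coefficient_kernel n0 s01 lamL aL asym abd.
have [rho1 [C [th [/andP[rho10 _] C0 th0 cmp]]]] :=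
  local_comparison kP n0 mZ Z0 ak uZ Vm um ueq u0 rho0 uge ugt.
have cE r : 0 < r <= rbar -> eball (c r) r `<=` Omega /\ enorm (c r - x0) = r.
  by move=> /ib[h [_ /boundary_eball]]; rewrite enormBC.
have [c1 [r1 [c10 r10 hc]]] : exists c1 r1, [/\ 0 < c1, 0 < r1 &
    forall z r, 0 < r <= r1 -> enorm (z - x0) = r -> eball z r `<=` Omega ->
    forall x, eball z r x -> c1 * r `^ (- s) * psi (s := s) z r x <= u x].
  pose d := Num.min (Num.min rbar (rho1 / 4)) (rho / 4).
  have d0 : 0 < d by rewrite !lt_min rbar0 !divr_gt0.
  have [r0 /andP[r00]] := limf_esup_frequent gr C d0.
  rewrite !lt_min => /andP[/andP[rb rr] rro] Cr.
  have [cO cx] : eball (c r0) r0 `<=` Omega /\ enorm (c r0 - x0) = r0.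
    by apply: cE; rewrite r00 ltW.
  apply: (growth_all_scales s01 rho10 C0 th0 cmp r00 _ (ltW rr) cO).
    by rewrite enormBC.
  move=> x xc; have ux : 0 <= u x.
    apply: uge; move: xc; rewrite !eballE -(subrKA (c r0) x (- x0)) => xc.
    by apply: (le_lt_trans (ler_enormD _ _)); rewrite cx; lra.
  rewrite -(ger0_norm ux).
  have : C * r0 `^ (2 * s) <= inf [set `|u x| | x in eball (c r0) (r0 / 2)].
    by rewrite -ler_pdivlMr// powR_gt0.
  move=> /le_trans; apply; apply: ge_inf; last by exists x.
  by exists 0 => _ [y _ <-]; exact: normr_ge0.
have cone r sg : 0 < r <= rbar -> 0 < sg -> exists c' t1, [/\ 0 < c', 0 < t1 &
    forall x, 0 < enorm (x - x0) < t1 ->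
      sg * (enorm (x - x0) * r) <= dotv (x - x0) (c r - x0) ->
      c' * enorm (x - x0) `^ s <= u x].
  move=> rr sg0; have [r0 _] := andP rr; have [cO cx] := cE r rr.
  pose e := r^-1 *: (c r - x0).
  have e1 : enorm e = 1 by rewrite enormZ cx gtr0_norm ?invr_gt0// mulVf// gt_eqF.
  have eO : eball (x0 + r *: e) r `<=` Omega.
    by rewrite /e scalerA mulfV ?gt_eqF// scale1r addrC subrK.
  have [c' [t1 [c'0 t10 h]]] := cone_growth s01 c10 r10 hc e1 r0 eO sg0.
  exists c', t1; split=> // x xt hx; apply: h => //.
  by rewrite /e dotvZr ler_pdivlMl// mulrC -mulrA.
have xO x : Omega x -> 0 < enorm (x - x0).
  move=> Ox; rewrite lt_def enorm_ge0 andbT; apply/eqP => /enorm_eq0/eqP.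
  by rewrite subr_eq0 => /eqP xx0; apply: (boundary_notin oO bO); rewrite -xx0.
split=> [beta r /andP[b0 b2] rr|g [gE [U Ux0 gc]]].
  have [_ cx] := cE r rr; have [r0 _] := andP rr.
  (* An angle below pi/2 - beta has cosine at least cos (pi/2 - beta), which is positive and serves
     as aperture of the cone. *)
  have sg0 : 0 < cos (pi / 2 - beta) by apply: cos_gt0_pihalf; apply/andP; split; lra.
  have [c' [t1 [c'0 t10 h]]] := cone r _ rr sg0.
  apply: (@lt_le_trans _ _ c'%:E); first by rewrite lte_fin.
  apply: (@ge_limf_einf _ _ _ _ _ [set x | enorm (x - x0) < t1 /\
    (Omega x /\ angle (x - x0) (c r - x0) < pi / 2 - beta)]).
    by apply/nbhs_eballP; exists t1 => // x xt1 xA.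
  move=> x [xt [Ox xa]]; have x_gt0 := xO x Ox.
  rewrite lee_fin ler_pdivlMr ?powR_gt0//; apply: h; first by rewrite x_gt0.
  have cx0 : 0 < enorm (c r - x0) by rewrite cx.
  have := @dotv_ge_of_angle _ _ (x - x0) (c r - x0) (pi / 2 - beta) _ x_gt0 cx0 xa.
  by rewrite cx; apply; apply/andP; split; lra.
have rr : 0 < rbar <= rbar by rewrite rbar0 lexx.
have [cO cx] := cE _ rr.
(* Aperture 1 leaves only the axis of the ball, and axis points are all that is used to evaluate the
   extension at x0. *)
have [c' [t1 [c'0 t10 h]]] := cone rbar 1 rr ltr01.
apply: (lt_le_trans c'0); rewrite leNgt; apply/negP => gx0.
have gx0' : 0 < c' - g x0 by rewrite subr_gt0.
have Ax0 : (Omega `|` (boundary Omega `&` U)) x0.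
  by right; split=> //; exact: nbhs_singleton.
have /subspace_continuousP/(_ _ Ax0)/cvgrPdist_lt/(_ _ gx0')/nbhs_eballP[d d0 gd] := gc.
(* Distance of the test point from x0: within the range of the growth bound and of the continuity of
   [g], and below the diameter of the ball so that the point is in Omega. *)
pose t := Num.min (Num.min t1 d) (2 * rbar) / 2.
have t0 : 0 < t by rewrite divr_gt0// !lt_min t10 d0 mulr_gt0.
have : t < Num.min (Num.min t1 d) (2 * rbar) by rewrite /t; move: t0; rewrite /t; lra.
rewrite !lt_min => /andP[/andP[tt1 td] tr].
pose x := x0 + (t / rbar) *: (c rbar - x0).
have tr0 : 0 < t / rbar by exact: divr_gt0.
have xx0 : x - x0 = (t / rbar) *: (c rbar - x0) by rewrite /x addrC addKr.
have xt : enorm (x - x0) = t by rewrite xx0 enormZ cx gtr0_norm// divfK// gt_eqF.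
have Ox : Omega x.
  apply: cO; rewrite eballE.
  have -> : x - c rbar = (t / rbar - 1) *: (c rbar - x0).
    by rewrite scalerBl scale1r -xx0 opprB addrA subrK.
  rewrite enormZ cx -{2}(gtr0_norm rbar0) -normrM mulrBl divfK ?gt_eqF// mul1r.
  by rewrite ltr_norml; apply/andP; split; lra.
have ux : c' * t `^ s <= u x.
  have := h x; rewrite xt mul1r t0 tt1; apply=> //.
  rewrite xx0 dotvZl -sqr_enorm cx expr2 mulrA divfK// gt_eqF//.
have d_gt0 := dist_to_boundary_gt0 oO bO Ox.
have dt : dist_to (boundary Omega) x <= t by rewrite -xt; exact: dist_to_le.
(* Since x0 is a boundary point, d(x) <= |x - x0| = t, so dividing by d(x)^s instead of t^s only
   improves the lower bound. *)
have gxx : c' <= g x.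
  rewrite -gE ?inE// ler_pdivlMr ?powR_gt0//; apply: le_trans ux.
  rewrite ler_wpM2l ?(ltW c'0)//; have /andP[s0 _] := s01.
  apply: ge0_ler_powR => //; first exact: ltW.
  - by rewrite nnegrE ltW.
  - by rewrite nnegrE ltW.
have : `|g x0 - g x| < c' - g x0 by apply: gd; [rewrite eballE xt|left].
by rewrite ltr_norml => /andP[]; lra.
Qed.
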